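(* Let $d\in\mathbb{N}$, $1<p<\infty$ and $r>\frac1p$. Then there exists a constant $C_{r,p,d}>0$ such that $$\varrho_{\lceil C_{r,p,d}\,n\log(n+1)^3\rceil}(S^r_pW(\mathbb{T}^d))_{L^2(\mathbb{T}^d)}\lesssim\sigma_n(S^r_pW(\mathbb{T}^d);\mathcal{T}^d)_{L^\infty(\mathbb{T}^d)}.$$
   Context: $\mathbb{T}^d=\mathbb{R}^d/\mathbb{Z}^d$ with normalized Haar measure; $L^\infty(\mathbb{T}^d)$ is the space of bounded measurable functions with the supremum norm (no a.e. identification). $\mathcal{T}^d=(\mathrm{e}^{2\pi\mathrm{i}\langle k,\cdot\rangle})_{k\in\mathbb{Z}^d}$. $\log$ is the natural logarithm. Sobolev space of mixed smoothness: let $F_r(x)=\sum_{k\in\mathbb{Z}}\max\{1,|k|\}^{-r}\mathrm{e}^{-2\pi\mathrm{i}kx}$ for $x\in\mathbb{T}$ and $F_r(x)=\prod_{j=1}^dF_r(x_j)$ for $x\in\mathbb{T}^d$. For $r>0$, $1<p<\infty$, $S^r_pW(\mathbb{T}^d)$ is the space of all $f\in L^p(\mathbb{T}^d)$ of the form $f=F_r\ast\varphi=\int_{\mathbb{T}^d}F_r(\cdot-y)\varphi(y)\,\mathrm{d}y$ with $\varphi\in L^p(\mathbb{T}^d)$, normed by $\|f\|_{S^r_pW(\mathbb{T}^d)}=\|\varphi\|_{L^p(\mathbb{T}^d)}$. For $r>\frac1p$ every element has a continuous representative, with which it is identified. $\sigma_n(\mathcal{F};\mathcal{T}^d)_{L^\infty(\mathbb{T}^d)}=\sup_{\|f\|_{\mathcal{F}}\le1}\inf\{\|f-\sum_{k\in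 J}c_k\mathrm{e}^{2\pi\mathrm{i}\langle k,\cdot\rangle}\|_{L^\infty(\mathbb{T}^d)}:J\subset\mathbb{Z}^d,|J|\le n,(c_k)\in\mathbb{C}^J\}$. Sampling numbers: $\varrho_m(\mathcal{F})_X=\inf_{t_1,\ldots,t_m\in\mathbb{T}^d}\inf_{R:\mathbb{C}^m\to X}\sup_{\|f\|_{\mathcal{F}}\le1}\|f-R(f(t_1),\ldots,f(t_m))\|_X$, with $R$ ranging over all (not necessarily linear) maps. $a_n\lesssim b_n$ means $a_n\le c\,b_n$ for all $n\in\mathbb{N}$ with a constant $c>0$ independent of $n$ (it may depend on $r,p,d$). *)

(* Defs.v *)
(* A function on T^d = R^d/Z^d is a Z^d-periodic function
   on R^d, and a point of T^d is given by any representative in R^d. *)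
From HB Require Import structures.
From mathcomp Require Export all_boot all_order all_algebra.
From mathcomp Require Export all_classical all_reals all_analysis.
From mathcomp Require Export finmap complex.

Set Implicit Arguments.
Unset Strict Implicit.
Unset Printing Implicit Defensive.

Export Order.TTheory GRing.Theory Num.Theory numFieldNormedType.Exports.
Export ComplexField.Normc.

Global Open Scope classical_set_scope.
Global Open Scope ring_scope.

Section haar.
Context {R : realType}.

Definition cons_tuple_prod (d : nat)
    (x : measurableTypeR R * d.-tuple (measurableTypeR R)) :
    d.+1.-tuple (measurableTypeR R) := [the _.-tuple _ of x.1 :: x.2].

Lemma measurable_cons_tuple_prod d :
  measurable_fun [set: measurableTypeR R * d.-tuple (measurableTypeR R)]
    (@cons_tuple_prod d).
Proof. exact: measurable_cons measurable_fst measurable_snd. Qed.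

HB.instance Definition _ d := isMeasurableFun.Build _ _ _ _
  (@cons_tuple_prod d) (@measurable_cons_tuple_prod d).

(* The d-fold product of the uniform probability on [0, 1]: Lebesgue measure
   on the fundamental domain, i.e. the normalized Haar measure of T^d. *)
Fixpoint haar (d : nat) : probability (d.-tuple (measurableTypeR R)) R :=
  match d with
  | 0 => dirac [tuple]
  | d'.+1 => distribution
      (product_measure1 (uniform_prob (@ltr01 R)) (haar d') : probability _ _)
      (@cons_tuple_prod d')
  end.

End haar.

Section torus_functions.
Context {R : realType} {d : nat}.
Implicit Types (f phi : 'rV[R]_d -> R[i]) (p : R).

Definition torus_point (t : d.-tuple (measurableTypeR R)) : 'rV[R]_d :=
  \row_j tnth t j.

Definition torus_fun f : Prop :=
  forall (x : 'rV[R]_d) (k : 'rV[int]_d), f (x + map_mx intr k) = f x.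

Definition torus_measurable f : Prop :=
  measurable_fun setT (fun t => complex.Re (f (torus_point t)) : R) /\
  measurable_fun setT (fun t => complex.Im (f (torus_point t)) : R).

Definition torus_integral f : R[i] :=
  (Rintegral (haar d) setT (fun t => complex.Re (f (torus_point t))) +i*
   Rintegral (haar d) setT (fun t => complex.Im (f (torus_point t))))%C.

Definition Lp_norm p f : \bar R :=
  Lnorm (haar d) p%:E (fun t => (normc (f (torus_point t)))%:E).

Definition Lp_space p : set ('rV[R]_d -> R[i]) :=
  [set f | torus_fun f /\ torus_measurable f /\ (Lp_norm p f < +oo)%E].

Definition sup_norm f : \bar R :=
  ereal_sup [set (normc (f x))%:E | x in [set: 'rV[R]_d]].

End torus_functions.

Section trigonometric.
Context {R : realType}.

Definition expi2pi (x : R) : R[i] := (cos (2 * pi * x) +i* sin (2 * pi * x))%C.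

Definition trig_char d (k : 'rV[int]_d) (x : 'rV[R]_d) : R[i] :=
  expi2pi (\sum_j (k 0 j)%:~R * x 0 j).

(* Symmetric partial sums, over -n <= k <= n.  For 0 < r <= 1 the series
   converges only conditionally, and it diverges at x in Z; lim takes a junk
   value on that null set. *)
Definition F_partial (r x : R) (n : nat) : R[i] :=
  \sum_(0 <= j < (2 * n).+1) let k : int := j%:Z - n%:Z in
    (((Num.max 1 `|k|%:~R) `^ (- r))%:C)%C * expi2pi (- (k%:~R * x)).

Definition F1 (r x : R) : R[i] := lim ((F_partial r x : nat -> R[i]^o) @ \oo).

Definition F_kernel (r : R) d (x : 'rV[R]_d) : R[i] := \prod_j F1 r (x 0 j).

Definition F_conv (r : R) d (phi : 'rV[R]_d -> R[i]) (x : 'rV[R]_d) : R[i] :=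
  torus_integral (fun y => F_kernel r (x - y) * phi y).

(* phi is a density of f: phi is in L^p and the continuous function f is the
   continuous representative of F_r * phi. *)
Definition SW_density (r p : R) d (f : 'rV[R]_d -> R[i]) :
    set ('rV[R]_d -> R[i]) :=
  [set phi | Lp_space p phi /\
     {ae haar d, forall t,
       f (torus_point t) = F_conv r phi (torus_point t)}].

Definition SW_space (r p : R) d : set ('rV[R]_d -> R[i]) :=
  [set f | torus_fun f /\ continuous (f : 'rV[R]_d -> R[i]^o) /\
     exists phi, SW_density r p f phi].

(* All Fourier coefficients of F_r are nonzero, so phi is unique up to a null
   set and the infimum is over a single value.  The norm is +oo exactly
   outside the space. *)
Definition SW_norm (r p : R) d (f : 'rV[R]_d -> R[i]) : \bar R :=
  ereal_inf [set Lp_norm p phi |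
    phi in [set phi | SW_space r p f /\ SW_density r p f phi]].

End trigonometric.

(* A normed function space on T^d is given by its norm N, equal to +oo off the
   space. *)
Section approximation_quantities.
Context {R : realType} {d : nat}.
Variable N : ('rV[R]_d -> R[i]) -> \bar R.

Definition best_nterm_width (n : nat) : \bar R :=
  ereal_sup [set
    ereal_inf [set sup_norm (fun x => f x - \sum_(k <- J) c k * trig_char k x) |
      J in [set J : {fset 'rV[int]_d} | (#|` J| <= n)%N] &
      c in [set: 'rV[int]_d -> R[i]]]
    | f in [set f | (N f <= 1)%E]].

Definition sampling_number (q : R) (m : nat) : \bar R :=
  ereal_inf [set
    ereal_sup [set Lp_norm q (fun x => f x - Rec (\row_i f (t i)) x) |
      f in [set f | (N f <= 1)%E]]
    | t in [set: 'I_m -> 'rV[R]_d] &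
      Rec in [set Rec : 'rV[R[i]]_m -> 'rV[R]_d -> R[i] |
        forall z, Lp_space q (Rec z)]].

End approximation_quantities.

(* Main.v *)
(* Take as recovery of f any g in the unit ball with the same samples.  Both f
   and g lie within 2 sigma_n of n-sparse trigonometric polynomials and, at a
   rate polynomial in K, of polynomials with frequencies in [-K, K]^d.  On the
   grid (Z/L)^d, L > 2K, characters alias to grid characters, so there f - g is
   uniformly close to a 2n-sparse combination of a bounded orthonormal system.
   The sampling points are grid points at which every such combination with
   small values has small L2 norm: this one-sided discretization costs only
   n log(n+1)^3 points, since some dyadic level set of a normalized sparse
   combination is large, Maurey's method approximates the combination at that
   level by one from a small finite family, and by a union bound over the family
   some tuple of points meets all these large level sets.  As f and g agree
   at these points, f - g is O(sigma_n) in L2 of the grid, hence in L2 of the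
   torus.  The tail of F_r is bounded away from Z by Abel summation against
   Dirichlet kernels and near Z by a singular power, so that Hoelder's inequality
   gives the polynomial rate; as sigma_n is itself at least a negative power of
   n, K and L polynomial in n suffice. *)
Require Import Defs.
From mathcomp Require Import measurable_realfun ring lra zify.

Set Implicit Arguments.
Unset Strict Implicit.
Unset Printing Implicit Defensive.

(** The best approximants may use arbitrarily high frequencies, so no finite dictionary contains
    them; folding them onto the L^d residue classes modulo L keeps their sparsity and their values
    on the grid, and makes the union bound finite. Each sparse combination needs only one large
    sample, so hitting probabilities are enough and no concentration of empirical norms enters. A
    level set where the squared modulus is about u is only known to have density about 1 / (u log
    n), but there an error of order sqrt u is allowed, so Maurey's method needs only about (n / u)
    log n atoms: the factors u cancel, and every level costs the same number of points. The three
    logarithms are the number of levels, the accuracy of Maurey's method at all grid points at once,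
    and the entropy of each atom; the last two are logarithms of the grid size, polynomial in n. The
    condition r > 1/p enters through the kernel: some alpha must satisfy both r + alpha > 1, for
    decay of the tail, and alpha q < 1 with q conjugate to p, for q-integrability of the singularity
    |sin (pi x)|^(-alpha). *)

Section complex_modulus.
Context {R : realType}.
Implicit Types x y z : R[i].

Lemma normc_ge0 z : 0 <= normc z.
Proof. by case: z => a b; rewrite sqrtr_ge0. Qed.

Lemma sqr_normcE z : normc z ^+ 2 = complex.Re z ^+ 2 + complex.Im z ^+ 2.
Proof. by case: z => a b; rewrite /= sqr_sqrtr// addr_ge0 ?sqr_ge0. Qed.

Lemma ler_normcD x y : normc (x + y) <= normc x + normc y.
Proof. exact: le_normcD. Qed.

Lemma normc_opp z : normc (- z) = normc z.
Proof. exact: normcN. Qed.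

Lemma ler_normcB x y : normc (x - y) <= normc x + normc y.
Proof. by rewrite -[normc y]normc_opp ler_normcD. Qed.

Lemma normc_distC x y : normc (x - y) = normc (y - x).
Proof. by rewrite -normc_opp opprB. Qed.

Lemma ler_normc_sum (I : Type) (s : seq I) (P : pred I) (F : I -> R[i]) :
  normc (\sum_(i <- s | P i) F i) <= \sum_(i <- s | P i) normc (F i).
Proof.
elim/big_rec2 : _ => [|i y x _ h]; first by rewrite normc0.
by rewrite (le_trans (ler_normcD _ _))// lerD2l.
Qed.

Lemma normc_real (a : R) : normc (a%:C)%C = `|a|.
Proof. by rewrite /= expr0n/= addr0 sqrtr_sqr. Qed.

Lemma normc_prod (I : finType) (F : I -> R[i]) :
  normc (\prod_i F i) = \prod_i normc (F i).
Proof. by elim/big_rec2 : _ => [|i y x _ <-]; rewrite ?normc1// normcM. Qed.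

Lemma ler_norm_Re z : `|complex.Re z| <= normc z.
Proof. by case: z => a b /=; rewrite -sqrtr_sqr ler_wsqrtr// lerDl sqr_ge0. Qed.

Lemma ler_norm_Im z : `|complex.Im z| <= normc z.
Proof. by case: z => a b /=; rewrite -sqrtr_sqr ler_wsqrtr// lerDr sqr_ge0. Qed.

Lemma normc_le_ReIm z : normc z <= `|complex.Re z| + `|complex.Im z|.
Proof.
case: z => a b; have -> : (a +i* b)%C = (a%:C + (0 +i* b))%C :> R[i].
  by apply/eqP; rewrite eq_complex /= addr0 add0r !eqxx.
rewrite (le_trans (ler_normcD _ _))// normc_real /= addr0 add0r lerD2l.
by rewrite expr0n add0r sqrtr_sqr.
Qed.

Lemma Re_add x y : complex.Re (x + y) = complex.Re x + complex.Re y.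
Proof. by case: x y => [a b] []. Qed.

Lemma Im_add x y : complex.Im (x + y) = complex.Im x + complex.Im y.
Proof. by case: x y => [a b] []. Qed.

Lemma Re_opp x : complex.Re (- x) = - complex.Re x.
Proof. by case: x. Qed.

Lemma Im_opp x : complex.Im (- x) = - complex.Im x.
Proof. by case: x. Qed.

Lemma Re_mul x y : complex.Re (x * y) =
  complex.Re x * complex.Re y - complex.Im x * complex.Im y.
Proof. by case: x y => [a b] []. Qed.

Lemma Im_mul x y : complex.Im (x * y) =
  complex.Re x * complex.Im y + complex.Im x * complex.Re y.
Proof. by case: x y => [a b] []. Qed.

Lemma Re_sum (I : Type) (s : seq I) (P : pred I) (F : I -> R[i]) :
  complex.Re (\sum_(i <- s | P i) F i) = \sum_(i <- s | P i) complex.Re (F i).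
Proof. by elim/big_rec2 : _ => // i y x _ <-; rewrite Re_add. Qed.

Lemma Im_sum (I : Type) (s : seq I) (P : pred I) (F : I -> R[i]) :
  complex.Im (\sum_(i <- s | P i) F i) = \sum_(i <- s | P i) complex.Im (F i).
Proof. by elim/big_rec2 : _ => // i y x _ <-; rewrite Im_add. Qed.

Lemma eq_complexP x y : complex.Re x = complex.Re y ->
  complex.Im x = complex.Im y -> x = y.
Proof. by case: x y => [a b] [c d] /= -> ->. Qed.

End complex_modulus.

Section integer_periods.
Context {R : realType}.

Lemma periodic_int (f : R -> R) (T : R) : periodic f T ->
  forall (z : int) a, f (a + T * z%:~R) = f a.
Proof.
move=> fT [n|n] a; first by rewrite mulr_natr periodicn.
rewrite NegzE mulrNz mulrN -[in RHS](subrK (T * n.+1%:R) a) mulr_natr.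
by rewrite (periodicn fT).
Qed.

Lemma sin_2pi_int (z : int) (y : R) : sin (2 * pi * z%:~R + y) = sin y.
Proof. by rewrite mulr_natl addrC periodic_int//; exact: sinD2pi. Qed.

Lemma cos_2pi_int (z : int) (y : R) : cos (2 * pi * z%:~R + y) = cos y.
Proof. by rewrite mulr_natl addrC periodic_int//; exact: cosD2pi. Qed.

Lemma norm_sin_pi_int (z : int) (y : R) : `|sin (pi * (y + z%:~R))| = `|sin (pi * y)|.
Proof.
rewrite mulrDr (@periodic_int (fun x => `|sin x|))// => a.
by rewrite sinDpi normrN.
Qed.

End integer_periods.

(** * Maurey approximation *)

Section maurey.
Context {R : realType}.

(** From exp(-x/2) >= 1 - x/2 follows exp(x) (1 - x/2)^2 <= 1, and the quadratic times (1 - x/2)^2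
    is at least 1. The factor 4 is generous. *)
Lemma expR_le_quadratic (x : R) : `|x| <= 1 -> expR x <= 1 + x + 4 * x ^+ 2.
Proof.
rewrite ler_norml => /andP[x1 x2].
have E0 := expR_gt0 (x / 2).
have : 1 - x / 2 <= (expR (x / 2))^-1 by rewrite -expRN; exact: expR_ge1Dx.
rewrite -(ler_pM2l E0) divff ?gt_eqF// => Ey.
have -> : expR x = expR (x / 2) ^+ 2 by rewrite -expRM_natl; congr expR; field.
have EE : expR (x / 2) ^+ 2 * (1 - x / 2) ^+ 2 <= 1.
  by rewrite -exprMn expr_le1// mulr_ge0; lra.
have y2 : 0 < (1 - x / 2) ^+ 2 by rewrite exprn_gt0; lra.
rewrite -(ler_pM2r y2); apply: le_trans EE _.
have -> : (1 + x + 4 * x ^+ 2) * (1 - x / 2) ^+ 2 =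
  1 + x ^+ 2 / 4 * (16 * (x / 2) ^+ 2 - 30 * (x / 2) + 13) by field.
rewrite lerDl mulr_ge0 ?divr_ge0 ?sqr_ge0//.
nra.
Qed.

Lemma exists_le_average (W : finType) (p g : W -> R) (c : R) :
  (forall w, 0 <= p w) -> \sum_w p w = 1 -> \sum_w p w * g w <= c ->
  exists w, g w <= c.
Proof.
move=> p0 p1 pg; apply: contrapT => /forallNP h.
have gc w : c < g w by rewrite ltNge; apply/negP/h.
have F0 w : true -> 0 <= p w * (g w - c) by move=> _; rewrite mulr_ge0// subr_ge0 ltW.
have h1 : \sum_w p w * (g w - c) = 0.
  apply/eqP; rewrite eq_le sumr_ge0// andbT.
  under eq_bigr do rewrite mulrBr.
  by rewrite sumrB -mulr_suml p1 mul1r subr_le0.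
have : \sum_w p w = 0.
  apply: big1 => w _; have /eqP : p w * (g w - c) = 0 by exact: (psumr_eq0P F0 h1).
  by rewrite mulf_eq0 subr_eq0 (gt_eqF (gc w)) orbF => /eqP.
by rewrite p1 => /eqP; rewrite oner_eq0.
Qed.

Section potential.
Variables (A W : finType) (v : W -> A -> R) (p : W -> R) (lam : R).
Hypotheses (v1 : forall w a, `|v w a| <= 1) (p0 : forall w, 0 <= p w)
  (p1 : \sum_w p w = 1) (lam0 : 0 <= lam) (lam1 : 2 * lam <= 1).

Let X a := \sum_w p w * v w a.

Let X1 a : `|X a| <= 1.
Proof.
apply: (le_trans (ler_norm_sum _ _ _)); rewrite -p1; apply: ler_sum => w _.
by rewrite normrM ger0_norm// ler_piMr.
Qed.

(** The first-order term averages to zero because [X a] is the mean of [v w a]. The deviation is at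
    most 2, so the second-order term is at most 4 (2 lam)^2. *)
Let expected_step (s : R) a : `|s| = 1 ->
  \sum_w p w * expR (lam * s * (v w a - X a)) <= 1 + 16 * lam ^+ 2.
Proof.
move=> s1.
apply: (@le_trans _ _ (\sum_w (p w * (1 + 16 * lam ^+ 2) +
   lam * s * (p w * v w a - p w * X a)))).
  apply: ler_sum => w _.
  have -> : p w * (1 + 16 * lam ^+ 2) + lam * s * (p w * v w a - p w * X a) =
    p w * (1 + lam * s * (v w a - X a) + 16 * lam ^+ 2) by ring.
  apply: ler_wpM2l => //.
  have d2 : `|v w a - X a| <= 2.
    by apply: (le_trans (ler_normB _ _)); have := v1 w a; have := X1 a; lra.
  have le : `|lam * s * (v w a - X a)| <= 2 * lam.
    by rewrite !normrM s1 mulr1 (ger0_norm lam0) mulrC ler_wpM2r.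
  have le1 : `|lam * s * (v w a - X a)| <= 1 by exact: le_trans le lam1.
  apply: (le_trans (expR_le_quadratic le1)).
  rewrite lerD2l -real_normK ?num_real//.
  have : `|lam * s * (v w a - X a)| ^+ 2 <= (2 * lam) ^+ 2 by rewrite lerXn2r ?nnegrE// mulr_ge0.
  by rewrite exprMn; lra.
rewrite big_split/= -mulr_suml p1 mul1r -mulr_sumr sumrB -mulr_suml p1 mul1r.
by rewrite subrr mulr0 addr0.
Qed.

(** Summing over both signs and over all of [A] turns a bound on one number into a bound on the
    absolute value of every coordinate, in the manner of a union bound. *)
Let Phi (y : A -> R) := \sum_a (expR (lam * y a) + expR (- (lam * y a))).

Lemma potential_step (y : A -> R) : exists w,
  Phi (fun a => v w a - X a + y a) <= (1 + 16 * lam ^+ 2) * Phi y.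
Proof.
apply: (@exists_le_average _ p) => //.
under eq_bigr do rewrite mulr_sumr.
rewrite exchange_big/= mulr_sumr; apply: ler_sum => a _.
have -> : \sum_w p w * (expR (lam * (v w a - X a + y a)) +
    expR (- (lam * (v w a - X a + y a)))) =
  expR (lam * y a) * (\sum_w p w * expR (lam * 1 * (v w a - X a))) +
  expR (- (lam * y a)) * (\sum_w p w * expR (lam * -1 * (v w a - X a))).
  rewrite !mulr_sumr -big_split/=; apply: eq_bigr => w _.
  rewrite mulrDr; congr (_ + _); rewrite mulrCA -expRD; congr (_ * expR _); ring.
rewrite mulrDr ![(1 + 16 * _) * _]mulrC.
apply: lerD; apply: ler_wpM2l; rewrite ?expR_ge0//;
  by apply: expected_step; rewrite ?normrN normr1.
Qed.

Lemma potential_iter (q : nat) : exists w : q.-tuple W,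
  Phi (fun a => \sum_(x <- w) (v x a - X a)) <=
    2 * #|A|%:R * (1 + 16 * lam ^+ 2) ^+ q.
Proof.
elim: q => [|q [w hw]].
  exists [tuple]; rewrite /Phi; under eq_bigr do rewrite big_nil mulr0 oppr0 expR0.
  by rewrite sumr_const expr0 mulr1 mulr_natr; exact: lexx.
have [x hx] := potential_step (fun a => \sum_(x <- w) (v x a - X a)).
exists [tuple of x :: w].
rewrite /Phi; under eq_bigr do rewrite big_cons.
apply: (le_trans hx); rewrite (exprS _ q) [leRHS]mulrCA ler_wpM2l//.
by rewrite addr_ge0 ?mulr_ge0 ?sqr_ge0.
Qed.

Lemma potential_bound (q : nat) : (0 < #|A|)%N -> exists w : q.-tuple W,
  forall a, lam * `|\sum_(x <- w) v x a - q%:R * X a| <=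
    ln (2 * #|A|%:R) + 16 * lam ^+ 2 * q%:R.
Proof.
move=> A0; have [w hw] := potential_iter q; exists w => a.
have -> : \sum_(x <- w) v x a - q%:R * X a = \sum_(x <- w) (v x a - X a).
  by rewrite sumrB big_const_seq count_predT size_tuple iter_addr_0 mulr_natl.
set S := \sum_(x <- w) _.
have A0' : 0 < 2 * #|A|%:R :> R by rewrite mulr_gt0 ?ltr0n.
rewrite -ler_expR expRD lnK ?posrE//.
apply: (@le_trans _ _ (2 * #|A|%:R * (1 + 16 * lam ^+ 2) ^+ q)); last first.
  rewrite ler_pM2l// [16 * _ * _]mulrC expRM_natl lerXn2r ?nnegrE ?expR_ge0//.
    by rewrite addr_ge0 ?mulr_ge0 ?sqr_ge0.
  exact: expR_ge1Dx.
apply: le_trans hw; rewrite /Phi (bigD1 a)//= -/S.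
apply: ler_wpDr; first by rewrite sumr_ge0// => i _; rewrite addr_ge0 ?expR_ge0.
have := expR_ge0 (lam * S); have := expR_ge0 (- (lam * S)).
by case: (leP 0 S) => S0; [rewrite ger0_norm//|rewrite ltr0_norm// mulrN]; lra.
Qed.

End potential.

(* Greedy choice decreases the average of the exponential potential, which is a
   derandomization of Maurey's empirical method. *)
Lemma maurey_approximation (A W : finType) (v : W -> A -> R) (p : W -> R)
    (eps : R) (q : nat) : (0 < #|A|)%N ->
  (forall w a, `|v w a| <= 1) -> (forall w, 0 <= p w) -> \sum_w p w = 1 ->
  0 < eps -> eps <= 1 -> 64 * ln (2 * #|A|%:R) <= q%:R * eps ^+ 2 ->
  exists w : q.-tuple W, forall a,
    `|\sum_(x <- w) v x a - q%:R * \sum_x p x * v x a| <= q%:R * eps.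
Proof.
move=> A0 v1 p0 p1 e0 e1 hq.
have l0 : 0 < eps / 32 by lra.
(* With lam = eps / 32 the quadratic term is q eps^2 / 64, and the logarithm is at most the same by
   [hq]; together they make lam times q eps. *)
have [||w hw] := @potential_bound A W v p (eps / 32) v1 p0 p1 _ _ q A0; [lra|lra|].
exists w => a; have := hw a; set S := `|_ - _| => hS.
rewrite -(ler_pM2l l0); apply: (le_trans hS).
rewrite !expr2 in hq *; nra.
Qed.

End maurey.

(** * Hitting tuples and sparse discretization *)

Section hitting.
Context {R : realType}.

(** Union bound by counting: a set of density at least delta is missed by a fraction at most (1 -
    delta)^m <= exp(- delta m) of all tuples, and these fractions sum to less than one. Sets of
    smaller density are exempt. *)
Lemma exists_hitting_tuple (T I : finType) (S : I -> {set T}) (delta : I -> R)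
    (m : nat) : (0 < #|T|)%N ->
  \sum_i expR (- (delta i * m%:R)) < 1 ->
  exists t : 'I_m -> T, forall i, delta i * #|T|%:R <= #|S i|%:R ->
    exists j, t j \in S i.
Proof.
move=> T0 hsum; apply: contrapT => /forallNP bad.
pose miss i := [set t : {ffun 'I_m -> T} | [forall j, t j \notin S i]]%SET.
pose big i := delta i * #|T|%:R <= #|S i|%:R.
have cover : (#|{ffun 'I_m -> T}| <= \sum_(i | big i) #|miss i|)%N.
  rewrite -sum1_card; under [leqRHS]eq_bigr do rewrite -sum1_card.
  rewrite [leqRHS](exchange_big_dep xpredT)//=; apply: leq_sum => t _.
  have := bad t; rewrite -existsNE => -[i /not_implyP[bi /forallNP hi]].
  have ti : t \in miss i by rewrite inE; apply/forallP => j; exact/negP/hi.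
  by rewrite (bigD1 i) ?ti ?andbT ?bi.
have T0' : 0 < #|T|%:R :> R by rewrite ltr0n.
have missle i : big i -> #|miss i|%:R <=
    #|T|%:R ^+ m * expR (- (delta i * m%:R)) :> R.
  move=> bi.
  have -> : #|miss i| = (#|~: S i| ^ m)%N.
    rewrite -[in RHS](card_ord m) -card_ffun_on; apply: eq_card => t.
    by rewrite inE; apply/forallP/ffun_onP => h j; have := h j; rewrite inE.
  have -> : #|T|%:R ^+ m * expR (- (delta i * m%:R)) =
      (#|T|%:R * expR (- delta i)) ^+ m by rewrite exprMn -expRM_natr mulNr.
  rewrite natrX lerXn2r ?nnegrE ?mulr_ge0 ?expR_ge0//.
  rewrite cardsCs finset.setCK natrB ?max_card//.
  apply: (@le_trans _ _ (#|T|%:R * (1 - delta i))); last first.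
    by rewrite ler_pM2l// expR_ge1Dx.
  by rewrite mulrBr mulr1 lerD2l lerN2 mulrC.
have : #|{ffun 'I_m -> T}|%:R < #|T|%:R ^+ m :> R.
  apply: (@le_lt_trans _ _ (\sum_(i | big i) #|miss i|)%:R); first by rewrite ler_nat.
  rewrite natr_sum; apply: (@le_lt_trans _ _
    (\sum_i #|T|%:R ^+ m * expR (- (delta i * m%:R)))).
    rewrite [leRHS](bigID big)/= -[leLHS]addr0; apply: lerD.
      exact: ler_sum.
    by apply: sumr_ge0 => i _; rewrite mulr_ge0 ?expR_ge0 ?exprn_ge0// ltW.
  by rewrite -mulr_sumr -[ltRHS]mulr1 ltr_pM2l// exprn_gt0.
by rewrite card_ffun card_ord natrX ltxx.
Qed.

(** A value above 1/2 lies between 2^j / 2 and 2^j for some j <= J, and the term of that j alone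
    dominates it. The induction drops the top level when x is below its threshold. *)
Lemma le_dyadic_sum (x : R) (J : nat) : 0 <= x -> x <= 2 ^+ J ->
  x <= 2^-1 + \sum_(j < J.+1) 2 ^+ j * (2 ^+ j / 2 <= x)%R%:R.
Proof.
move=> x0; elim: J => [|J IH] xJ.
  rewrite big_ord1 expr0 mul1r; rewrite expr0 in xJ; case: (leP (1 / 2) x) => h /=; lra.
rewrite big_ord_recr/=; case: (leP (2 ^+ J.+1 / 2) x) => [h|h].
  have : 0 <= \sum_(j < J.+1) 2 ^+ j * (2 ^+ j / 2 <= x)%R%:R :> R.
    by apply: sumr_ge0 => j _; rewrite mulr_ge0 ?exprn_ge0.
  by rewrite mulr1; lra.
rewrite mulr0 addr0; apply: IH; move: h; rewrite exprS; lra.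
Qed.

(** Pigeonhole on [le_dyadic_sum]: X has mean one and the additive 1/2 accounts for only half of it,
    so one of the J + 1 levels carries its share of the other half. *)
Lemma exists_dyadic_level (T : finType) (X : T -> R) (J : nat) :
  (forall t, 0 <= X t <= 2 ^+ J) -> \sum_t X t = #|T|%:R ->
  exists j : 'I_J.+1,
    #|T|%:R <= 2 * J.+1%:R * 2 ^+ j * #|[set t | (2 ^+ j / 2 <= X t)%R]%SET|%:R
      :> R.
Proof.
move=> hX sX; apply: contrapT => /forallNP h.
have : #|T|%:R < #|T|%:R :> R; last by rewrite ltxx.
have h' (j : 'I_J.+1) : 2 ^+ j * #|[set t | (2 ^+ j / 2 <= X t)%R]%SET|%:R <
    #|T|%:R / (2 * J.+1%:R) :> R.
  rewrite ltr_pdivlMr ?mulr_gt0// mulrC mulrA ltNge; exact/negP/h.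
apply: (@le_lt_trans _ _ (\sum_(t : T) (2^-1 +
    \sum_(j < J.+1) 2 ^+ j * (2 ^+ j / 2 <= X t)%R%:R))).
  by rewrite -{1}sX; apply: ler_sum => t _; case/andP: (hX t); exact: le_dyadic_sum.
rewrite big_split/= sumr_const exchange_big/= -[_ *+ _]mulr_natl.
rewrite [ltRHS](_ : _ = #|T|%:R / 2 + \sum_(j < J.+1) #|T|%:R / (2 * J.+1%:R)); last first.
  by rewrite sumr_const card_ord -[_ *+ _]mulr_natl; field; rewrite nat1r pnatr_eq0.
rewrite ltrD2l; apply: ltr_sum => [|j _]; first by apply/hasP; exists ord0; rewrite ?mem_index_enum.
apply: le_lt_trans (h' j); rewrite -mulr_sumr ler_wpM2l ?exprn_ge0//.
rewrite -natr_sum ler_nat -sum1_card [leqRHS]big_mkcond/=; apply: leq_sum => t _.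
by rewrite inE; case: (_ <= _).
Qed.

End hitting.

(** * Discretization of sparse combinations of a bounded orthogonal system *)

Section sparse.
Context {R : realType}.
Variables (T K : finType) (e : K -> T -> R[i]).
Hypotheses (T0 : (0 < #|T|)%N) (TK : #|K| = #|T|).
Hypothesis (e1 : forall k t, normc (e k t) <= 1).

Definition combination (c : K -> R[i]) (t : T) : R[i] := \sum_k c k * e k t.

(** [x.2.1] selects the sign and [x.2.2] the factor i: with complex coefficients split into signed
    real and imaginary parts, a combination becomes a multiple of a convex combination of these
    atoms. *)
Definition signed_atom (x : K * (bool * bool)) (t : T) : R[i] :=
  (if x.2.1 then -1 else 1) * (if x.2.2 then 'i%C else 1) * e x.1 t.

Let part (b : bool) (z : R[i]) := if b then complex.Im z else complex.Re z.

Let sum_signed (F : K * (bool * bool) -> R) : \sum_x F x =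
  \sum_k (F (k, (true, true)) + F (k, (true, false)) +
         (F (k, (false, true)) + F (k, (false, false)))).
Proof.
rewrite (eq_bigr (fun x => F (x.1, x.2))); last by case.
rewrite -(pair_bigA _ (fun k b => F (k, b)))/=; apply: eq_bigr => k _.
rewrite (eq_bigr (fun x => F (k, (x.1, x.2)))); last by case.
by rewrite -(pair_bigA _ (fun b b' => F (k, (b, b'))))/= !big_bool.
Qed.

Lemma normc_signed_atom x t : normc (signed_atom x t) <= 1.
Proof.
rewrite !normcM.
have -> : normc (if x.2.1 then -1 else 1 : R[i]) = 1.
  by case: ifP => _; rewrite ?normc_opp normc1.
have -> : normc (if x.2.2 then 'i%C else 1 : R[i]) = 1.
  by case: ifP => _; rewrite ?normc1//= expr0n expr1n add0r sqrtr1.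
by rewrite !mul1r.
Qed.

(** Maurey's method over [T * bool], with real and imaginary parts as separate coordinates. Hence
    the 4 in the logarithm (two parts, two signs of the potential) and the 2 in the error (two parts
    added up). *)
Lemma combination_approximation (c : K -> R[i]) (B eps : R) (q : nat) :
  0 < B -> \sum_k (`|complex.Re (c k)| + `|complex.Im (c k)|) <= B ->
  0 < eps -> eps <= 1 -> 64 * ln (4 * #|T|%:R) <= q%:R * eps ^+ 2 ->
  exists w : q.-tuple (K * (bool * bool)), forall t,
    normc (combination c t - (B / q%:R)%:C%C * \sum_(x <- w) signed_atom x t)
      <= 2 * B * eps.
Proof.
move=> B0 cB eps0 eps1 hq.
have T0' : 0 < #|T|%:R :> R by rewrite ltr0n.
have q0 : 0 < q%:R :> R.
  rewrite -(@pmulr_lgt0 _ (eps ^+ 2)) ?exprn_gt0//; apply: lt_le_trans hq.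
  rewrite mulr_gt0// ln_gt0//.
  have N1 : 1 <= #|T|%:R :> R by rewrite ler1n.
  lra.
pose S := \sum_k (`|complex.Re (c k)| + `|complex.Im (c k)|).
(* The mass by which [S] falls short of [B] is spread evenly over the 4 |T| signed atoms, where
   opposite signs cancel. *)
pose pad := (1 - S / B) / (4 * #|T|%:R).
pose coef (k : K) (im : bool) := part im (c k).
pose p (x : K * (bool * bool)) :=
  (`|coef x.1 x.2.2| + (if x.2.1 then -1 else 1) * coef x.1 x.2.2) / (2 * B) + pad.
have pad0 : 0 <= pad by rewrite divr_ge0 ?mulr_ge0 ?subr_ge0 ?ler_pdivrMr ?mul1r// ltW.
have p0 x : 0 <= p x.
  rewrite addr_ge0// divr_ge0 ?(mulr_ge0 _ (ltW B0))//.
  by case: ifP => _; have := ler_norm (coef x.1 x.2.2);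
    have := ler_norm (- coef x.1 x.2.2); rewrite normrN; lra.
have p1 : \sum_x p x = 1.
  rewrite sum_signed/p/coef/=.
  rewrite (eq_bigr (fun k => (`|complex.Re (c k)| + `|complex.Im (c k)|) / B + 4 * pad)); last first.
    by move=> k _; field; rewrite gt_eqF.
  rewrite big_split/= -mulr_suml -/S sumr_const TK -mulr_natl /pad; field.
  by rewrite !gt_eqF.
pose v (x : K * (bool * bool)) (a : T * bool) := part a.2 (signed_atom x a.1).
have v1 x a : `|v x a| <= 1.
  by apply: le_trans (normc_signed_atom x a.1); rewrite /v /part; case: ifP => _;
    [exact: ler_norm_Im|exact: ler_norm_Re].
have pv a : \sum_x p x * v x a = part a.2 (combination c a.1) / B.
  rewrite sum_signed; case: a => t b /=.
  have -> : part b (combination c t) = \sum_k part b (c k * e k t).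
    by rewrite /part; case: b; rewrite /combination ?Re_sum ?Im_sum.
  rewrite mulr_suml; apply: eq_bigr => k _.
  rewrite /v /p /signed_atom /coef /part/=; case: b; rewrite !(Re_mul, Im_mul)/=; field;
    by rewrite gt_eqF.
have card2 : 2 * #|{: T * bool}|%:R = 4 * #|T|%:R :> R.
  by rewrite card_prod card_bool natrM; ring.
have A0 : (0 < #|{: T * bool}|)%N by rewrite card_prod card_bool muln_gt0 T0.
have [|w hw] := maurey_approximation (q := q) A0 v1 p0 p1 eps0 eps1.
  by rewrite card2.
exists w => t.
apply: (le_trans (normc_le_ReIm _)).
have key b : `|part b (combination c t - (B / q%:R)%:C%C * \sum_(x <- w) signed_atom x t)| <= B * eps.
  have := hw (t, b); rewrite pv/=.
  have -> : \sum_(x <- w) v x (t, b) = part b (\sum_(x <- w) signed_atom x t).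
    by rewrite /v /part; case: b; rewrite ?Re_sum ?Im_sum.
  set z := \sum_(x <- w) _; set s := combination c t => h.
  have -> : part b (s - (B / q%:R)%:C%C * z) = - (B / q%:R) * (part b z - q%:R * (part b s / B)).
    by case: b {h}; rewrite /part !(Re_add, Im_add, Re_opp, Im_opp, Re_mul, Im_mul)/=; field;
     rewrite !gt_eqF.
  have Bq : 0 <= B / q%:R by rewrite divr_ge0// ltW.
  rewrite normrM normrN (ger0_norm Bq).
  apply: (@le_trans _ _ (B / q%:R * (q%:R * eps))); first by rewrite ler_wpM2l.
  by rewrite mulrA divfK ?gt_eqF.
by have := key true; have := key false; rewrite /part; lra.
Qed.

Hypothesis parseval : forall c : K -> R[i],
  \sum_t normc (combination c t) ^+ 2 = #|T|%:R * \sum_k normc (c k) ^+ 2.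

(** Cauchy-Schwarz in the form |c k| <= (s / 2) |c k|^2 + 1 / (2 s) on the support, with s = sqrt
    n. *)
Lemma sparse_l1_norm (c : K -> R[i]) (n : nat) : (0 < n)%N ->
  (#|[pred k | c k != 0%R]| <= n)%N -> \sum_k normc (c k) ^+ 2 = 1 ->
  \sum_k normc (c k) <= Num.sqrt n%:R.
Proof.
move=> n0 cn c1; have s0 : 0 < Num.sqrt n%:R :> R by rewrite sqrtr_gt0 ltr0n.
have ss : Num.sqrt n%:R * Num.sqrt n%:R = n%:R :> R by rewrite -expr2 sqr_sqrtr.
set s := Num.sqrt _ in s0 ss *.
apply: (@le_trans _ _ (\sum_k (s / 2 * normc (c k) ^+ 2 + (c k != 0)%R%:R / (2 * s)))).
  apply: ler_sum => k _; case: eqVneq => [->|_]; first by rewrite normc0 expr0n/=; lra.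
  rewrite -subr_ge0.
  have -> : s / 2 * normc (c k) ^+ 2 + true%:R / (2 * s) - normc (c k) =
    (s * normc (c k) - 1) ^+ 2 / (2 * s) by rewrite /=; field; rewrite gt_eqF.
  by rewrite divr_ge0 ?sqr_ge0// mulr_ge0// ltW.
rewrite big_split/= -mulr_sumr c1 -mulr_suml -natr_sum.
have -> : (\sum_k (c k != 0)%R)%N = #|[pred k | c k != 0%R]|.
  by rewrite -sum1_card [RHS]big_mkcond.
rewrite -[leRHS](_ : s / 2 * 1 + n%:R / (2 * s) = s); last first.
  by rewrite -ss; field; rewrite gt_eqF.
by rewrite lerD2l ler_wpM2r ?ler_nat// invr_ge0 mulr_ge0// ltW.
Qed.

Lemma sparse_sup_norm (c : K -> R[i]) (n : nat) t : (0 < n)%N ->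
  (#|[pred k | c k != 0%R]| <= n)%N -> \sum_k normc (c k) ^+ 2 = 1 ->
  normc (combination c t) ^+ 2 <= n%:R.
Proof.
move=> n0 cn c1; rewrite -[leRHS]sqr_sqrtr// lerXn2r ?nnegrE ?normc_ge0 ?sqrtr_ge0//.
apply: le_trans (sparse_l1_norm n0 cn c1); apply: (le_trans (ler_normc_sum _ _ _)).
by apply: ler_sum => k _; rewrite normcM ler_piMr ?normc_ge0.
Qed.

(** At level j the number of Maurey approximants has logarithm [q j * Lam], of order (n / u j)
    Lam^2, while a set of density delta is hit with exponent delta m. Both scale as 1 / u j, so one
    m serves all levels. *)
Lemma sparse_sampling_normalized (n m : nat) : (0 < n)%N -> (n <= #|T|)%N ->
  4 * (64 * 256 + 3) * (up_log 2 n).+1%:R * n%:R * ln (4 * #|T|%:R) ^+ 2 <= m%:R :> R ->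
  exists t : 'I_m -> T, forall c : K -> R[i],
    (#|[pred k | c k != 0%R]| <= n)%N -> \sum_k normc (c k) ^+ 2 = 1 ->
    exists i, 1 <= 8 * normc (combination c (t i)) ^+ 2.
Proof.
move=> n0 nT hm; set J := up_log 2 n in hm.
have n0' : 1 <= n%:R :> R by rewrite ler1n.
have N1 : 1 <= #|T|%:R :> R by rewrite ler1n.
have nJ : n%:R <= 2 ^+ J :> R by rewrite -natrX ler_nat up_logP.
have Jn j : (j <= J)%N -> 2 ^+ j <= 2 * n%:R :> R.
  move=> jJ; rewrite -natrX -natrM ler_nat; apply: leq_trans (_ : 2 ^ J <= _)%N.
    by rewrite leq_exp2l.
  have [n1|n1] := leqP n 1.
    by rewrite /J (eqP (_ : n == 1)%N) ?up_log1// eqn_leq n1.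
  have := up_log_gtn (isT : 1 < 2)%N n1; rewrite -/J.
  have : (0 < J)%N by rewrite up_log_gt0.
  by case: (J) => // J' _; rewrite expnS /=; lia.
have J4 : J.+1%:R <= 4 * #|T|%:R :> R.
  rewrite -natrM ler_nat; apply: (@leq_trans n.+1); last by lia.
  by rewrite ltnS /J up_log_min// ltnW// ltn_expl.
set Lam := ln _ in hm.
have Lam1 : 1 <= Lam.
  rewrite /Lam -[leLHS]expRK ler_ln ?posrE ?expR_gt0//; last by lra.
  have -> : 1 = 2 * (1 / 2) :> R by lra.
  rewrite expRM_natl.
  have h : expR (1 / 2) <= 2 :> R.
    rewrite -[leLHS]invrK -expRN -[leRHS]invrK lef_pV2 ?posrE ?expR_gt0//.
    by have := expR_ge1Dx (- (1 / 2) : R); lra.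
  apply: (@le_trans _ _ (2 ^+ 2)); first by rewrite lerXn2r ?nnegrE// expR_ge0.
  by rewrite expr2; lra.
pose u (j : nat) : R := 2 ^+ j / 2.
have u0 j : 0 < u j by rewrite divr_gt0 ?exprn_gt0.
(* Real and imaginary parts are each at most |c k|, and the moduli sum to at most sqrt n. *)
pose B : R := 2 * Num.sqrt n%:R.
have BB : B ^+ 2 = 4 * n%:R by rewrite exprMn sqr_sqrtr// expr2; ring.
have B0 : 0 < B by rewrite mulr_gt0 ?sqrtr_gt0//; lra.
(* Makes the error 2 B eps of [combination_approximation] a quarter of sqrt (u j). *)
pose eps j := Num.sqrt (u j) / (8 * B).
have eps0 j : 0 < eps j by rewrite divr_gt0 ?sqrtr_gt0// mulr_gt0.
have epsE j : eps j ^+ 2 = u j / (256 * n%:R).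
  rewrite expr_div_n sqr_sqrtr ?(ltW (u0 j))// exprMn BB; congr (_ / _).
  by rewrite expr2; ring.
have uE j : (j <= J)%N -> u j <= n%:R by move=> /Jn; rewrite /u; lra.
have eps1 j : (j <= J)%N -> eps j <= 1.
  move=> jJ; rewrite -(@ler_pXn2r _ 2)// ?nnegrE ?(ltW (eps0 j))// expr1n epsE.
  by rewrite ler_pdivrMr ?mul1r; have := uE _ jJ; lra.
pose q j := (Num.truncn (64 * Lam / eps j ^+ 2)).+1.
have qge j : 64 * Lam <= (q j)%:R * eps j ^+ 2.
  by rewrite -ler_pdivrMr ?exprn_gt0// ltW// truncnS_gt.
have qle j : (q j)%:R <= 64 * 256 * Lam * n%:R / u j + 1.
  rewrite /q -natr1 lerD2r; apply: (@le_trans _ _ (64 * Lam / eps j ^+ 2)).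
    by rewrite truncn_le divr_ge0 ?sqr_ge0//; lra.
  by rewrite epsE le_eqVlt; apply/orP; left; apply/eqP; field; rewrite !gt_eqF//; lra.
pose g (j : nat) (w : seq (K * (bool * bool))) t :=
  (B / (q j)%:R)%:C%C * \sum_(x <- w) signed_atom x t.
pose I := {j : 'I_J.+1 & (q j).-tuple (K * (bool * bool))}.
(* With error at most a quarter of sqrt u, a combination of modulus at least sqrt u has its
   approximant above this threshold, and an approximant above it leaves the combination at least
   half of sqrt u. *)
pose S (i : I) := [set t | (3 / 4 * Num.sqrt (u (tag i)) <= normc (g (tag i) (tagged i) t))%R]%SET.
(* The density given by [exists_dyadic_level], as 2 * 2^j = 4 u j. *)
pose delta (i : I) : R := (4 * J.+1%:R * u (tag i))^-1.
have sum_small : \sum_i expR (- (delta i * m%:R)) < 1.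
  apply: (@le_lt_trans _ _ (\sum_(j < J.+1) \sum_(w : (q j).-tuple (K * (bool * bool)))
      expR (- ((4 * J.+1%:R * u j)^-1 * m%:R)))).
    by rewrite sig_big_dep/=.
  rewrite [ltRHS](_ : _ = \sum_(j < J.+1) J.+1%:R^-1); last first.
    by rewrite sumr_const card_ord -[RHS]mulr_natl divff.
  apply: ltr_sum => [|j _]; first by apply/hasP; exists ord0; rewrite ?mem_index_enum.
  have jJ : (j <= J)%N by rewrite -ltnS.
  rewrite sumr_const card_tuple !card_prod card_bool TK -[_ *+ _]mulr_natl.
  have N4 : 0 < 4 * #|T|%:R :> R by lra.
  have -> : ((#|T| * (2 * 2)) ^ q j)%:R = expR ((q j)%:R * Lam).
    by rewrite expRM_natl lnK ?posrE// natrX mulnC natrM.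
  rewrite -expRD; apply: (@lt_le_trans _ _ (4 * #|T|%:R)^-1); last first.
    by rewrite lef_pV2 ?posrE.
  rewrite -[ltRHS]lnK ?posrE ?invr_gt0// ltr_expR lnV ?posrE// -/Lam.
  have y1 : 1 <= n%:R / u j by rewrite ler_pdivlMr// mul1r uE.
  have mge : (64 * 256 + 3) * (n%:R / u j * Lam ^+ 2) <= (4 * J.+1%:R * u j)^-1 * m%:R.
    rewrite ler_pdivlMl ?mulr_gt0//; apply: le_trans hm.
    by rewrite le_eqVlt; apply/orP; left; apply/eqP; field; rewrite gt_eqF.
  have qL : (q j)%:R * Lam <= 64 * 256 * (n%:R / u j * Lam ^+ 2) + Lam.
    have -> : 64 * 256 * (n%:R / u j * Lam ^+ 2) + Lam =
      (64 * 256 * Lam * n%:R / u j + 1) * Lam by field; rewrite gt_eqF.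
    by rewrite ler_wpM2r ?qle// (le_trans ler01).
  have Lz : Lam <= n%:R / u j * Lam ^+ 2 by rewrite expr2; nra.
  (* Of the 3 added to 64 * 256, one pays for rounding [q j] up; the other two bring each level
     strictly below 1 / (4 |T|), hence below 1 / (J + 1). *)
  have fin (L z M Q : R) : 1 <= L -> (64 * 256 + 3) * z <= M ->
    Q <= 64 * 256 * z + L -> L <= z -> Q - M < - L by lra.
  exact: fin Lam1 mge qL Lz.
have [t ht] := @exists_hitting_tuple _ _ _ S _ _ T0 sum_small.
exists t => c cn c1.
have [j hj] : exists j : 'I_J.+1, #|T|%:R <= 2 * J.+1%:R * 2 ^+ j *
    #|[set t | (2 ^+ j / 2 <= normc (combination c t) ^+ 2)%R]%SET|%:R :> R.
  apply: exists_dyadic_level => [t'|].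
    by rewrite sqr_ge0/= (le_trans _ nJ)// (sparse_sup_norm _ n0).
  by rewrite parseval c1 mulr1.
have jJ : (j <= J)%N by rewrite -ltnS.
have [|w hw] := combination_approximation B0 _ (eps0 j) (eps1 _ jJ) (qge j) (c := c).
  apply: (@le_trans _ _ (\sum_k 2 * normc (c k))).
    apply: ler_sum => k _; have := ler_norm_Re (c k); have := ler_norm_Im (c k); lra.
  by rewrite -mulr_sumr ler_wpM2l// sparse_l1_norm.
have err t' : normc (combination c t' - g j w t') <= Num.sqrt (u j) / 4.
  apply: (le_trans (hw t')); rewrite /eps le_eqVlt; apply/orP; left; apply/eqP; field.
  by rewrite gt_eqF.
pose i : I := Tagged (fun j : 'I_J.+1 => (q j).-tuple (K * (bool * bool))) w.
have [|l] := ht i.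
  rewrite /delta/= mulrC ler_pdivrMr ?mulr_gt0//.
  apply: (le_trans hj); rewrite mulrC.
  have -> : 2 * J.+1%:R * 2 ^+ j = 4 * J.+1%:R * u j by rewrite /u; field.
  rewrite ler_pM2r ?mulr_gt0// ler_nat; apply/subset_leq_card/fintype.subsetP => t'.
  rewrite !inE => ut'; have := err t'.
  have := ler_normcD (g j w t') (combination c t' - g j w t').
  rewrite addrC subrK.
  have : Num.sqrt (u j) <= normc (combination c t').
    by rewrite -[leRHS]ger0_norm ?normc_ge0// -sqrtr_sqr ler_wsqrtr.
  lra.
rewrite inE/= => hl; exists l.
have := err (t l); have := ler_normcB (combination c (t l)) (combination c (t l) - g j w (t l)).
rewrite opprB addrCA subrr addr0 => h1 h2.
(* The square of this lower bound is 2^j / 8, smallest at j = 0: this is the 8 of the conclusion. *)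
have h3 : Num.sqrt (u j) / 2 <= normc (combination c (t l)) by lra.
have : (Num.sqrt (u j) / 2) ^+ 2 <= normc (combination c (t l)) ^+ 2.
  by rewrite lerXn2r ?nnegrE ?normc_ge0// divr_ge0// sqrtr_ge0.
rewrite expr_div_n sqr_sqrtr ?(ltW (u0 j))// /u.
have : 1 <= 2 ^+ j :> R by rewrite exprn_ege1// ler1n.
rewrite [2 ^+ 2]expr2; lra.
Qed.

(** By homogeneity: after division by the l2 norm, some sample has squared modulus at least 1/8,
    while all samples are bounded by b over that norm. *)
Theorem sparse_sampling (n m : nat) : (0 < n)%N -> (n <= #|T|)%N ->
  4 * (64 * 256 + 3) * (up_log 2 n).+1%:R * n%:R * ln (4 * #|T|%:R) ^+ 2 <= m%:R :> R ->
  exists t : 'I_m -> T, forall (c : K -> R[i]) (b : R),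
    (#|[pred k | c k != 0%R]| <= n)%N ->
    (forall i, normc (combination c (t i)) <= b) ->
    \sum_k normc (c k) ^+ 2 <= 8 * b ^+ 2.
Proof.
move=> n0 nT hm; have [t ht] := sparse_sampling_normalized n0 nT hm.
exists t => c b cn cb; set s2 := \sum_k _.
have s20 : 0 <= s2 by apply: sumr_ge0 => k _; exact: sqr_ge0.
have [s0|s0] := eqVneq s2 0; first by rewrite s0 mulr_ge0 ?sqr_ge0.
have {s20}s0 : 0 < s2 by rewrite lt_neqAle eq_sym s0.
pose a := (Num.sqrt s2)^-1; have a0 : 0 < a by rewrite invr_gt0 sqrtr_gt0.
have a2 : a ^+ 2 = s2^-1 by rewrite exprVn sqr_sqrtr// ltW.
have na : normc (a%:C)%C = a by rewrite normc_real gtr0_norm.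
have [||i hi] := ht (fun k => (a%:C)%C * c k).
- apply: leq_trans cn; apply/subset_leq_card/fintype.subsetP => k.
  by rewrite !inE; apply: contra => /eqP ->; rewrite mulr0.
- under eq_bigr do rewrite normcM na exprMn a2.
  by rewrite -mulr_sumr mulVf// gt_eqF.
have combE : combination (fun k => (a%:C)%C * c k) (t i) = (a%:C)%C * combination c (t i).
  by rewrite mulr_sumr; apply: eq_bigr => k _; rewrite mulrA.
move: hi; rewrite combE normcM na exprMn a2 mulrCA mulrC ler_pdivlMr// mul1r => /le_trans; apply.
have b0 : 0 <= b by apply: le_trans (cb i); exact: normc_ge0.
by rewrite ler_wpM2l// lerXn2r ?nnegrE ?normc_ge0.
Qed.

End sparse.

(** * The univariate kernel *)

Section power_differences.
Context {R : realType}.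
Implicit Types (s : R) (l : nat).

Lemma ln_ratio_ge l : l.+2%:R^-1 <= ln l.+2%:R - ln l.+1%:R :> R.
Proof.
have p1 : 0 < l.+1%:R :> R by rewrite ltr0n.
have p2 : 0 < l.+2%:R :> R by rewrite ltr0n.
have -> : ln l.+2%:R - ln l.+1%:R = - ln (1 + (- l.+2%:R^-1)) :> R.
  have -> : 1 + - l.+2%:R^-1 = l.+1%:R / l.+2%:R :> R.
    by rewrite -[l.+1%:R](addrK 1) natr1 mulrBl divff ?gt_eqF// mul1r.
  by rewrite ln_div ?posrE// opprB.
rewrite lerNr le_ln1Dx// ltrN2 invf_lt1//.
by rewrite ltr1n.
Qed.

Lemma ln_ratio_le l : ln l.+2%:R - ln l.+1%:R <= l.+1%:R^-1 :> R.
Proof.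
have p1 : 0 < l.+1%:R :> R by rewrite ltr0n.
have p2 : 0 < l.+2%:R :> R by rewrite ltr0n.
rewrite -ln_div ?posrE//.
have -> : l.+2%:R / l.+1%:R = 1 + l.+1%:R^-1 :> R.
  by rewrite -natr1 mulrDl divff ?gt_eqF// mul1r.
by rewrite le_ln1Dx// (@lt_trans _ _ 0) ?invr_gt0.
Qed.

Lemma powR_expR (x s : R) : 0 < x -> x `^ s = expR (s * ln x).
Proof. by move=> x0; rewrite /powR gt_eqF. Qed.

(** A discrete mean value estimate, from 1 + x <= exp x at x = s times the logarithm of a ratio of
    neighbours. *)
Lemma natr_powRN_sub_ge s l : 0 < s ->
  s / l.+2%:R * l.+2%:R `^ (- s) <= l.+1%:R `^ (- s) - l.+2%:R `^ (- s).
Proof.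
move=> s0; rewrite !powR_expR ?ltr0n//.
have -> : - s * ln l.+1%:R = - s * ln l.+2%:R + s * (ln l.+2%:R - ln l.+1%:R) by ring.
rewrite expRD; have := expR_gt0 (- s * ln l.+2%:R); set E := expR _ => E0.
have := expR_ge1Dx (s * (ln l.+2%:R - ln l.+1%:R)); set F := expR _ => hF.
rewrite [E * F]mulrC -[leRHS](_ : (F - 1) * E = _); last by ring.
rewrite ler_pM2r// lerBrDl; apply: le_trans hF.
by rewrite lerD2l ler_wpM2l ?ln_ratio_ge// ltW.
Qed.

Lemma natr_powRN_sub_le s l : 0 < s ->
  l.+1%:R `^ (- s) - l.+2%:R `^ (- s) <= s / l.+1%:R * l.+1%:R `^ (- s).
Proof.
move=> s0; rewrite !powR_expR ?ltr0n//.
have -> : - s * ln l.+2%:R = - s * ln l.+1%:R + - (s * (ln l.+2%:R - ln l.+1%:R)) by ring.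
rewrite expRD; have := expR_gt0 (- s * ln l.+1%:R); set E := expR _ => E0.
have := expR_ge1Dx (- (s * (ln l.+2%:R - ln l.+1%:R))); set F := expR _ => hF.
rewrite -[leLHS](_ : (1 - F) * E = _); last by ring.
rewrite ler_pM2r// lerBlDl -lerBlDr; apply: le_trans hF.
by rewrite lerD2l lerN2 ler_wpM2l ?ln_ratio_le// ltW.
Qed.

(* Abel summation against Dirichlet sums of size l^(1-alpha) thus telescopes
   when eta = r + alpha - 1 is positive. *)
Lemma natr_powRN_telescope (r eta : R) l : 0 < r -> 0 < eta ->
  (l.+1%:R `^ (- r) - l.+2%:R `^ (- r)) * l.+1%:R `^ (r - eta) <=
  r * 2 `^ (eta + 1) / eta * (l.+1%:R `^ (- eta) - l.+2%:R `^ (- eta)).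
Proof.
move=> r0 eta0.
have p1 : 0 < l.+1%:R :> R by rewrite ltr0n.
have p2 : 0 < l.+2%:R :> R by rewrite ltr0n.
apply: (@le_trans _ _ (r / l.+1%:R * l.+1%:R `^ (- r) * l.+1%:R `^ (r - eta))).
  by rewrite ler_wpM2r ?powR_ge0// natr_powRN_sub_le.
apply: (@le_trans _ _ (r * 2 `^ (eta + 1) / eta * (eta / l.+2%:R * l.+2%:R `^ (- eta)))); last first.
  rewrite ler_wpM2l ?natr_powRN_sub_ge//.
  by rewrite divr_ge0 ?mulr_ge0 ?powR_ge0 ?(ltW r0) ?(ltW eta0).
rewrite -mulrA -powRD ?(gt_eqF p1) ?implybT// addrA addNr add0r.
have inv (x : R) : 0 < x -> x `^ (- eta) / x = x `^ (- (eta + 1)).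
  by move=> x0; rewrite opprD powRB ?(gt_eqF x0) ?implybT// powRr1// ltW.
have -> : r / l.+1%:R * l.+1%:R `^ (- eta) = r * (l.+1%:R `^ (- (eta + 1))).
  by rewrite -inv//; ring.
have -> : r * 2 `^ (eta + 1) / eta * (eta / l.+2%:R * l.+2%:R `^ (- eta)) =
    r * (2 `^ (eta + 1) * l.+2%:R `^ (- (eta + 1))).
  rewrite -inv//; move: (l.+2%:R) p2 => y y0; field.
  by rewrite !gt_eqF.
rewrite ler_wpM2l ?(ltW r0)// !powRN ler_pdivlMr ?powR_gt0// mulrC.
rewrite ler_pdivrMr ?powR_gt0// -powRM// ?(ltW p1)//.
have : l.+2%:R <= 2 * l.+1%:R :> R by rewrite -natrM ler_nat; lia.
by move=> h; apply: ge0_ler_powR; rewrite ?nnegrE ?mulr_ge0 ?(ltW p1) ?(ltW p2)// addr_ge0// ltW.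
Qed.

End power_differences.

(** * Dirichlet sums and the tail of the cosine series *)

Section dirichlet.
Context {R : realType}.
Implicit Types (x : R) (l n K : nat).

Definition cos_sum x n : R := \sum_(1 <= k < n.+1) cos (2 * pi * (k%:R * x)).

(** Each 2 sin a cos b is a difference of sines, so the sum telescopes. With the denominator cleared
    the identity also holds at the integers. *)
Lemma cos_sum_dirichlet x n :
  2 * sin (pi * x) * cos_sum x n = sin ((2 * n%:R + 1) * (pi * x)) - sin (pi * x).
Proof.
rewrite /cos_sum; elim: n => [|n IH].
  by rewrite big_geq// !mulr0 add0r mul1r subrr.
rewrite big_nat_recr//= mulrDr IH.
have -> : (2 * n%:R + 1) * (pi * x) = 2 * pi * (n.+1%:R * x) - pi * x by rewrite -natr1; ring.
have -> : (2 * n.+1%:R + 1) * (pi * x) = 2 * pi * (n.+1%:R * x) + pi * x by ring.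
by rewrite sinB sinD; ring.
Qed.

Lemma ler_norm_cos_sum x n : `|cos_sum x n| <= n%:R.
Proof.
apply: (le_trans (ler_norm_sum _ _ _)).
apply: (@le_trans _ _ (\sum_(1 <= k < n.+1) 1)).
  by apply: ler_sum => k _; exact: cos_max.
by rewrite big_const_nat subn1 iter_addr_0.
Qed.

Lemma ler_norm_cos_sum_sin x n : `|sin (pi * x)| * `|cos_sum x n| <= 1.
Proof.
rewrite -normrM -(@ler_pM2l _ 2)// -[X in X * _]ger0_norm// -normrM mulrA.
rewrite cos_sum_dirichlet (le_trans (ler_normB _ _))//.
by rewrite mulr1 -[leRHS]/(1 + 1) lerD// sin_max.
Qed.

Definition singular_weight (alpha x : R) : R := `|sin (pi * x)| `^ (- alpha).

Lemma singular_weight_ge1 (alpha x : R) : 0 <= alpha -> sin (pi * x) != 0 ->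
  1 <= singular_weight alpha x.
Proof.
move=> a0 s0; rewrite /singular_weight powRN invf_ge1 ?powR_gt0 ?normr_gt0//.
apply: (@le_trans _ _ (1 `^ alpha)); last by rewrite powR1.
apply: ge0_ler_powR; rewrite ?nnegrE//.
exact: sin_max.
Qed.

(** Weighted geometric mean of the bounds n and 1 / |sin (pi x)|, with exponents 1 - alpha and
    alpha. It trades growth in n for a milder singularity. *)
Lemma ler_norm_cos_sum_weight (alpha x : R) n :
  0 <= alpha <= 1 -> sin (pi * x) != 0 ->
  `|cos_sum x n.+1| <= n.+1%:R `^ (1 - alpha) * singular_weight alpha x.
Proof.
move=> /andP[a0 a1] s0; set D := `|_|.
have [->|D0] := eqVneq D 0; first by rewrite mulr_ge0 ?powR_ge0.
have {}D0 : 0 < D by rewrite lt_neqAle eq_sym D0 normr_ge0.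
have -> : D = D `^ (1 - alpha) * D `^ alpha.
  by rewrite -powRD ?(gt_eqF D0) ?implybT// subrK (powRr1 (ltW D0)).
apply: ler_pM; rewrite ?powR_ge0//.
  by apply: ge0_ler_powR; rewrite ?nnegrE ?subr_ge0 ?(ltW D0) ?ler_norm_cos_sum.
rewrite /singular_weight.
have -> : `|sin (pi * x)| `^ (- alpha) = (`|sin (pi * x)|^-1) `^ alpha.
  by rewrite -(powR_inv1 (normr_ge0 _)) -powRrM mulN1r.
apply: ge0_ler_powR; rewrite ?nnegrE ?invr_ge0 ?(ltW D0)//.
by rewrite -[leRHS]mul1r ler_pdivlMr ?normr_gt0// mulrC ler_norm_cos_sum_sin.
Qed.

Lemma abel_summation (a c : nat -> R) (K n : nat) : (K <= n)%N ->
  let D l := \sum_(1 <= k < l.+1) c k in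
  \sum_(K.+1 <= k < n.+1) a k * c k =
  a n * D n - a K * D K + \sum_(K <= l < n) (a l - a l.+1) * D l.
Proof.
move=> Kn D; elim: n Kn => [|n IH].
  by rewrite leqn0 => /eqP ->; rewrite !big_geq// subrr addr0.
rewrite leq_eqVlt => /predU1P[->|Kn]; first by rewrite !big_geq// subrr addr0.
rewrite big_nat_recr//= IH// [in RHS]big_nat_recr//= /D.
rewrite [\sum_(1 <= k < n.+2) _]big_nat_recr//=; ring.
Qed.

(** Abel summation leaves two boundary terms of size at most K^(-eta), which give the 2, and a sum
    that telescopes by [natr_powRN_telescope]. The bound is uniform in n and so yields convergence
    as well as a rate. *)
Lemma power_cos_sum_tail (r alpha x : R) (K n : nat) :
  0 < r -> 0 <= alpha <= 1 -> 1 < r + alpha -> sin (pi * x) != 0 ->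
  (0 < K <= n)%N ->
  `|\sum_(K.+1 <= k < n.+1) k%:R `^ (- r) * cos (2 * pi * (k%:R * x))| <=
  (2 + r * 2 `^ (r + alpha) / (r + alpha - 1)) *
  K%:R `^ (- (r + alpha - 1)) * singular_weight alpha x.
Proof.
move=> r0 a01 ra s0 /andP[K0 Kn]; set w := singular_weight _ _.
set eta := r + alpha - 1; have eta0 : 0 < eta by rewrite subr_gt0.
have w0 : 0 <= w by exact: powR_ge0.
rewrite (@abel_summation (fun k => k%:R `^ (- r)) (fun k => cos (2 * pi * (k%:R * x))))//=.
have term l : (0 < l)%N -> `|l%:R `^ (- r) * cos_sum x l| <= l%:R `^ (- eta) * w.
  case: l => // l _; rewrite normrM ger0_norm ?powR_ge0//.
  have -> : - eta = - r + (1 - alpha) by rewrite /eta; ring.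
  rewrite powRD ?pnatr_eq0 ?implybT// -mulrA ler_wpM2l ?powR_ge0//.
  exact: ler_norm_cos_sum_weight.
set C := r * _ / eta.
have sum_le : `|\sum_(K <= l < n) (l%:R `^ (- r) - l.+1%:R `^ (- r)) * cos_sum x l| <=
    C * (K%:R `^ (- eta) - n%:R `^ (- eta)) * w.
  have -> : C * (K%:R `^ (- eta) - n%:R `^ (- eta)) * w =
      \sum_(K <= l < n) C * (l%:R `^ (- eta) - l.+1%:R `^ (- eta)) * w.
    rewrite (@telescope_sumr_eq _ K n (fun l => - (C * l%:R `^ (- eta) * w)))//.
      by ring.
    by move=> l _; ring.
  apply: (le_trans (ler_norm_sum _ _ _)); apply: ler_sum_nat => l /andP[Kl _].
  have {Kl} l0 : (0 < l)%N by exact: leq_trans Kl.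
  case: l l0 => // l _.
  have d0 : 0 <= l.+1%:R `^ (- r) - l.+2%:R `^ (- r) :> R.
    rewrite subr_ge0 !powRN lef_pV2 ?posrE ?powR_gt0// ge0_ler_powR ?nnegrE ?(ltW r0)//.
    by rewrite ler_nat.
  rewrite normrM (ger0_norm d0).
  apply: (@le_trans _ _ ((l.+1%:R `^ (- r) - l.+2%:R `^ (- r)) * (l.+1%:R `^ (1 - alpha) * w))).
    by rewrite ler_wpM2l// ler_norm_cos_sum_weight.
  rewrite mulrA ler_wpM2r//.
  have -> : 1 - alpha = r - eta by rewrite /eta; ring.
  apply: le_trans (natr_powRN_telescope l r0 eta0) _.
  by rewrite /C /eta subrK.
have bn : n%:R `^ (- eta) <= K%:R `^ (- eta) :> R.
  rewrite !powRN lef_pV2 ?posrE ?powR_gt0 ?ltr0n ?(leq_trans K0)//.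
  by rewrite ge0_ler_powR ?nnegrE ?(ltW eta0)// ler_nat.
have C0 : 0 <= C by rewrite divr_ge0 ?mulr_ge0 ?powR_ge0 ?(ltW r0) ?(ltW eta0).
have := term n (leq_trans K0 Kn); have := term K K0.
set X := _ * cos_sum x K; set Y := _ * cos_sum x n; rewrite -/Y in sum_le *.
move: sum_le; set S := \sum_(_ <= _ < _) _ => sum_le tK tn.
apply: (le_trans (ler_normD _ _)).
apply: (le_trans (lerD (ler_normB _ _) (lexx _))).
apply: (le_trans (lerD (lerD tn tK) sum_le)).
have : n%:R `^ (- eta) * w <= K%:R `^ (- eta) * w by rewrite ler_wpM2r.
have : 0 <= C * n%:R `^ (- eta) * w by apply: mulr_ge0 => //; apply: mulr_ge0 => //; exact: powR_ge0.
move: (K%:R `^ (- eta)) (n%:R `^ (- eta)) => b b'; lra.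
Qed.

End dirichlet.

(** * Integration against Haar measure *)

Section haar_integral.
Context {R : realType}.
Local Notation U := (uniform_prob (@ltr01 R)).
Local Notation X d := (d.-tuple (measurableTypeR R)).

Lemma ge0_integral_haarS (d : nat) (f : X d.+1 -> \bar R) :
  measurable_fun [set: X d.+1] f -> (forall t, 0 <= f t)%E ->
  (\int[haar d.+1]_t f t =
   \int[U]_x \int[haar d]_t f (cons_tuple_prod (x, t)))%E.
Proof.
move=> mf f0 /=; rewrite ge0_integral_distribution// fubini_tonelli1//=.
by apply: measurableT_comp => //; exact: measurable_cons_tuple_prod.
Qed.

Lemma integral_haar0 (f : X 0 -> \bar R) : measurable_fun [set: X 0] f ->
  (\int[haar 0]_t f t = f [tuple])%E.
Proof. by move=> mf; rewrite /= integral_dirac//= diracT mul1e. Qed.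

Lemma emeasurable_prod (d : measure_display) (T : measurableType d) (I : Type)
    (s : seq I) (h : I -> T -> \bar R) :
  (forall i, measurable_fun setT (h i)) ->
  measurable_fun setT (fun x => (\prod_(i <- s) h i x)%E).
Proof.
move=> mh; elim: s => [|i s IH].
  by rewrite (_ : (fun x => _) = cst 1%E)//; apply/funext => x; rewrite big_nil.
rewrite (_ : (fun x => _) = (fun x => h i x * \prod_(i <- s) h i x)%E).
  exact: emeasurable_funM.
by apply/funext => x; rewrite big_cons.
Qed.

Lemma prode_ge0 (I : Type) (s : seq I) (h : I -> \bar R) :
  (forall i, 0 <= h i)%E -> (0 <= \prod_(i <- s) h i)%E.
Proof. by move=> h0; elim/big_rec : _ => // i x _ x0; rewrite mule_ge0. Qed.

Lemma integral_haar_prod_le (d : nat) (g : 'I_d -> measurableTypeR R -> \bar R) (C : R) :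
  (forall j, measurable_fun setT (g j)) -> (forall j x, 0 <= g j x)%E ->
  (forall j, \int[U]_x g j x <= C%:E)%E ->
  (\int[haar d]_t \prod_j g j (tnth t j) <= (C ^+ d)%:E)%E.
Proof.
move=> mg g0 gC.
have mprod d' (g' : 'I_d' -> measurableTypeR R -> \bar R) : (forall j, measurable_fun setT (g' j)) ->
    measurable_fun [set: X d'] (fun t => (\prod_j g' j (tnth t j))%E).
  move=> mg'; apply: emeasurable_prod => j.
  exact: (measurableT_comp (mg' j) (measurable_tnth j)).
elim: d g mg g0 gC => [|d IH] g mg g0 gC.
  by rewrite integral_haar0 ?big_ord0//; exact: mprod.
have C0 : 0 <= C.
  by rewrite -lee_fin; apply: le_trans (gC ord0); exact: integral_ge0.
rewrite ge0_integral_haarS; [|exact: mprod|by move=> t; exact: prode_ge0].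
apply: (@le_trans _ _ (\int[U]_x (g ord0 x * (C ^+ d)%:E))%E).
  apply: ge0_le_integral => //.
  - by move=> x _; apply: integral_ge0 => t _; exact: prode_ge0.
  - apply: (measurable_fun_fubini_tonelli_F (m2 := haar d)
      (fun z => \prod_j g j (tnth (cons_tuple_prod z) j))%E).
      apply: (measurableT_comp (mprod _ g mg)); exact: measurable_cons_tuple_prod.
    by move=> z; exact: prode_ge0.
  - by apply: emeasurable_funM => //; exact: mg.
  move=> x _.
  rewrite (eq_integral (fun t : X d => g ord0 x * \prod_j g (lift ord0 j) (tnth t j))%E); last first.
    move=> t _; rewrite big_ord_recl; congr (_ * _)%E.
    by apply: eq_bigr => j _; rewrite (tnth_nth 0) /= (tnth_nth 0).
  rewrite ge0_integralZl//; last 2 first.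
    by apply: (mprod _ (fun j => g (lift ord0 j))) => j; exact: mg.
    by move=> t _; exact: prode_ge0.
  rewrite lee_wpmul2l//.
  by apply: (IH (fun j => g (lift ord0 j))) => // j; exact: mg.
rewrite ge0_integralZr//; last by rewrite lee_fin exprn_ge0.
by rewrite exprS EFinM lee_wpmul2r// lee_fin exprn_ge0.
Qed.

Lemma measurable_dot (d : nat) (k : 'I_d -> R) (theta : R) :
  measurable_fun [set: X d] (fun t => 2 * pi * (\sum_j k j * tnth t j) + theta).
Proof.
apply: measurable_funD => //; apply: measurable_funM => //.
apply: measurable_sum => j; apply: measurable_funM => //.
exact: measurable_tnth.
Qed.

(** The added 1 makes the integrand nonnegative, so that Tonelli's theorem alone handles characters
    in several variables. *)
Lemma integral_uniform_character (a theta : R) : a != 0 ->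
  sin (a + theta) = sin theta ->
  (\int[U]_x (1 + cos (a * x + theta))%:E = 1)%E.
Proof.
move=> a0 per.
have cvg_aff : continuous (fun x : R => a * x + theta).
  by move=> x; apply: cvgD; [exact: mulrl_continuous|exact: cvg_cst].
have cont : continuous (fun x : R => 1 + cos (a * x + theta)).
  move=> x; apply: cvgD; first exact: cvg_cst.
  by apply: continuous_comp; [exact: cvg_aff|exact: continuous_cos].
rewrite integral_uniform; last 2 first.
- by apply/measurable_EFinP; exact: continuous_measurable_fun.
- by move=> x; rewrite lee_fin -lerBlDl sub0r cos_geN1.
rewrite subr0 invr1 mul1e.
pose F (x : R) : R := x + a^-1 * sin (a * x + theta).
have dF (x : R) : is_derive x 1 F (1 + cos (a * x + theta)).
  have h1 : is_derive x 1 (a \*: (@id R) + cst theta) a.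
    by apply: is_derive_eq; rewrite addr0 /GRing.scale/= mulr1.
  have h2 := @is_derive1_comp R sin _ x _ _ (is_derive_sin _) h1.
  have h3 : is_derive x 1 (@id R + a^-1 \*: (sin \o (a \*: (@id R) + cst theta)))
      (1 + a^-1 *: (cos (a * x + theta) * a)) by exact: is_deriveD.
  apply: (is_derive_eq h3); congr (_ + _).
  by rewrite /GRing.scale/= mulrCA mulVf// mulr1.
rewrite (@continuous_FTC2 _ _ F)//.
- rewrite -EFinB /F !mulr1 !mulr0 !add0r per.
  by congr _%:E; ring.
- exact: continuous_subspaceT.
- split.
  + by move=> x _; exact: (@ex_derive _ _ _ _ _ _ _ (dF x)).
  + apply: cvg_at_right_filter; apply: differentiable_continuous.
    apply/derivable1_diffP; exact: (@ex_derive _ _ _ _ _ _ _ (dF 0)).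
  + apply: cvg_at_left_filter; apply: differentiable_continuous.
    apply/derivable1_diffP; exact: (@ex_derive _ _ _ _ _ _ _ (dF 1)).
- by move=> x _; rewrite derive1E; exact: (@derive_val _ _ _ _ _ _ _ (dF x)).
Qed.

Lemma integral_uniform_cst (c : R) : (\int[U]_x c%:E = c%:E)%E.
Proof.
rewrite integral_cst// -[RHS]mule1; congr (_ * _)%E; exact: (probability_setT U).
Qed.

(** The phase [theta] is arbitrary so that the induction can absorb the first coordinate into it. *)
Lemma integral_haar_character (d : nat) (k : 'I_d -> int) (theta : R) :
  (\int[haar d]_t (1 + cos (2 * pi * (\sum_j (k j)%:~R * tnth t j) + theta))%:E =
   (1 + (if [forall j, k j == 0%R] then cos theta else 0))%:E)%E.
Proof.
have mc d' (k' : 'I_d' -> int) th : measurable_fun [set: X d']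
    (fun t => (1 + cos (2 * pi * (\sum_j (k' j)%:~R * tnth t j) + th))%:E).
  apply/measurable_EFinP; apply: measurable_funD => //.
  apply: (measurableT_comp (continuous_measurable_fun (@continuous_cos R))).
  exact: measurable_dot.
elim: d k theta => [|d IH] k theta.
  rewrite integral_haar0// big_ord0 mulr0 add0r; case: forallP => // h.
  by exfalso; apply: h => -[].
rewrite ge0_integral_haarS; last 2 first.
- exact: mc.
- by move=> t; rewrite lee_fin -lerBlDl sub0r cos_geN1.
rewrite (eq_integral (fun x : measurableTypeR R => (1 + (if [forall j, k (lift ord0 j) == 0%R] then
   cos (2 * pi * (k ord0)%:~R * x + theta) else 0))%:E)); last first.
  move=> x _; rewrite -mulrA -IH; apply: eq_integral => t _.
  congr (1 + cos _)%:E; rewrite big_ord_recl mulrDr.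
  rewrite [Z in Z + theta = _]addrC -addrA; congr (2 * pi * _ + _).
  by apply: eq_bigr => j _; rewrite (tnth_nth 0) /= (tnth_nth 0).
case: forallP => [k0|k0]; last first.
  rewrite integral_uniform_cst; case: forallP => // h; case: k0 => j; exact: h.
have [k00|k00] := eqVneq (k ord0) 0.
  rewrite (eq_integral (cst (1 + cos theta)%:E)); last first.
    by move=> x _; rewrite k00 mulr0 mul0r add0r.
  rewrite integral_uniform_cst; case: forallP => // h.
  by case: h => j; case: (unliftP ord0 j) => [j' ->|->]; rewrite ?k00.
rewrite integral_uniform_character; last 2 first.
- by rewrite !mulf_neq0// ?intr_eq0// gt_eqF// pi_gt0.
- exact: sin_2pi_int.
case: forallP => [h|_]; last by rewrite addr0.
by rewrite (eqP (h ord0)) eqxx in k00.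
Qed.

Lemma bounded_haar_integrable (d : nat) (f : X d -> R) (M : R) :
  measurable_fun setT f -> (forall t, `|f t| <= M) ->
  (haar d).-integrable setT (EFin \o f).
Proof.
move=> mf fM; apply: measurable_bounded_integrable => //.
  by apply: le_lt_trans (ltry 1); rewrite -(probability_setT (haar d)); exact: lexx.
exists M; split; first exact: num_real.
by move=> y My t _; apply: le_trans (fM t) _; exact: ltW.
Qed.

End haar_integral.

(** * Convergence and tail of the kernel series *)

Section bernoulli_kernel.
Context {R : realType}.
Implicit Types (x r alpha : R) (n K : nat).

Definition real_partial r n x : R :=
  1 + 2 * \sum_(1 <= k < n.+1) k%:R `^ (- r) * cos (2 * pi * (k%:R * x)).

Lemma sum_symmetric (V : zmodType) (f : int -> V) n :
  \sum_(0 <= j < (2 * n).+1) f (j%:Z - n%:Z) =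
  f 0 + \sum_(1 <= k < n.+1) (f k%:Z + f (- k%:Z)).
Proof.
elim: n => [|n IH].
  by rewrite muln0 big_nat1 big_geq// [RHS]addr0 subrr.
rewrite [in RHS]big_nat_recr//= addrA -IH.
rewrite mulnS add2n big_nat_recl// big_nat_recr//=.
rewrite (eq_big_nat _ _ (F2 := fun j => f (j%:Z - n%:Z))); last first.
  by move=> j _; congr f; lia.
have -> : (2 * n).+2%:Z - n.+1%:Z = n.+1%:Z by lia.
by rewrite sub0r addrCA [f (- _) + _]addrC.
Qed.

Lemma F_partialE r x n : F_partial r x n = ((real_partial r n x)%:C)%C.
Proof.
rewrite /F_partial (sum_symmetric (fun k => (((Num.max 1 `|k|%:~R) `^ (- r))%:C)%C * expi2pi (- (k%:~R * x)))).
rewrite /real_partial.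
rewrite [Num.max 1 `|0|%:~R]max_l//.
rewrite mul0r oppr0 /expi2pi mulr0 cos0 sin0 powR1.
apply: eq_complexP; rewrite ?(Re_add, Im_add, Re_sum, Im_sum, Re_mul, Im_mul)/=.
  rewrite !mulr1 mulr0 subr0 mulr_sumr; congr (_ + _); apply: eq_big_nat => k /andP[k0 _].
  rewrite !mul0r !subr0 normrN.
  have -> : Num.max 1 `|k%:Z|%:~R = k%:R :> R by rewrite max_r// ler1n.
  by rewrite mulrNz mulNr opprK mulrN cosN; ring.
rewrite !mulr0 mul0r addr0 add0r big1_seq// => k /andP[_]; rewrite mem_index_iota => /andP[k0 _].
rewrite !mul0r !addr0 normrN.
by rewrite mulrNz mulNr opprK mulrN sinN; ring.
Qed.

Lemma real_partial_diff r alpha x K n :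
  0 < r -> 0 <= alpha <= 1 -> 1 < r + alpha -> sin (pi * x) != 0 ->
  (0 < K <= n)%N ->
  `|real_partial r n x - real_partial r K x| <=
  2 * (2 + r * 2 `^ (r + alpha) / (r + alpha - 1)) *
  K%:R `^ (- (r + alpha - 1)) * singular_weight alpha x.
Proof.
move=> r0 a01 ra s0 /andP[K0 Kn].
rewrite /real_partial opprD addrACA subrr add0r -mulrBr normrM ger0_norm//.
rewrite -2![leRHS]mulrA ler_wpM2l// [leRHS]mulrA.
rewrite (big_cat_nat (n := K.+1))//= addrAC subrr add0r.
by apply: power_cos_sum_tail; rewrite ?K0.
Qed.

Lemma powRN_small (eta c eps : R) : 0 < eta -> 0 < eps ->
  exists2 K : nat, (0 < K)%N & c * K%:R `^ (- eta) < eps.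
Proof.
(* [Num.max c 1] keeps the base of the power positive whatever the sign of [c]. *)
move=> e0 ep0; pose K := (Num.truncn ((Num.max c 1 / eps) `^ eta^-1)).+1.
exists K => //; have c1 : 0 < Num.max c 1 by rewrite lt_max ltr01 orbT.
rewrite powRN -ltr_pdivlMr ?invr_gt0 ?powR_gt0// invrK mulrC -ltr_pdivrMr//.
apply: (@le_lt_trans _ _ (Num.max c 1 / eps)).
  by rewrite ler_wpM2r ?invr_ge0 ?(ltW ep0)// le_max lexx.
have -> : Num.max c 1 / eps = ((Num.max c 1 / eps) `^ eta^-1) `^ eta.
  by rewrite -powRrM mulVf ?gt_eqF// powRr1// divr_ge0 ?(ltW c1) ?(ltW ep0).
by apply: gt0_ltr_powR => //; rewrite ?nnegrE ?powR_ge0// truncnS_gt.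
Qed.

(** The uniform tail bound makes the partial sums Cauchy off the integers, so [lim] is a genuine
    limit there; it is real because the terms of k and -k pair up to cosines. The constant is chosen
    before x. *)
Lemma F1_tail r alpha : 0 < r -> 0 <= alpha <= 1 -> 1 < r + alpha ->
  exists2 C, 0 <= C & forall x, sin (pi * x) != 0 ->
  exists g : R, [/\ F1 r x = (g%:C)%C, real_partial r n x @[n --> \oo] --> g &
    forall K, (0 < K)%N -> `|g - real_partial r K x| <=
      C * K%:R `^ (- (r + alpha - 1)) * singular_weight alpha x].
Proof.
move=> r0 a01 ra; set eta := r + alpha - 1.
have eta0 : 0 < eta by rewrite subr_gt0.
pose C := 2 * (2 + r * 2 `^ (r + alpha) / eta).
have C0 : 0 <= C.
  by rewrite mulr_ge0// addr_ge0// divr_ge0 ?mulr_ge0 ?powR_ge0 ?(ltW r0) ?(ltW eta0).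
exists C => // x s0.
have diff K n : (0 < K <= n)%N -> `|real_partial r n x - real_partial r K x| <=
    C * K%:R `^ (- eta) * singular_weight alpha x.
  exact: real_partial_diff.
have [g hg] : exists g : R, real_partial r n x @[n --> \oo] --> g.
  apply/cvg_ex; apply: cauchy_cvg; apply: cauchy_exP => e e0.
  have [K K0 hK] := powRN_small (C * singular_weight alpha x) eta0 e0.
  exists (real_partial r K x); exists K => // n /= Kn.
  rewrite /ball/= distrC; apply: le_lt_trans (diff K n _) _; first by rewrite K0.
  by rewrite mulrAC.
exists g; split=> //.
  have hc : (F_partial r x : nat -> R[i]^o) @ \oo --> ((g%:C)%C : R[i]^o).
    apply/cvgrPdist_lt => e; case: e => a b; rewrite ltcE/= => /andP[/eqP -> a0].
    move/cvgrPdist_lt : hg => /(_ _ a0); apply: filterS => n hn.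
    by rewrite F_partialE -rmorphB/= normc_def/= expr0n addr0 sqrtr_sqr ltcR.
  exact: (cvg_lim (@norm_hausdorff _ _) hc).
move=> K K0; apply/ler_addgt0Pr => e e0.
move/cvgrPdist_lt : hg => /(_ _ e0) [N _ hN].
have := hN (maxn N K) (leq_maxl _ _); have := diff K (maxn N K).
rewrite K0 leq_maxr => /(_ isT).
set z := real_partial r _ x; set y := real_partial r K x => h1 h2.
have -> : g - y = (z - y) + (g - z) by ring.
by rewrite (le_trans (ler_normD _ _))// lerD// ltW.
Qed.

End bernoulli_kernel.

Section kernel_measurability.
Context {R : realType}.
Implicit Types (x r alpha : R) (n K : nat).

(** All integers share the same sequence of partial sums, so whatever [lim] returns, it is one
    constant there, which is enough for measurability. *)
Lemma F1_integer r x : sin (pi * x) = 0 -> F1 r x = F1 r 0.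
Proof.
move=> s0; rewrite /F1; have -> // : F_partial r x = F_partial r 0.
apply/funext => n; rewrite !F_partialE; congr (_%:C)%C; rewrite /real_partial.
congr (1 + 2 * _); apply: eq_bigr => k _; congr (_ * _).
have sk : sin (pi * (k%:R * x)) = 0.
  elim: k => [|k IH]; first by rewrite mul0r mulr0 sin0.
  have -> : pi * (k.+1%:R * x) = pi * (k%:R * x) + pi * x by ring.
  by rewrite sinD IH s0 mul0r mulr0 addr0.
rewrite mulr0 mulr0 cos0 -mulrA mulr_natl cos_mulr2n cos2sin2 sk expr0n/= subr0.
by ring.
Qed.

Lemma measurable_real_partial r n : measurable_fun setT (real_partial r n : R -> R).
Proof.
apply: measurable_funD => //; apply: measurable_funM => //.
apply: measurable_sum => k; apply: measurable_funM => //.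
apply: (measurableT_comp (continuous_measurable_fun (@continuous_cos R))).
by do 2 apply: measurable_funM => //.
Qed.

Lemma measurable_sin_pi_eq0 : measurable_fun setT (fun x : R => sin (pi * x) == 0).
Proof.
apply: measurable_fun_eqr => //.
apply: (measurableT_comp (continuous_measurable_fun (@continuous_sin R))).
exact: measurable_funM.
Qed.

(** The last two conditions confine alpha between 1 - r and 1 - 1/p, a nonempty interval as r > 1/p.
    The witness is its midpoint, or (1 - 1/p) / 2 when that is larger, which keeps alpha
    positive. *)
Lemma exists_tail_exponent r (p : R) : 1 < p -> p^-1 < r ->
  exists alpha, [/\ 0 <= alpha <= 1, 1 < r + alpha & alpha < 1 - p^-1].
Proof.
move=> p1 pr; have p0 : 0 < p^-1 by rewrite invr_gt0; lra.
have p2 : p^-1 < 1 by rewrite invf_lt1//; lra.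
exists (Num.max ((1 - p^-1) / 2) (1 - (r + p^-1) / 2)).
by case: (leP ((1 - p^-1) / 2) (1 - (r + p^-1) / 2)) => h; split; try apply/andP; try split; lra.
Qed.

Lemma measurable_F1 r : 0 < r ->
  measurable_fun setT (fun x => complex.Re (F1 r x)) /\
  measurable_fun setT (fun x => complex.Im (F1 r x)).
Proof.
(* alpha = 1 gives convergence off the integers for every r > 0. *)
move=> r0; have [||C _ F1C] := @F1_tail R r 1 r0; [by rewrite ler01 lexx|lra|].
split.
- apply: (@measurable_fun_cvg _ _ _ _ (fun n x =>
    if sin (pi * x) == 0 then complex.Re (F1 r 0) else real_partial r n x)).
    move=> n; apply: measurable_fun_ifT => //; first exact: measurable_sin_pi_eq0.
    exact: measurable_real_partial.
  move=> x _ /=; case: eqVneq => s0; first by rewrite F1_integer//; exact: cvg_cst.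
  by have [g [-> hg _]] := F1C x s0.
- rewrite (_ : (fun x => _) = (fun x => if sin (pi * x) == 0 then complex.Im (F1 r 0) else 0)).
    by apply: measurable_fun_ifT => //; exact: measurable_sin_pi_eq0.
  apply/funext => x; case: eqVneq => s0; first by rewrite F1_integer.
  by have [g [-> _ _]] := F1C x s0.
Qed.

End kernel_measurability.

(** * Characters and integration on the torus *)

Section characters.
Context {R : realType}.

Lemma expi2piD (x y : R) : expi2pi (x + y) = expi2pi x * expi2pi y.
Proof.
apply: eq_complexP; rewrite ?(Re_mul, Im_mul)/= mulrDr ?cosD ?sinD//.
by rewrite addrC.
Qed.

Lemma expi2pi_int (z : int) : expi2pi (z%:~R : R) = 1.
Proof.
by rewrite /expi2pi -[2 * pi * _]addr0 cos_2pi_int sin_2pi_int cos0 sin0.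
Qed.

Lemma normc_expi2pi (x : R) : normc (expi2pi x) = 1.
Proof. by rewrite /= cos2Dsin2 sqrtr1. Qed.

Variable d : nat.
Implicit Types (k l : 'rV[int]_d) (x y : 'rV[R]_d).

Lemma normc_trig_char k x : normc (trig_char k x) = 1.
Proof. exact: normc_expi2pi. Qed.

Lemma trig_charD k l x : trig_char (k + l) x = trig_char k x * trig_char l x.
Proof.
rewrite /trig_char -expi2piD -big_split/=; congr expi2pi.
by apply: eq_bigr => j _; rewrite mxE rmorphD mulrDl.
Qed.

Lemma trig_char_add k x y : trig_char k (x + y) = trig_char k x * trig_char k y.
Proof.
rewrite /trig_char -expi2piD -big_split/=; congr expi2pi.
by apply: eq_bigr => j _; rewrite mxE mulrDr.
Qed.

Lemma trig_char_opp k x : trig_char k (- x) = trig_char (- k) x.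
Proof.
rewrite /trig_char; congr expi2pi; apply: eq_bigr => j _.
by rewrite !mxE rmorphN mulrN mulNr.
Qed.

Lemma trig_char_intr k (z : 'rV[int]_d) : trig_char k (map_mx intr z : 'rV[R]_d) = 1.
Proof.
rewrite /trig_char -(expi2pi_int (\sum_j k 0 j * z 0 j)) rmorph_sum/=.
congr expi2pi; apply: eq_bigr => j _; by rewrite mxE rmorphM.
Qed.

Lemma trig_char_conj k x : trig_char (- k) x = ((trig_char k x)^*)%C.
Proof.
have -> : trig_char (- k) x = expi2pi (- (\sum_j (k 0 j)%:~R * x 0 j)).
  rewrite /trig_char -sumrN; congr expi2pi; apply: eq_bigr => j _.
  by rewrite mxE rmorphN mulNr.
by rewrite /trig_char /expi2pi mulrN cosN sinN.
Qed.

End characters.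

(** * Complex-valued integrals on the torus *)

Section torus_integration.
Context {R : realType} {d : nat}.
Local Notation X := (d.-tuple (measurableTypeR R)).
Implicit Types (f g : 'rV[R]_d -> R[i]).

Definition torus_integrable f :=
  (haar d).-integrable [set: X] (EFin \o (fun t => complex.Re (f (torus_point t)))) /\
  (haar d).-integrable [set: X] (EFin \o (fun t => complex.Im (f (torus_point t)))).

Lemma haar_integrableZ (c : R) (f : X -> R) :
  (haar d).-integrable setT (EFin \o f) ->
  (haar d).-integrable setT (EFin \o (fun t => c * f t)).
Proof.
by move=> hf; apply: eq_integrable (integrableZl measurableT c hf) => // t _; rewrite /= EFinM.
Qed.

Lemma torus_integralD f g : torus_integrable f -> torus_integrable g ->
  torus_integral (fun x => f x + g x) = torus_integral f + torus_integral g.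
Proof.
move=> [f1 f2] [g1 g2]; apply: eq_complexP; rewrite ?(Re_add, Im_add)/=.
  by rewrite -RintegralD//; apply: eq_Rintegral => t _; rewrite Re_add.
by rewrite -RintegralD//; apply: eq_Rintegral => t _; rewrite Im_add.
Qed.

Lemma torus_integrableD f g : torus_integrable f -> torus_integrable g ->
  torus_integrable (fun x => f x + g x).
Proof.
move=> [f1 f2] [g1 g2]; split.
  apply: eq_integrable (integrableD measurableT f1 g1) => // t _.
  by rewrite /= Re_add.
apply: eq_integrable (integrableD measurableT f2 g2) => // t _.
by rewrite /= Im_add.
Qed.

Lemma torus_integrableZ (c : R[i]) f : torus_integrable f ->
  torus_integrable (fun x => c * f x).
Proof.
move=> [f1 f2]; split.
  apply: eq_integrable (integrableB measurableT
    (integrableZl measurableT (complex.Re c) f1) (integrableZl measurableT (complex.Im c) f2)) => // t _.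
  by rewrite /= Re_mul.
apply: eq_integrable (integrableD measurableT
    (integrableZl measurableT (complex.Re c) f2) (integrableZl measurableT (complex.Im c) f1)) => // t _.
by rewrite /= Im_mul.
Qed.

Lemma torus_integralZ (c : R[i]) f : torus_integrable f ->
  torus_integral (fun x => c * f x) = c * torus_integral f.
Proof.
move=> [f1 f2]; apply: eq_complexP; rewrite ?(Re_mul, Im_mul)/=.
  rewrite -!RintegralZl// -RintegralB//; last 2 first.
  - exact: haar_integrableZ.
  - exact: haar_integrableZ.
  by apply: eq_Rintegral => t _; rewrite Re_mul.
rewrite -!RintegralZl// -RintegralD//; last 2 first.
- exact: haar_integrableZ.
- exact: haar_integrableZ.
by apply: eq_Rintegral => t _; rewrite Im_mul.
Qed.

Lemma torus_integrable0 : torus_integrable (fun=> 0).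
Proof. by split; exact: integrable0. Qed.

Lemma torus_integral0 : torus_integral (fun _ : 'rV[R]_d => 0 : R[i]) = 0.
Proof. by apply: eq_complexP; rewrite /= Rintegral_cst// mul0r. Qed.

Lemma torus_integrable_sum (I : Type) (s : seq I) (F : I -> 'rV[R]_d -> R[i]) :
  (forall i, torus_integrable (F i)) -> torus_integrable (fun x => \sum_(i <- s) F i x).
Proof.
move=> h; elim: s => [|i s IH].
  rewrite (_ : (fun x => _) = fun=> 0); first exact: torus_integrable0.
  by apply/funext => x; rewrite big_nil.
rewrite (_ : (fun x => _) = fun x => F i x + \sum_(i <- s) F i x).
  exact: torus_integrableD.
by apply/funext => x; rewrite big_cons.
Qed.

Lemma torus_integral_sum (I : Type) (s : seq I) (F : I -> 'rV[R]_d -> R[i]) :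
  (forall i, torus_integrable (F i)) ->
  torus_integral (fun x => \sum_(i <- s) F i x) = \sum_(i <- s) torus_integral (F i).
Proof.
move=> h; elim: s => [|i s IH].
  rewrite big_nil (_ : (fun x => _) = fun=> 0); first exact: torus_integral0.
  by apply/funext => x; rewrite big_nil.
rewrite big_cons -IH -torus_integralD//; last exact: torus_integrable_sum.
by congr torus_integral; apply/funext => x; rewrite big_cons.
Qed.

Lemma bounded_torus_integrable f (M : R) : torus_measurable f ->
  (forall x, normc (f x) <= M) -> torus_integrable f.
Proof.
move=> [mf1 mf2] fM; split; apply: (@bounded_haar_integrable _ _ _ M) => // t;
  apply: le_trans (fM (torus_point t)); [exact: ler_norm_Re|exact: ler_norm_Im].
Qed.

Lemma torus_measurableD f g : torus_measurable f -> torus_measurable g ->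
  torus_measurable (fun x => f x + g x).
Proof.
move=> [f1 f2] [g1 g2]; split.
  under eq_fun do rewrite Re_add; exact: measurable_funD.
under eq_fun do rewrite Im_add; exact: measurable_funD.
Qed.

Lemma torus_measurableM f g : torus_measurable f -> torus_measurable g ->
  torus_measurable (fun x => f x * g x).
Proof.
move=> [f1 f2] [g1 g2]; split.
  by under eq_fun do rewrite Re_mul; apply: measurable_funB; exact: measurable_funM.
by under eq_fun do rewrite Im_mul; apply: measurable_funD; exact: measurable_funM.
Qed.

Lemma torus_measurable_cst (c : R[i]) : torus_measurable (fun _ : 'rV[R]_d => c).
Proof. by split. Qed.

Lemma torus_measurableN f : torus_measurable f -> torus_measurable (fun x => - f x).
Proof.
move=> [f1 f2]; split.
  under eq_fun do rewrite Re_opp; exact: measurableT_comp.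
under eq_fun do rewrite Im_opp; exact: measurableT_comp.
Qed.

Lemma torus_measurable_sum (I : Type) (s : seq I) (F : I -> 'rV[R]_d -> R[i]) :
  (forall i, torus_measurable (F i)) -> torus_measurable (fun x => \sum_(i <- s) F i x).
Proof.
move=> h; elim: s => [|i s IH].
  rewrite (_ : (fun x => _) = fun=> 0); first exact: torus_measurable_cst.
  by apply/funext => x; rewrite big_nil.
rewrite (_ : (fun x => _) = fun x => F i x + \sum_(i <- s) F i x).
  exact: torus_measurableD.
by apply/funext => x; rewrite big_cons.
Qed.

Lemma torus_measurable_prod (I : Type) (s : seq I) (F : I -> 'rV[R]_d -> R[i]) :
  (forall i, torus_measurable (F i)) -> torus_measurable (fun x => \prod_(i <- s) F i x).
Proof.
move=> h; elim: s => [|i s IH].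
  rewrite (_ : (fun x => _) = fun=> 1); first exact: torus_measurable_cst.
  by apply/funext => x; rewrite big_nil.
rewrite (_ : (fun x => _) = fun x => F i x * \prod_(i <- s) F i x).
  exact: torus_measurableM.
by apply/funext => x; rewrite big_cons.
Qed.

Lemma torus_measurable_normc f : torus_measurable f ->
  measurable_fun [set: X] (fun t => normc (f (torus_point t))).
Proof.
move=> [f1 f2].
rewrite (_ : (fun t => _) = (fun t => Num.sqrt (complex.Re (f (torus_point t)) ^+ 2
   + complex.Im (f (torus_point t)) ^+ 2))); last first.
  by apply/funext => t; rewrite -sqr_normcE sqrtr_sqr ger0_norm// normc_ge0.
apply: (measurableT_comp (continuous_measurable_fun (@sqrt_continuous R))).
by apply: measurable_funD; exact: measurable_funX.
Qed.

Lemma torus_measurable_char (k : 'rV[int]_d) : torus_measurable (trig_char k : 'rV[R]_d -> R[i]).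
Proof.
have h : measurable_fun [set: X]
    (fun t => 2 * pi * (\sum_j (k 0 j)%:~R * (torus_point t) 0 j)).
  rewrite (_ : (fun t => _) = fun t => 2 * pi * (\sum_j (k 0 j)%:~R * tnth t j) + 0).
    exact: measurable_dot.
  by apply/funext => t; rewrite addr0; congr (_ * _); apply: eq_bigr => j _; rewrite mxE.
split.
  exact: (measurableT_comp (continuous_measurable_fun (@continuous_cos R))).
exact: (measurableT_comp (continuous_measurable_fun (@continuous_sin R))).
Qed.

Lemma torus_integrable_char (k : 'rV[int]_d) : torus_integrable (trig_char k : 'rV[R]_d -> R[i]).
Proof.
apply: (@bounded_torus_integrable _ 1); first exact: torus_measurable_char.
by move=> x; rewrite normc_trig_char.
Qed.

Lemma torus_integral_char (k : 'rV[int]_d) :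
  torus_integral (trig_char k : 'rV[R]_d -> R[i]) = (k == 0)%:R.
Proof.
have kE : [forall j, k 0 j == 0%R] = (k == 0).
  apply/forallP/eqP => [h|-> j]; last by rewrite mxE.
  by apply/rowP => j; rewrite mxE; exact/eqP.
have key (th : R) : Rintegral (haar d) setT (fun t =>
    cos (2 * pi * (\sum_j (k 0 j)%:~R * tnth t j) + th)) = (k == 0)%:R * cos th.
  have mc : measurable_fun [set: X] (fun t =>
      cos (2 * pi * (\sum_j (k 0 j)%:~R * tnth t j) + th)).
    apply: (measurableT_comp (continuous_measurable_fun (@continuous_cos R))).
    exact: measurable_dot.
  have ic : (haar d).-integrable [set: X] (EFin \o (fun t =>
      cos (2 * pi * (\sum_j (k 0 j)%:~R * tnth t j) + th))).
    by apply: (@bounded_haar_integrable _ _ _ 1) => // t; exact: cos_max.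
  have i1 : (haar d).-integrable [set: X] (EFin \o cst (1 : R)).
    by apply: (@bounded_haar_integrable _ _ _ 1) => // t; rewrite /= normr1.
  apply: (addrI 1); have := integral_haar_character (k 0) th.
  move/(congr1 fine); rewrite -[fine (integral _ _ _)]/(Rintegral _ _ _) RintegralD//.
  rewrite Rintegral_cst// [fine (haar d _)](_ : _ = 1) ?mulr1; last first.
    by rewrite -[RHS]/(fine 1%E); congr fine; exact: probability_setT.
  by move=> ->; rewrite kE; case: eqP; rewrite ?mul1r ?mul0r.
have dotE t : \sum_j (k 0 j)%:~R * (torus_point t) 0 j = \sum_j (k 0 j)%:~R * tnth t j :> R.
  by apply: eq_bigr => j _; rewrite mxE.
apply: eq_complexP => /=.
  under eq_Rintegral do rewrite dotE -[2 * pi * _]addr0.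
  by rewrite key cos0 mulr1; case: (k == 0).
(* The sine is the case of phase - pi / 2. *)
under eq_Rintegral do rewrite dotE -cosBpihalf.
by rewrite key cosN cos_pihalf mulr0; case: (k == 0).
Qed.

End torus_integration.

(** * Convolution with the kernel *)

Section sine_lower_bound.
Context {R : realType}.
Implicit Types (x y z : R).

(** Where cos (pi z) >= 1/2, the mean value theorem gives slope at least pi / 2 >= 1; elsewhere the
    sine is at least 1/2, hence at least z. *)
Lemma sin_pi_ge z : 0 <= z <= 1 / 2 -> z <= sin (pi * z).
Proof.
move=> /andP[z0 z2]; have [->|zn0] := eqVneq z 0; first by rewrite mulr0 sin0.
have {zn0}z0 : 0 < z by rewrite lt_neqAle eq_sym zn0.
have p0 := pi_gt0 R; have p2 := pi_ge2 R.
have pz : 0 < pi * z by rewrite mulr_gt0.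
have pz2 : pi * z <= pi / 2 by rewrite ler_pM2l//; lra.
have s0 : 0 <= sin (pi * z) by rewrite sin_ge0_pi//; lra.
have [c2|c2] := leP (1 / 2) (cos (pi * z)).
  have cs : {within `[0, (pi * z)], continuous (@sin R)}.
    by apply: continuous_subspaceT => x; exact: continuous_sin.
  have [c cI hc] := MVT pz (fun x _ => is_derive_sin x) cs.
  move: hc; rewrite sin0 !subr0 => ->; move: cI; rewrite in_itv/= => /andP[c0 cpz].
  have : cos (pi * z) < cos c by rewrite ltr_cos// in_itv/=; apply/andP; split; lra.
  nra.
have : sin (pi * z) ^+ 2 >= (1 / 2) ^+ 2.
  have c0 : 0 <= cos (pi * z) by rewrite cos_ge0_pihalf//; apply/andP; split; lra.
  rewrite sin2cos2; nra.
by rewrite ler_pXn2r// ?nnegrE//; lra.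
Qed.

Lemma norm_sin_pi_ge z : `|z| <= 1 / 2 -> `|z| <= `|sin (pi * z)|.
Proof.
case: (leP 0 z) => z0 hz.
  by rewrite ger0_norm in hz *; rewrite // (le_trans _ (ler_norm _))// sin_pi_ge// z0.
rewrite ltr0_norm// in hz *.
rewrite -normrN -sinN -mulrN (le_trans _ (ler_norm _))// sin_pi_ge// hz andbT; lra.
Qed.

(* As y runs over [0, 1], the integers nearest to x - y are among three. *)
Lemma near_integer_translate x : exists a : 'I_3 -> R, forall eps y, 0 <= y <= 1 ->
  `|sin (pi * (x - y))| <= eps -> exists k, `|y - a k| <= eps.
Proof.
pose m := Num.floor x; exists (fun k => x - (m + (k : nat)%:Z - 1)%:~R) => eps y /andP[y0 y1] hs.
have := floor_itv x; rewrite -/m => /andP[mx xm].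
rewrite intrD in xm; set M := m%:~R in mx xm.
have [j hj] : exists j : 'I_3, `|x - y - (m + (j : nat)%:Z - 1)%:~R| <= 1 / 2.
  have [h1|h1] := leP (x - y) (M - 1 / 2).
    exists (inord 0); rewrite inordK// intrB intrD -/M ler_norml; apply/andP; split; lra.
  have [h2|h2] := leP (x - y) (M + 1 / 2).
    exists (inord 1); rewrite inordK// intrB intrD -/M ler_norml; apply/andP; split; lra.
  exists (inord 2); rewrite inordK// intrB intrD -/M ler_norml; apply/andP; split; lra.
exists j.
have := norm_sin_pi_ge hj; rewrite -(norm_sin_pi_int (m + (j : nat)%:Z - 1)) subrK.
move=> /le_trans /(_ hs); rewrite -normrN; apply: le_trans.
by rewrite le_eqVlt; apply/orP; left; apply/eqP; congr `|_|; ring.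
Qed.

End sine_lower_bound.

(** * An integrable majorant of the singularity *)

Section singular_majorant.
Context {R : realType}.
Implicit Types (s x y eps : R).
Local Notation U := (uniform_prob (@ltr01 R)).

Lemma measurable_sin_ball x eps :
  measurable_fun setT (fun y : R => (`|sin (pi * (x - y))| <= eps)%R).
Proof.
apply: measurable_fun_ler => //; apply: measurableT_comp => //.
apply: (measurableT_comp (continuous_measurable_fun (@continuous_sin R))).
by apply: measurable_funM => //; exact: measurable_funB.
Qed.

Lemma measurable_natr_bool (f : R -> bool) : measurable_fun setT f ->
  measurable_fun setT (fun y : R => (f y)%:R : R).
Proof.
move=> mf; rewrite (_ : (fun y => _) = (fun y => if f y then 1 else 0)).
  exact: measurable_fun_ifT.
by apply/funext => y; case: (f y).
Qed.

(** The set is covered by the three intervals of length 2 eps that [near_integer_translate]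
    provides. *)
Lemma integral_sin_ball_le x eps : 0 <= eps ->
  (\int[U]_y ((`|sin (pi * (x - y))| <= eps)%R%:R)%:E <= (6 * eps)%:E)%E.
Proof.
move=> eps0; have [a ha] := near_integer_translate x.
have mf := measurable_natr_bool (measurable_sin_ball x eps).
rewrite integral_uniform; [|exact/measurable_EFinP|by move=> y; rewrite lee_fin].
rewrite subr0 invr1 mul1e.
pose J k := `[(a k - eps), (a k + eps)]%classic : set R.
have mJ k : measurable (J k) by exact: measurable_itv.
have mE k D : measurable_fun D (fun y : R => (\1_(J k) y)%:E).
  apply/measurable_EFinP; apply: measurable_indic; exact: mJ.
apply: (@le_trans _ _ (\int[lebesgue_measure]_(y in `[0%R, 1%R])
    (\sum_(k < 3) (\1_(J k) y)%:E))%E).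
  apply: ge0_le_integral.
  - by [].
  - by move=> y _; rewrite lee_fin.
  - by apply/measurable_EFinP; exact: measurable_funTS.
  - by apply: emeasurable_sum => k; exact: mE.
  move=> y; rewrite /= in_itv/= => y01; case: (leP `|sin (pi * (x - y))| eps) => [h|_]; last first.
    by apply: sume_ge0 => k _; rewrite lee_fin.
  have [k hk] := ha _ _ y01 h.
  rewrite (bigD1 k)//= indicE mem_set; last first.
    by rewrite /J/= in_itv/= -ler_distlC distrC.
  by rewrite leeDl//; apply: sume_ge0 => k' _; rewrite lee_fin.
rewrite ge0_integral_sum; [|by []|by move=> k; exact: mE|by move=> k y _; rewrite lee_fin].
apply: (@le_trans _ _ (\sum_(k < 3) (2 * eps)%:E)%E); last first.
  by rewrite !big_ord_recr big_ord0/= -!EFinD lee_fin; lra.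
apply: lee_sum => k _; rewrite integral_indic//; last exact: (mJ k).
apply: (@le_trans _ _ (lebesgue_measure (J k))).
  apply: le_measure; [apply/mem_set|apply/mem_set; exact: (mJ k)|exact: subIsetl].
  by apply: measurableI => //; exact: (mJ k).
rewrite lebesgue_measure_itv/= lte_fin; case: ifP => _; last by rewrite lee_fin mulr_ge0.
by rewrite -EFinB lee_fin; lra.
Qed.

Definition majorant_term s j x : R :=
  2 `^ (s * j.+1%:R) * (`|sin (pi * x)| <= 2^-1 ^+ j)%R%:R.

(** A dyadic step function replacing |sin (pi x)|^(-s). It is integrated term by term from the
    measure of balls, and for s >= 0 it is infinite at the integers, so bounds by it hold there
    whatever [F1] is. *)
Definition singular_majorant s x : \bar R :=
  (\sum_(0 <= j <oo) (majorant_term s j x)%:E)%E.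

Lemma majorant_term_ge0 s j x : 0 <= majorant_term s j x.
Proof. by rewrite mulr_ge0 ?powR_ge0. Qed.

Lemma singular_majorant_ge0 s x : (0 <= singular_majorant s x)%E.
Proof. by apply: nneseries_ge0 => j _ _; rewrite lee_fin majorant_term_ge0. Qed.

Lemma measurable_majorant_term s j x :
  measurable_fun setT (fun y : R => majorant_term s j (x - y)).
Proof.
apply: measurable_funM => //.
exact: (measurable_natr_bool (measurable_sin_ball x _)).
Qed.

Lemma measurable_singular_majorant s x :
  measurable_fun setT (fun y : R => singular_majorant s (x - y)).
Proof.
apply: (@ge0_emeasurable_sum _ _ _ _ (fun j (y : R) => (majorant_term s j (x - y))%:E) xpredT).
  by move=> j y _ _; rewrite lee_fin majorant_term_ge0.
by move=> j _; apply/measurable_EFinP; exact: measurable_majorant_term.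
Qed.

Lemma singular_majorant_ge1 s x : 0 <= s -> (1 <= singular_majorant s x)%E.
Proof.
move=> s0; apply: le_trans (nneseries_lim_ge (m := 0) 1 _); last first.
  by move=> j _ _; rewrite lee_fin majorant_term_ge0.
rewrite big_nat1 lee_fin /majorant_term expr0 sin_max mulr1 mulr1.
by rewrite -[leLHS](powRr0 2) ler_powR// ler1n.
Qed.

(** One term suffices, that of the smallest dyadic ball containing x: |sin (pi x)| > 2^-(j+1) puts
    the power below 2^(s (j+1)), which explains the exponent j + 1 in [majorant_term]. *)
Lemma singular_majorant_ge s x : 0 <= s -> sin (pi * x) != 0 ->
  ((`|sin (pi * x)| `^ (- s))%:E <= singular_majorant s x)%E.
Proof.
move=> s0 sx; set z := `|_|; have z0 : 0 < z by rewrite normr_gt0.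
have [j zj jz] : exists2 j, 2^-1 ^+ j.+1 < z & z <= 2^-1 ^+ j.
  have ex : exists j, 2^-1 ^+ j.+1 < z.
    exists (Num.truncn z^-1).
    have : z^-1 < 2 ^+ (Num.truncn z^-1).+1.
      apply: (lt_trans (truncnS_gt z^-1)).
      by rewrite -natrX ltr_nat ltn_expl.
    by rewrite exprVn -[ltRHS]invrK ltf_pV2 ?posrE ?exprn_gt0 ?invr_gt0.
  case: (ex_minnP ex) => -[|j] hj mj; first by exists 0%N; rewrite // expr0 sin_max.
  exists j.+1 => //; rewrite leNgt; apply/negP => h.
  by have := mj _ h; rewrite ltnn.
apply: le_trans (nneseries_lim_ge (m := 0) j.+1 _); last first.
  by move=> i _ _; rewrite lee_fin majorant_term_ge0.
rewrite big_nat_recr//= -[leLHS]add0e leeD//.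
  by apply: sume_ge0 => i _; rewrite lee_fin majorant_term_ge0.
rewrite lee_fin /majorant_term jz mulr1 powRN.
have -> : 2 `^ (s * j.+1%:R) = ((2^-1 ^+ j.+1) `^ s)^-1 :> R.
  by rewrite exprVn -powR_invn// -powRrM -powRN; congr (_ `^ _); ring.
rewrite lef_pV2 ?posrE ?powR_gt0 ?exprn_gt0//.
by apply: ge0_ler_powR; rewrite ?nnegrE ?exprn_ge0 ?(ltW z0) ?(ltW zj).
Qed.

Lemma singular_majorant_pinfty s x : 0 <= s -> sin (pi * x) = 0 ->
  singular_majorant s x = +oo%E.
Proof.
move=> s0 sx; apply/eqyP => A A0.
apply: le_trans (nneseries_lim_ge (m := 0) (Num.truncn A).+1 _); last first.
  by move=> i _ _; rewrite lee_fin majorant_term_ge0.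
apply: (@le_trans _ _ (\sum_(0 <= i < (Num.truncn A).+1) 1%:E)%E).
  rewrite sumEFin lee_fin big_const_nat subn0 iter_addr_0 ltW//.
  exact: truncnS_gt.
apply: lee_sum => j _; rewrite lee_fin /majorant_term sx normr0 exprn_ge0// mulr1.
by rewrite -[leLHS](powRr0 2) ler_powR ?ler1n// mulr_ge0.
Qed.

(** Level j contributes 2^(s (j+1)) times a measure at most 6 * 2^-j: a geometric series of ratio
    2^(s-1) < 1, summed below by telescoping. *)
Lemma integral_singular_majorant s : 0 <= s < 1 ->
  exists2 C : R, 0 <= C & forall x,
    (\int[U]_y singular_majorant s (x - y) <= C%:E)%E.
Proof.
move=> /andP[s0 s1]; pose q : R := 2 `^ (s - 1).
have q0 : 0 <= q by exact: powR_ge0.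
have q1 : q < 1.
  rewrite /q powR_expR// -[ltRHS]expR0 ltr_expR nmulr_rlt0 ?subr_lt0//.
  by rewrite ln_gt0// ltr1n.
pose C := 6 * 2 `^ s / (1 - q).
have C0 : 0 <= C by rewrite divr_ge0 ?mulr_ge0 ?powR_ge0// subr_ge0 ltW.
exists C => // x.
rewrite integral_nneseries//; last 2 first.
- by move=> j; apply/measurable_EFinP; exact: measurable_majorant_term.
- by move=> j y _; rewrite lee_fin majorant_term_ge0.
apply: lime_le.
  by apply: is_cvg_nneseries => j _ _; apply: integral_ge0 => y _; rewrite lee_fin majorant_term_ge0.
near=> n; apply: (@le_trans _ _ (\sum_(0 <= j < n) (C * (q ^+ j - q ^+ j.+1))%:E)%E).
  apply: lee_sum => j _.
  rewrite (eq_integral (fun y : measurableTypeR R => ((2 `^ (s * j.+1%:R))%:E *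
    ((`|sin (pi * (x - y))| <= 2^-1 ^+ j)%R%:R)%:E)%E)); last first.
    by move=> y _; rewrite -EFinM.
  rewrite ge0_integralZl; last 4 first.
  - by [].
  - by apply/measurable_EFinP; exact: (measurable_natr_bool (measurable_sin_ball x _)).
  - by move=> y _; rewrite lee_fin.
  - by rewrite lee_fin powR_ge0.
  apply: (@le_trans _ _ ((2 `^ (s * j.+1%:R))%:E * (6 * 2^-1 ^+ j)%:E)%E).
    by rewrite lee_wpmul2l ?lee_fin ?powR_ge0// integral_sin_ball_le// exprn_ge0.
  rewrite -EFinM lee_fin le_eqVlt; apply/orP; left; apply/eqP.
  have -> : C * (q ^+ j - q ^+ j.+1) = 6 * 2 `^ s * q ^+ j.
    by rewrite /C exprS; field; rewrite subr_eq0 eq_sym lt_eqF.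
  have -> : s * j.+1%:R = s + s * j%:R by ring.
  rewrite powRD ?pnatr_eq0 ?implybT// powRrM powR_mulrn ?powR_ge0//.
  rewrite /q powRB ?pnatr_eq0 ?implybT// powRr1// expr_div_n exprVn; ring.
rewrite sumEFin lee_fin -mulr_sumr.
rewrite (@telescope_sumr_eq _ 0 n (fun j => - q ^+ j))//; last by move=> j _; ring.
rewrite expr0 opprK -[leRHS]mulr1 ler_wpM2l//.
by rewrite addrC lerBlDr lerDl exprn_ge0.
Unshelve. all: by end_near.
Qed.

End singular_majorant.

(** * Hoelder's inequality with a singular kernel *)

Section weighted_hoelder.
Context {R : realType} {d : nat}.
Local Notation X := (d.-tuple (measurableTypeR R)).
Implicit Types (f g phi : 'rV[R]_d -> R[i]).

(** Real and imaginary parts are estimated separately, which costs the factor 2. *)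
Lemma normc_integrable f (K : R) : torus_measurable f ->
  (\int[haar d]_t (normc (f (torus_point t)))%:E <= K%:E)%E ->
  torus_integrable f /\ normc (torus_integral f) <= 2 * K.
Proof.
move=> mf fK; have mn := torus_measurable_normc mf.
have ni : (haar d).-integrable [set: X] (EFin \o (fun t => normc (f (torus_point t)))).
  apply/integrableP; split; first exact/measurable_EFinP.
  rewrite (eq_integral (fun t : X => (normc (f (torus_point t)))%:E)).
    exact: le_lt_trans fK (ltry _).
  by move=> t _; rewrite /= ger0_norm// normc_ge0.
have Ri : (haar d).-integrable [set: X] (EFin \o (fun t => complex.Re (f (torus_point t)))).
  apply: le_integrable ni => //; first by apply/measurable_EFinP; case: mf.
  by move=> t _; rewrite lee_fin /= [leRHS]ger0_norm ?normc_ge0// ler_norm_Re.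
have Ii : (haar d).-integrable [set: X] (EFin \o (fun t => complex.Im (f (torus_point t)))).
  apply: le_integrable ni => //; first by apply/measurable_EFinP; case: mf.
  by move=> t _; rewrite lee_fin /= [leRHS]ger0_norm ?normc_ge0// ler_norm_Im.
split; first by split.
have nK : Rintegral (haar d) setT (fun t => normc (f (torus_point t))) <= K.
  rewrite -lee_fin fineK//; exact: integrable_fin_num.
have absi h : (haar d).-integrable [set: X] (EFin \o h) ->
    (haar d).-integrable [set: X] (EFin \o (fun t => `|h t|)).
  by move=> /integrable_abse.
apply: (le_trans (normc_le_ReIm _)) => /=.
rewrite -[2]/(1 + 1) mulrDl mul1r; apply: lerD.
  apply: (le_trans (le_normr_Rintegral _ Ri)) => //; apply: le_trans nK.
  by apply: le_Rintegral => //; [exact: absi|move=> t _; exact: ler_norm_Re].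
apply: (le_trans (le_normr_Rintegral _ Ii)) => //; apply: le_trans nK.
by apply: le_Rintegral => //; [exact: absi|move=> t _; exact: ler_norm_Im].
Qed.

(** Hoelder with q conjugate to p: the q-norm of k is at most B times the q-th root of the integral
    of the majorant, which factors over coordinates by Tonelli. The hypothesis compares q-th powers,
    so that the exponent s already includes q. *)
Lemma weighted_hoelder (p s : R) : 1 < p -> 0 <= s < 1 ->
  exists2 C : R, 0 <= C & forall (x : 'rV[R]_d) k phi (B : R),
    torus_measurable k -> Lp_space p phi -> 0 <= B ->
    (forall t : X, ((normc (k (torus_point t)) `^ (1 - p^-1)^-1)%:E <=
      (B `^ (1 - p^-1)^-1)%:E *
      \prod_j singular_majorant s (x 0%R j - tnth t j)%R)%E) ->
    torus_integrable (fun y => k y * phi y) /\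
    normc (torus_integral (fun y => k y * phi y)) <= C * B * fine (Lp_norm p phi).
Proof.
move=> p1 s01; set q := (1 - p^-1)^-1.
have p0 : 0 < p by lra.
have pV1 : p^-1 < 1 by rewrite invf_lt1.
have q0 : 0 < q by rewrite invr_gt0 subr_gt0.
have pq : q^-1 + p^-1 = 1 by rewrite /q invrK subrK.
have [C0 C00 hC0] := @integral_singular_majorant R s s01.
pose C := 2 * (C0 ^+ d) `^ q^-1; exists C; first by rewrite mulr_ge0 ?powR_ge0.
move=> x k phi B mk [_ [mphi phip]] B0 hk.
have mkp := torus_measurableM mk mphi.
have mK := torus_measurable_normc mk; have mP := torus_measurable_normc mphi.
have Lfin : Lp_norm p phi \is a fin_num by rewrite ge0_fin_numE ?Lnorm_ge0.
have LkB : (Lnorm (haar d) q%:E (EFin \o (fun t : X => normc (k (torus_point t)))) <=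
    (B * (C0 ^+ d) `^ q^-1)%:E)%E.
  rewrite unlock.
  have -> : B * (C0 ^+ d) `^ q^-1 = (B `^ q * C0 ^+ d) `^ q^-1.
    by rewrite powRM ?powR_ge0 ?exprn_ge0// -powRrM divff ?gt_eqF// powRr1.
  rewrite -poweR_EFin; set I := (integral _ _ _).
  have I0 : (0 <= I)%E by apply: integral_ge0 => t _; exact: poweR_ge0.
  have mW : measurable_fun [set: X]
      (fun t => (\prod_j singular_majorant s (x 0%R j - tnth t j)%R)%E).
    apply: emeasurable_prod => j.
    exact: (measurableT_comp (measurable_singular_majorant s (x 0 j)) (measurable_tnth j)).
  have IB : (I <= (B `^ q * C0 ^+ d)%:E)%E.
    apply: (@le_trans _ _ (\int[haar d]_t ((B `^ q)%:E *
        \prod_j singular_majorant s (x 0%R j - tnth t j)%R))%E).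
      rewrite /I (eq_integral (fun t : X => (normc (k (torus_point t)) `^ q)%:E)); last first.
        by move=> t _; rewrite /= ger0_norm ?normc_ge0.
      apply: ge0_le_integral.
      - by [].
      - by move=> t _; rewrite lee_fin powR_ge0.
      - apply/measurable_EFinP.
        exact: (@measurableT_comp _ _ _ _ _ _ (@powR R ^~ q)).
      - by apply: emeasurable_funM => //; exact: mW.
      - by move=> t _; exact: hk.
    rewrite ge0_integralZl; last 4 first.
    - by [].
    - exact: mW.
    - by move=> t _; apply: prode_ge0 => j; exact: singular_majorant_ge0.
    - by rewrite lee_fin powR_ge0.
    rewrite EFinM lee_wpmul2l ?lee_fin ?powR_ge0//.
    apply: (@integral_haar_prod_le R d (fun j (y : R) => singular_majorant s (x 0%R j - y))) => //.
    - by move=> j; exact: measurable_singular_majorant.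
    - by move=> j y; exact: singular_majorant_ge0.
  apply: gt0_ler_poweR => //.
  - by rewrite invr_ge0 ltW.
  - by rewrite in_itv/= I0 leey.
  - by rewrite in_itv/= leey andbT (le_trans I0).
have bound : (\int[haar d]_t (normc (k (torus_point t) * phi (torus_point t)))%:E <=
    (B * (C0 ^+ d) `^ q^-1 * fine (Lp_norm p phi))%:E)%E.
  have := hoelder (haar d) mK mP q0 p0 pq.
  rewrite Lnorm1 => /le_trans h.
  rewrite (eq_integral (fun t : X => `|(EFin \o ((fun t : X => normc (k (torus_point t))) \*
      (fun t : X => normc (phi (torus_point t))))%R) t|)%E); last first.
    by move=> t _; rewrite /= normcM ger0_norm// mulr_ge0 ?normc_ge0.
  apply: h; rewrite EFinM fineK//.
  by apply: lee_pmul => //; exact: Lnorm_ge0.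
have [ih nh] := normc_integrable mkp bound.
split=> //; apply: (le_trans nh).
by rewrite le_eqVlt; apply/orP; left; apply/eqP; rewrite /C; ring.
Qed.

End weighted_hoelder.

Section ereal_products.
Context {R : realType}.

Lemma le_prode (I : Type) (s : seq I) (g h : I -> \bar R) :
  (forall i, 0 <= g i)%E -> (forall i, g i <= h i)%E ->
  (\prod_(i <- s) g i <= \prod_(i <- s) h i)%E.
Proof.
move=> g0 gh; elim: s => [|i s IH]; first by rewrite !big_nil.
by rewrite !big_cons lee_pmul// prode_ge0.
Qed.

Lemma prode_ge1 (I : Type) (s : seq I) (h : I -> \bar R) :
  (forall i, 1 <= h i)%E -> (1 <= \prod_(i <- s) h i)%E.
Proof.
move=> h1; apply: (@le_trans _ _ (\prod_(i <- s) 1)%E); first by rewrite big1.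
exact: le_prode.
Qed.

(** Factors at least one exclude a vanishing factor, which would turn the product with +oo into
    0. *)
Lemma prode_pinfty (I : finType) (h : I -> \bar R) i :
  (forall i, 1 <= h i)%E -> h i = +oo%E -> (\prod_i h i = +oo)%E.
Proof.
move=> h1 hi; rewrite (bigD1 i)//= hi gt0_mulye//.
apply: (@lt_le_trans _ _ 1%E); first by rewrite lte01.
by elim/big_rec : _ => // j x _ x1;
  rewrite -[1%E]mule1 lee_pmul.
Qed.

Lemma prodEFin (I : Type) (s : seq I) (h : I -> R) :
  (\prod_(i <- s) (h i)%:E = (\prod_(i <- s) h i)%:E)%E.
Proof. by elim/big_rec2 : _ => // i y x _ ->; rewrite EFinM. Qed.

Lemma powR_prod (I : Type) (s : seq I) (h : I -> R) (q : R) :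
  (forall i, 0 <= h i) -> (\prod_(i <- s) h i) `^ q = \prod_(i <- s) (h i `^ q).
Proof.
move=> h0; elim: s => [|i s IH]; first by rewrite !big_nil powR1.
by rewrite !big_cons powRM ?IH// prodr_ge0.
Qed.

(** The factors are exchanged one at a time: each exchange costs [E], and the remaining factors are
    bounded through [A]. *)
Lemma normc_prod_sub (I : Type) (s : seq I) (a b : I -> R[i]) (w : I -> R) (A E : R) :
  1 <= A -> 0 <= E -> (forall i, 0 <= w i) ->
  (forall i, normc (a i) <= A * w i) -> (forall i, normc (b i) <= A * w i) ->
  (forall i, normc (a i - b i) <= E * w i) ->
  normc (\prod_(i <- s) a i - \prod_(i <- s) b i) <=
  (size s)%:R * A ^+ size s * E * \prod_(i <- s) w i.
Proof.
move=> A1 E0 w0 ha hb hab; have A0 : 0 <= A by lra.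
have pa s' : normc (\prod_(i <- s') a i) <= A ^+ size s' * \prod_(i <- s') w i.
  elim: s' => [|i s' IH]; first by rewrite !big_nil normc1 expr0 mulr1.
  rewrite !big_cons normcM exprS mulrACA; apply: ler_pM => //; exact: normc_ge0.
elim: s => [|i s IH]; first by rewrite !big_nil subrr normc0 !mul0r.
rewrite !big_cons /=; set PA := \prod_(i <- s) a i; set PB := \prod_(i <- s) b i.
set PW := \prod_(i <- s) w i; set n := size s in IH *.
have PW0 : 0 <= PW by exact: prodr_ge0.
have -> : a i * PA - b i * PB = (a i - b i) * PA + b i * (PA - PB) by ring.
apply: (le_trans (ler_normcD _ _)); rewrite !normcM.
apply: (@le_trans _ _ (E * w i * (A ^+ n * PW) + A * w i * (n%:R * A ^+ n * E * PW))).
  by apply: lerD; apply: ler_pM; rewrite ?normc_ge0 ?pa.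
have -> : n.+1%:R * A ^+ n.+1 * E * (w i * PW) =
  E * w i * (A ^+ n * PW) * A + A * w i * (n%:R * A ^+ n * E * PW).
  by rewrite -natr1 exprS; ring.
by rewrite lerD2r ler_peMr// !mulr_ge0// exprn_ge0.
Qed.

End ereal_products.

(** * Truncation error of the convolution *)

Section convolution_approximation.
Context {R : realType} {d : nat}.
Local Notation X := (d.-tuple (measurableTypeR R)).
Implicit Types (x : 'rV[R]_d) (phi : 'rV[R]_d -> R[i]).

Definition partial_kernel (r : R) K x : R[i] := \prod_j F_partial r (x 0 j) K.

Definition partial_conv (r : R) K phi x : R[i] :=
  torus_integral (fun y => partial_kernel r K (x - y) * phi y).

Lemma torus_measurable_kernel (r : R) x : 0 < r ->
  torus_measurable (fun y : 'rV[R]_d => F_kernel r (x - y)).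
Proof.
move=> r0; have [mR mI] := measurable_F1 r0.
apply: torus_measurable_prod => j.
have mt : measurable_fun [set: X] (fun t : X => x 0 j - tnth t j).
  by apply: measurable_funB => //; exact: measurable_tnth.
split; [rewrite (_ : (fun t => _) = (fun z => complex.Re (F1 r z)) \o (fun t => x 0 j - tnth t j))|
  rewrite (_ : (fun t => _) = (fun z => complex.Im (F1 r z)) \o (fun t => x 0 j - tnth t j))];
  try (by apply/funext => t; rewrite /= !mxE); exact: measurableT_comp.
Qed.

Lemma torus_measurable_partial_kernel (r : R) K x :
  torus_measurable (fun y : 'rV[R]_d => partial_kernel r K (x - y)).
Proof.
apply: torus_measurable_prod => j.
have mt : measurable_fun [set: X] (fun t : X => x 0 j - tnth t j).
  by apply: measurable_funB => //; exact: measurable_tnth.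
split.
  rewrite (_ : (fun t => _) = real_partial r K \o (fun t => x 0 j - tnth t j)).
    exact: (measurableT_comp (measurable_real_partial r K)).
  by apply/funext => t; rewrite F_partialE /= !mxE.
rewrite (_ : (fun t => _) = cst 0)//.
by apply/funext => t; rewrite F_partialE.
Qed.

Lemma F1_tail_weight (r alpha : R) :
  0 < r -> 0 <= alpha <= 1 -> 1 < r + alpha ->
  exists A C : R, [/\ 1 <= A, 0 < C & forall K z, (0 < K)%N -> sin (pi * z) != 0 ->
    [/\ normc (F1 r z) <= A * singular_weight alpha z,
        normc (F_partial r z K) <= A * singular_weight alpha z &
        normc (F1 r z - F_partial r z K) <=
          C * K%:R `^ (- (r + alpha - 1)) * singular_weight alpha z]].
Proof.
move=> r0 a01 ra; have [C C0 hC] := F1_tail r0 a01 ra.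
(* The partial sum of order one is at most 3; one [C] leads from it to the limit, another back to
   the K-th partial sum. [C + 1] is positive even if [C] vanishes. *)
exists (3 + 2 * C), (C + 1); split; [lra|lra|] => K z K0 sz.
have w1 : 1 <= singular_weight alpha z by apply: singular_weight_ge1 => //; case/andP: a01.
have [g [-> _ hg]] := hC z sz; rewrite F_partialE -rmorphB !normc_real.
have eta0 : 0 <= r + alpha - 1 by lra.
have kw (k : nat) : (0 < k)%N -> `|g - real_partial r k z| <= C * singular_weight alpha z.
  move=> k0; apply: (le_trans (hg k k0)); rewrite ler_wpM2r ?powR_ge0//.
  rewrite ler_piMr// powRN invf_le1 ?powR_gt0 ?ltr0n// -[leLHS](powRr0 k%:R).
  by rewrite ler_powR ?ler1n.
have T1 : `|real_partial r 1 z| <= 3 * singular_weight alpha z.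
  apply: (@le_trans _ _ 3); last by rewrite ler_peMr.
  rewrite /real_partial big_nat1 powR1 mul1r.
  have := cos_max (2 * pi * (1%:R * z)); rewrite ler_norml => /andP[h1 h2].
  by rewrite ler_norml; apply/andP; split; lra.
have gw : `|g| <= (3 + C) * singular_weight alpha z.
  rewrite -[g](subrK (real_partial r 1 z)) (le_trans (ler_normD _ _))//.
  by rewrite addrC mulrDl lerD// kw.
split.
- by apply: (le_trans gw); rewrite ler_wpM2r ?powR_ge0//; lra.
- rewrite -[real_partial r K z](subKr g) (le_trans (ler_normB _ _))//.
  have := kw K K0; lra.
- apply: (le_trans (hg K K0)); rewrite ler_wpM2r ?powR_ge0//.
  by rewrite ler_wpM2r ?powR_ge0//; lra.
Qed.

Lemma kernel_tail (r p : R) : 1 < p -> p^-1 < r ->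
  exists s eta C : R, [/\ 0 <= s < 1, 0 < eta, 0 < C &
  forall K x (t : X), (0 < K)%N ->
    ((normc (F_kernel r (x - torus_point t) - partial_kernel r K (x - torus_point t))
        `^ (1 - p^-1)^-1)%:E <=
     ((C * K%:R `^ (- eta)) `^ (1 - p^-1)^-1)%:E *
     \prod_j singular_majorant s (x 0%R j - tnth t j)%R)%E].
Proof.
move=> p1 pr; have [alpha [a01 ra ap]] := exists_tail_exponent p1 pr.
have pV : 0 < p^-1 by rewrite invr_gt0; lra.
have r0 : 0 < r by lra.
have pV1 : p^-1 < 1 by rewrite invf_lt1; lra.
set q := (1 - p^-1)^-1; have q0 : 0 < q by rewrite invr_gt0 subr_gt0.
have a0 : 0 <= alpha by case/andP: a01.
have [A [C [A1 C0 hT]]] := F1_tail_weight r0 a01 ra.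
(* alpha q < 1 restates alpha < 1 - 1/p. The factor [d.+1] keeps the constant positive in dimension
   zero. *)
exists (alpha * q), (r + alpha - 1), (d.+1%:R * A ^+ d * C).
have s0 : 0 <= alpha * q by rewrite mulr_ge0// ltW.
split.
- by rewrite s0/= /q ltr_pdivrMr ?subr_gt0// mul1r.
- lra.
- by rewrite !mulr_gt0 ?exprn_gt0//; lra.
move=> K x t K0; set eta := r + alpha - 1.
have Keta : 0 < K%:R `^ (- eta) :> R by rewrite powR_gt0 ?ltr0n.
set B := _ * C * _; have B0 : 0 < B by rewrite !mulr_gt0 ?exprn_gt0//; lra.
(* On a singular hyperplane [F_kernel] may be a default value, but the majorant is infinite
   there. *)
have [/existsP[j /eqP sj]|/existsPn sn0] := boolP [exists j, sin (pi * (x 0 j - tnth t j)) == 0].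
  rewrite (@prode_pinfty _ _ _ j) ?gt0_muley ?leey ?lte_fin ?powR_gt0//.
  - by move=> i; exact: singular_majorant_ge1.
  - exact: singular_majorant_pinfty.
pose w j := singular_weight alpha (x 0 j - tnth t j).
have w0 j : 0 <= w j by exact: powR_ge0.
have diff : normc (F_kernel r (x - torus_point t) - partial_kernel r K (x - torus_point t))
    <= B * \prod_j w j.
  have xj j : (x - torus_point t) 0 j = x 0 j - tnth t j by rewrite !mxE.
  rewrite /F_kernel /partial_kernel.
  apply: (le_trans (@normc_prod_sub _ _ _ _ _ w A (C * K%:R `^ (- eta)) A1 _ w0 _ _ _)).
  - by rewrite mulr_ge0// ltW.
  - by move=> j; rewrite xj; case: (hT K _ K0 (sn0 j)).
  - by move=> j; rewrite xj; case: (hT K _ K0 (sn0 j)).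
  - by move=> j; rewrite xj; case: (hT K _ K0 (sn0 j)).
  rewrite ler_wpM2r ?prodr_ge0// /B.
  have -> : size (index_enum 'I_d) = d by rewrite -[RHS]card_ord cardT enumT.
  rewrite -!mulrA ler_wpM2r ?ler_nat//.
  by rewrite !mulr_ge0 ?exprn_ge0 ?(ltW C0) ?(ltW Keta)//; lra.
apply: (@le_trans _ _ ((B * \prod_j w j) `^ q)%:E).
  rewrite lee_fin; apply: ge0_ler_powR; rewrite ?nnegrE ?normc_ge0 ?(ltW q0)//.
  by rewrite mulr_ge0 ?prodr_ge0// ltW.
rewrite powRM ?(ltW B0) ?prodr_ge0// EFinM lee_wpmul2l ?lee_fin ?powR_ge0//.
rewrite powR_prod// -prodEFin; apply: le_prode => j; first by rewrite lee_fin powR_ge0.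
by rewrite /w /singular_weight -powRrM mulNr; exact: singular_majorant_ge.
Qed.

End convolution_approximation.

(** * Truncated convolutions as trigonometric polynomials *)

Section trigonometric_approximation.
Context {R : realType} {d : nat}.
Local Notation X := (d.-tuple (measurableTypeR R)).
Implicit Types (x : 'rV[R]_d) (phi : 'rV[R]_d -> R[i]).

(** The case s = 0 of [weighted_hoelder], as the majorant is at least one. *)
Lemma bounded_mul_integrable (p B : R) (k phi : 'rV[R]_d -> R[i]) : 1 < p ->
  torus_measurable k -> (forall x, normc (k x) <= B) -> Lp_space p phi ->
  torus_integrable (fun y => k y * phi y).
Proof.
move=> p1 mk kB hphi.
have [C _ hC] := @weighted_hoelder R d p 0 p1 (introT andP (conj (lexx 0) ltr01)).
have B0 : 0 <= B by apply: le_trans (kB 0); exact: normc_ge0.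
have pV1 : p^-1 < 1 by rewrite invf_lt1; lra.
have [] // := hC 0 k phi B mk hphi B0 => t.
apply: (@le_trans _ _ (B `^ (1 - p^-1)^-1)%:E).
  rewrite lee_fin; apply: ge0_ler_powR; rewrite ?nnegrE ?normc_ge0//.
  by rewrite invr_ge0 subr_ge0 ltW.
rewrite -[leLHS]mule1 lee_wpmul2l ?lee_fin ?powR_ge0//.
by apply: prode_ge1 => j; exact: singular_majorant_ge1.
Qed.

Lemma partial_kernel_bounded (r : R) K x :
  normc (partial_kernel r K x) <= (1 + 2 * \sum_(1 <= k < K.+1) k%:R `^ (- r)) ^+ d.
Proof.
rewrite normc_prod -[X in _ ^+ X](card_ord d) -prodr_const; apply: ler_prod => j _.
rewrite normc_ge0/= F_partialE normc_real /real_partial.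
apply: (le_trans (ler_normD _ _)); rewrite normr1 lerD2l normrM ger0_norm// ler_pM2l//.
apply: (le_trans (ler_norm_sum _ _ _)); apply: ler_sum => k _.
by rewrite normrM ger0_norm ?powR_ge0// ler_piMr ?powR_ge0// cos_max.
Qed.

Lemma conv_approximation (r p : R) : 1 < p -> p^-1 < r ->
  exists eta C : R, [/\ 0 < eta, 0 <= C & forall K phi x, (0 < K)%N ->
    Lp_space p phi ->
    normc (F_conv r phi x - partial_conv r K phi x) <=
    C * K%:R `^ (- eta) * fine (Lp_norm p phi)].
Proof.
move=> p1 pr; have [s [eta [C [s01 eta0 C0 hK]]]] := @kernel_tail R d r p p1 pr.
have [C' C'0 hC] := @weighted_hoelder R d p s p1 s01.
have r0 : 0 < r by apply: lt_trans pr; rewrite invr_gt0; lra.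
exists eta, (C' * C); split=> //; first by rewrite mulr_ge0// ltW.
move=> K phi x K0 hphi.
pose k y := F_kernel r (x - y) - partial_kernel r K (x - y).
have mk : torus_measurable k.
  apply: torus_measurableD; first exact: torus_measurable_kernel.
  by apply: torus_measurableN; exact: torus_measurable_partial_kernel.
have [|ik nk] := hC x k phi (C * K%:R `^ (- eta)) mk hphi _ (fun t => hK K x t K0).
  by rewrite mulr_ge0 ?powR_ge0// ltW.
have ip : torus_integrable (fun y => partial_kernel r K (x - y) * phi y).
  apply: (bounded_mul_integrable p1 _ _ hphi).
    exact: torus_measurable_partial_kernel.
  by move=> y; exact: partial_kernel_bounded.
have -> : F_conv r phi x = torus_integral (fun y => k y * phi y) + partial_conv r K phi x.
  rewrite -torus_integralD//; congr torus_integral; apply/funext => y.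
  by rewrite -mulrDl subrK.
by rewrite addrK mulrA in nk *.
Qed.

(** The kernel is built from exp(-2 pi i k x): the summation index k = f j - K belongs to the
    character of frequency -k. *)
Definition frequency K (f : {ffun 'I_d -> 'I_(2 * K).+1}) : 'rV[int]_d :=
  \row_j (K%:Z - (f j : nat)%:Z).

Definition trig_poly K (c : {ffun 'I_d -> 'I_(2 * K).+1} -> R[i]) x : R[i] :=
  \sum_f c f * trig_char (frequency f) x.

Lemma frequency_inj K : injective (@frequency K).
Proof.
move=> f g /rowP fg; apply/ffunP => j; have := fg j; rewrite !mxE.
by move=> /addrI/oppr_inj[] h; exact: val_inj.
Qed.

Definition fourier_coef phi (k : 'rV[int]_d) : R[i] :=
  torus_integral (fun y => trig_char (- k) y * phi y).

Definition kernel_coef (r : R) (k : 'rV[int]_d) : R :=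
  \prod_j (Num.max 1 `|(k 0 j)%:~R|) `^ (- r).

Lemma partial_kernelE (r : R) K x :
  partial_kernel r K x =
  trig_poly (fun f : {ffun 'I_d -> 'I_(2 * K).+1} => (kernel_coef r (frequency f))%:C%C) x.
Proof.
rewrite /partial_kernel /F_partial.
under eq_bigr do rewrite big_mkord.
rewrite bigA_distr_bigA/=; apply: eq_bigr => f _.
rewrite big_split/=; congr (_ * _).
  rewrite /kernel_coef rmorph_prod/=; apply: eq_bigr => j _.
  by rewrite mxE -normrN opprB intr_norm.
rewrite /trig_char; elim/big_rec2 : _ => [|j y z _ ->]; first by rewrite (expi2pi_int 0).
rewrite expi2piD; congr (expi2pi _ * _).
by rewrite mxE -mulNr -rmorphN opprB.
Qed.

Lemma partial_convE (r p : R) K phi x : 1 < p -> Lp_space p phi ->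
  partial_conv r K phi x =
  trig_poly (fun f : {ffun 'I_d -> 'I_(2 * K).+1} =>
    (kernel_coef r (frequency f))%:C%C * fourier_coef phi (frequency f)) x.
Proof.
move=> p1 hphi; rewrite /partial_conv.
have it (k : 'rV[int]_d) : torus_integrable (fun y => trig_char (- k) y * phi y).
  apply: (@bounded_mul_integrable p 1) => //; first exact: torus_measurable_char.
  by move=> y; rewrite normc_trig_char.
rewrite (_ : (fun y => _) = (fun y => \sum_(f : {ffun 'I_d -> 'I_(2 * K).+1})
    ((kernel_coef r (frequency f))%:C%C * trig_char (frequency f) x) *
    (trig_char (- frequency f) y * phi y))); last first.
  apply/funext => y; rewrite partial_kernelE /trig_poly mulr_suml; apply: eq_bigr => f _.
  by rewrite trig_char_add trig_char_opp; ring.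
rewrite torus_integral_sum; last by move=> f; exact: torus_integrableZ.
by apply: eq_bigr => f _; rewrite torus_integralZ// /fourier_coef; ring.
Qed.

End trigonometric_approximation.

(** * The unit ball *)

Section haar_boxes.
Context {R : realType}.
Local Notation U := (uniform_prob (@ltr01 R)).
Local Notation X d := (d.-tuple (measurableTypeR R)).

Definition box d (a b : 'I_d -> R) : set (X d) :=
  [set t | forall j, a j <= tnth t j <= b j].

Lemma measurable_box d (a b : 'I_d -> R) : measurable (box a b).
Proof.
rewrite (_ : box a b = \bigcap_(j in [set: 'I_d])
    ((fun t : X d => tnth t j) @^-1` `[a j, b j]%classic)); last first.
  apply/seteqP; split => t /= h j; first by move=> _; rewrite /preimage/= in_itv/=; exact: h.
  by have := h j Logic.I; rewrite /preimage/= in_itv.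
apply: fin_bigcap_measurable; first exact: finite_finset.
move=> j _; rewrite -[_ @^-1` _]setTI; exact: measurable_tnth.
Qed.

Lemma uniform_itv_gt0 (a b : R) : 0 <= a -> a < b -> b <= 1 ->
  (0 < U `[a, b]%classic)%E.
Proof.
move=> a0 ab b1.
rewrite -[Z in U Z]setIT -(@integral_indic _ _ _ U)//.
rewrite integral_uniform//; last exact/measurable_EFinP/measurable_indic.
rewrite subr0 invr1 mul1e integral_indic// setIidl; last first.
  by move=> x /=; rewrite !in_itv/= => /andP[h1 h2]; apply/andP; split; lra.
apply: (@lt_le_trans _ _ (lebesgue_measure `[a, b]%classic)); last exact: lexx.
by rewrite lebesgue_measure_itv/= lte_fin ab -EFinB lte_fin subr_gt0.
Qed.

Lemma haar_box_gt0 d (a b : 'I_d -> R) :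
  (forall j, [/\ 0 <= a j, a j < b j & b j <= 1]) -> (0 < haar d (box a b))%E.
Proof.
elim: d a b => [|d IH] a b hab.
  rewrite /= diracE mem_set ?lte01// => -[]//.
have -> : haar d.+1 (box a b) = (U `[a ord0, b ord0]%classic *
    haar d (box (fun j => a (lift ord0 j)) (fun j => b (lift ord0 j))))%E.
  rewrite -product_measure1E; [|exact: measurable_itv|exact: measurable_box].
  rewrite /= /distribution /pushforward; congr (product_measure1 _ _ _).
  apply/seteqP; split => -[x t] /=.
    move=> h; split.
      by have := h ord0; rewrite (tnth_nth 0)/= in_itv.
    by move=> j; have := h (lift ord0 j); rewrite (tnth_nth 0)/= -tnth_nth.
  move=> [hx ht] j; case: (unliftP ord0 j) => [j' ->|->].
    by rewrite (tnth_nth 0)/= -tnth_nth; exact: ht.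
  by rewrite (tnth_nth 0)/=; move: hx; rewrite in_itv.
apply: mule_gt0; last by apply: IH => j; exact: hab.
by case: (hab ord0) => *; exact: uniform_itv_gt0.
Qed.

End haar_boxes.

Section continuity.
Context {R : realType} {d : nat}.
Implicit Types (f : 'rV[R]_d -> R[i]).

Lemma continuous_complex f :
  continuous (fun x => complex.Re (f x)) -> continuous (fun x => complex.Im (f x)) ->
  continuous (f : 'rV[R]_d -> R[i]^o).
Proof.
move=> cr ci x; have FF : Filter (nbhs x) by exact: nbhs_filter.
apply/cvgrPdist_lt => e; case: e => e0 e1; rewrite ltcE/= => /andP[/eqP -> e0p].
have e2 : 0 < e0 / 2 by rewrite divr_gt0.
move/cvgrPdist_lt : (cr x) => /(_ _ e2) h1; move/cvgrPdist_lt : (ci x) => /(_ _ e2) h2.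
apply: (@filterS2 _ _ (nbhs_filter x) _ _ _ _ h1 h2) => y hy1 hy2; rewrite normc_def ltcR.
have -> : Num.sqrt (complex.Re (f x - f y) ^+ 2 + complex.Im (f x - f y) ^+ 2) = normc (f x - f y).
  by case: (f x - f y).
apply: (le_lt_trans (normc_le_ReIm _)); rewrite Re_add Im_add Re_opp Im_opp (splitr e0).
by apply: ltrD.
Qed.

Lemma continuous_trig_char (k : 'rV[int]_d) : continuous (trig_char k : 'rV[R]_d -> R[i]^o).
Proof.
have cd : continuous (fun x : 'rV[R]_d => 2 * pi * \sum_j (k 0 j)%:~R * x 0 j).
  have cs (s : seq 'I_d) : continuous (fun x : 'rV[R]_d => \sum_(j <- s) (k 0 j)%:~R * x 0 j).
    elim: s => [|j s IH].
      by rewrite (_ : (fun x => _) = cst 0); [exact: cst_continuous|apply/funext => x; rewrite big_nil].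
    rewrite (_ : (fun x => _) = (fun x : 'rV[R]_d => (k 0 j)%:~R * x 0 j) +
        (fun x => \sum_(j <- s) (k 0 j)%:~R * x 0 j)); last first.
      by apply/funext => x; rewrite big_cons.
    move=> x; apply: continuousD; last exact: IH.
    by apply: continuousM; [exact: cst_continuous|exact: coord_continuous].
  move=> x; apply: (@continuous_comp _ _ _ (fun x : 'rV[R]_d => \sum_j (k 0 j)%:~R * x 0 j)
    ( *%R (2 * pi))); [exact: cs|exact: mulrl_continuous].
apply: continuous_complex => x.
  by apply: (continuous_comp (cd x)); exact: continuous_cos.
by apply: (continuous_comp (cd x)); exact: continuous_sin.
Qed.

Lemma normc_continuous f (x : 'rV[R]_d) (e : R) :
  {for x, continuous (f : 'rV[R]_d -> R[i]^o)} -> 0 < e ->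
  \forall y \near x, normc (f x - f y) < e.
Proof.
have FF : Filter (nbhs x) by exact: nbhs_filter.
move=> cf e0; have e0' : 0 < (e%:C)%C :> R[i] by rewrite ltcR.
move/cvgrPdist_lt : cf => /(_ _ e0'); apply: (@filterS _ _ (nbhs_filter x)) => y.
by rewrite normc_def ltcR; case: (f x - f y).
Qed.

(* Haar measure charges every open set, so an almost everywhere bound on a
   continuous periodic function holds everywhere. *)
Lemma ae_le_everywhere f (e : R) : torus_fun f ->
  continuous (f : 'rV[R]_d -> R[i]^o) ->
  {ae haar d, forall t, normc (f (torus_point t)) <= e} ->
  forall x, normc (f x) <= e.
Proof.
move=> pf cf [N [mN N0 hN]] x0.
pose x : 'rV[R]_d := \row_j (x0 0 j - (Num.floor (x0 0 j))%:~R).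
have -> : f x0 = f x.
  have -> : x = x0 + map_mx intr (\row_j (- Num.floor (x0 0 j))).
    by apply/rowP => j; rewrite !mxE rmorphN.
  by rewrite pf.
have x01 j : 0 <= x 0 j < 1.
  have := floor_itv (x0 0 j); rewrite intrD => /andP[h1 h2].
  by rewrite mxE; apply/andP; split; lra.
rewrite leNgt; apply/negP => fe.
have e0 : 0 < normc (f x) - e by rewrite subr_gt0.
have [P hP hPf] := normc_continuous (cf x) e0.
have hd j : exists b, [/\ x 0 j < b, b <= 1 & forall y, x 0 j <= y <= b -> P 0 j y].
  have /nbhs_ballP[dl /= dl0 hdl] := hP 0 j.
  exists (Num.min (x 0 j + dl / 2) 1); have /andP[h1 h2] := x01 j.
  rewrite lt_min h2 andbT ltrDl divr_gt0// ge_min lexx orbT; split=> // y.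
  rewrite le_min => /andP[y1 /andP[y2 _]]; apply: hdl.
  rewrite /ball/= distrC ger0_norm ?subr_ge0// ltrBlDl.
  apply: (le_lt_trans y2); rewrite ltrD2l; lra.
have [b hb] := choice hd.
have box0 : (0 < haar d (box (fun j => x 0%R j) b))%E.
  by apply: haar_box_gt0 => j; have [h1 h2 _] := hb j; have /andP[] := x01 j.
have : (haar d (box (fun j => x 0%R j) b) <= haar d N)%E.
  apply: le_measure; [apply/mem_set; exact: measurable_box|exact/mem_set|].
  move=> t ht; apply: hN => /= te.
  have : normc (f x - f (torus_point t)) < normc (f x) - e.
    apply: hPf => i j; rewrite ord1 mxE.
    by have [_ _ h] := hb j; apply: h; exact: ht.
  have := ler_normcD (f x - f (torus_point t)) (f (torus_point t)).
  rewrite subrK; lra.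
by rewrite N0 leNgt box0.
Qed.

End continuity.

(** * Uniform approximation of the unit ball *)

Section unit_ball.
Context {R : realType} {d : nat}.
Local Notation X := (d.-tuple (measurableTypeR R)).
Implicit Types (f phi : 'rV[R]_d -> R[i]).

Lemma torus_fun_trig_char (k : 'rV[int]_d) : torus_fun (trig_char k : 'rV[R]_d -> R[i]).
Proof. by move=> x z; rewrite trig_char_add trig_char_intr mulr1. Qed.

Lemma torus_fun_sum_char (I : Type) (s : seq I) (c : I -> R[i]) (k : I -> 'rV[int]_d) :
  torus_fun (fun x : 'rV[R]_d => \sum_(i <- s) c i * trig_char (k i) x).
Proof. by move=> x z; apply: eq_bigr => i _; rewrite torus_fun_trig_char. Qed.

Lemma continuous_sum_char (I : Type) (s : seq I) (c : I -> R[i]) (k : I -> 'rV[int]_d) :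
  continuous ((fun x : 'rV[R]_d => \sum_(i <- s) c i * trig_char (k i) x) : 'rV[R]_d -> R[i]^o).
Proof.
elim: s => [|i s IH].
  by rewrite (_ : (fun x => _) = cst 0); [exact: cst_continuous|apply/funext => x; rewrite big_nil].
rewrite (_ : (fun x => _) = ((fun x => c i *: (trig_char (k i) x : R[i]^o)) : 'rV[R]_d -> R[i]^o) +
    (fun x => \sum_(i <- s) c i * trig_char (k i) x)); last first.
  by apply/funext => x; rewrite big_cons.
move=> x; apply: continuousD; last exact: IH.
apply: continuousZ; first exact: cst_continuous.
exact: continuous_trig_char.
Qed.

Lemma torus_measurable_sum_char (I : Type) (s : seq I) (c : I -> R[i]) (k : I -> 'rV[int]_d) :
  torus_measurable (fun x : 'rV[R]_d => \sum_(i <- s) c i * trig_char (k i) x).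
Proof.
apply: torus_measurable_sum => i; apply: torus_measurableM.
  exact: torus_measurable_cst.
exact: torus_measurable_char.
Qed.

Lemma normc_sum_char (I : Type) (s : seq I) (c : I -> R[i]) (k : I -> 'rV[int]_d) (x : 'rV[R]_d) :
  normc (\sum_(i <- s) c i * trig_char (k i) x) <= \sum_(i <- s) normc (c i).
Proof.
apply: (le_trans (ler_normc_sum _ _ _)); apply: ler_sum => i _.
by rewrite normcM normc_trig_char mulr1.
Qed.

(** The norm is an infimum over densities; the bound 2 avoids having to attain it. *)
Lemma SW_norm_le1_density (r p : R) f : (SW_norm r p f <= 1)%E ->
  SW_space r p f /\ exists2 phi, SW_density r p f phi & (Lp_norm p phi < 2%:E)%E.
Proof.
move=> f1; have /ereal_inf_lt : (SW_norm r p f < 2%:E)%E.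
  by apply: (le_lt_trans f1); rewrite lte_fin ltr1n.
by move=> [_ [phi [Sf Df] <-] phi2]; split=> //; exists phi.
Qed.

(** The approximant is the truncated convolution with a density of norm below 2. As f agrees with
    the convolution only almost everywhere, continuity is what makes the bound hold at every
    point. *)
Lemma unit_ball_approximation (r p : R) : 1 < p -> p^-1 < r ->
  exists eta C : R, [/\ 0 < eta, 0 <= C & forall f K, (SW_norm r p f <= 1)%E -> (0 < K)%N ->
    exists c : {ffun 'I_d -> 'I_(2 * K).+1} -> R[i],
      forall x, normc (f x - trig_poly c x) <= C * K%:R `^ (- eta)].
Proof.
move=> p1 pr; have [eta [C [eta0 C0 hC]]] := @conv_approximation R d r p p1 pr.
exists eta, (C * 2); split=> //; first by rewrite mulr_ge0.
move=> f K /SW_norm_le1_density[[pf [cf _]] [phi [Lphi fphi] phi2]] K0.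
pose c (g : {ffun 'I_d -> 'I_(2 * K).+1}) :=
  (kernel_coef r (frequency g))%:C%C * fourier_coef phi (frequency g).
exists c; apply: ae_le_everywhere.
- move=> x z; rewrite pf; congr (_ - _); exact: torus_fun_sum_char.
- move=> x; apply: continuousB; first exact: cf.
  exact: continuous_sum_char.
- apply: filterS fphi => t ->.
  rewrite -(partial_convE r K _ p1 Lphi) (le_trans (hC _ _ _ K0 Lphi))//.
  rewrite [leRHS]mulrAC ler_wpM2l ?mulr_ge0 ?powR_ge0//.
  have Lfin : Lp_norm p phi \is a fin_num by case: Lphi => _ [_ ?]; rewrite ge0_fin_numE ?Lnorm_ge0.
  by rewrite -lee_fin fineK// ltW.
Qed.

Lemma torus_measurable_uniform_limit f :
  (forall e : R, 0 < e -> exists2 g, torus_measurable g & forall x, normc (f x - g x) <= e) ->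
  torus_measurable f.
Proof.
move=> h.
have h' (n : nat) : exists g : 'rV[R]_d -> R[i], torus_measurable g /\
    forall x, normc (f x - g x) <= n.+1%:R^-1.
  by have [|g mg hg] := h n.+1%:R^-1; [rewrite invr_gt0|exists g].
have [g hg] := choice h'.
have cv (u : nat -> R) l : (forall n, `|l - u n| <= n.+1%:R^-1) -> u n @[n --> \oo] --> l.
  move=> hu; apply/cvgrPdist_le => e e0; near=> n.
  apply: (le_trans (hu n)); rewrite invf_ple ?posrE//.
  near: n; exists (Num.truncn e^-1) => // n /= hn.
  by rewrite ltW// (lt_le_trans (truncnS_gt _))// ler_nat ltnS.
split.
  apply: (@measurable_fun_cvg _ _ _ _ (fun n (t : X) => complex.Re (g n (torus_point t)))).
    by move=> n; case: (hg n) => -[].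
  move=> t _; apply: cv => n; have [_ hn] := hg n.
  by rewrite -Re_opp -Re_add (le_trans (ler_norm_Re _)).
apply: (@measurable_fun_cvg _ _ _ _ (fun n (t : X) => complex.Im (g n (torus_point t)))).
  by move=> n; case: (hg n) => -[].
move=> t _; apply: cv => n; have [_ hn] := hg n.
by rewrite -Im_opp -Im_add (le_trans (ler_norm_Im _)).
Unshelve. all: by end_near.
Qed.

(** Measurability is inherited from trigonometric polynomials through uniform convergence. *)
Lemma unit_ball_measurable (r p : R) f : 1 < p -> p^-1 < r ->
  (SW_norm r p f <= 1)%E -> torus_measurable f.
Proof.
move=> p1 pr f1; apply: torus_measurable_uniform_limit => e e0.
have [eta [C [eta0 C0 hC]]] := unit_ball_approximation p1 pr.
have [K K0 hK] := powRN_small C eta0 e0.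
have [c hc] := hC f K f1 K0; exists (trig_poly c); first exact: torus_measurable_sum_char.
by move=> x; rewrite (le_trans (hc x))// ltW.
Qed.

Lemma unit_ball_bounded (r p : R) f : 1 < p -> p^-1 < r ->
  (SW_norm r p f <= 1)%E -> exists M : R, forall x, normc (f x) <= M.
Proof.
move=> p1 pr f1; have [eta [C [eta0 C0 hC]]] := unit_ball_approximation p1 pr.
have [c hc] := hC f 1%N f1 isT.
exists (C * 1 `^ (- eta) + \sum_g normc (c g)) => x.
rewrite -[f x](subrK (trig_poly c x)) (le_trans (ler_normcD _ _))// lerD//.
exact: normc_sum_char.
Qed.

End unit_ball.

(** * The grid and the width *)

Section grid.
Context {R : realType} {d : nat} (L : nat).
Hypothesis L0 : (0 < L)%N.
Local Notation G := {ffun 'I_d -> 'I_L}.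

Let Lneq0 : L%:R != 0 :> R.
Proof. by rewrite pnatr_eq0 -lt0n. Qed.

Definition grid_point (t : G) : 'rV[R]_d := \row_j ((t j : nat)%:R / L%:R).

Lemma expi2pi_neq1 (y : R) : 0 < y < 1 -> expi2pi y != 1.
Proof.
move=> /andP[y0 y1]; apply/negP => /eqP /(congr1 (@complex.Re R))/=.
have p0 := pi_gt0 R.
have -> : 2 * pi * y = (pi * y) *+ 2 by rewrite -mulr_natl; ring.
rewrite cos_mulr2n cos2sin2.
have : 0 < sin (pi * y).
  apply: sin_gt0_pi; rewrite mulr_gt0//=.
  by rewrite -[ltRHS]mulr1 ltr_pM2l.
nra.
Qed.

Lemma expi2piX (y : R) n : expi2pi (y * n%:R) = expi2pi y ^+ n.
Proof.
elim: n => [|n IH]; first by rewrite mulr0 expr0 (expi2pi_int 0).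
by rewrite -natr1 mulrDr mulr1 expi2piD IH exprSr.
Qed.

Lemma sum_root_of_unity (k : int) :
  \sum_(i < L) expi2pi (k%:~R * ((i : nat)%:R / L%:R) : R) = ((L%:Z %| k)%Z * L)%:R.
Proof.
under eq_bigr do rewrite mulrCA mulrC expi2piX.
have [/dvdzP[q ->]|ndvd] := boolP (L%:Z %| k)%Z.
  rewrite intrM mulfK// expi2pi_int.
  under eq_bigr do rewrite expr1n.
  by rewrite sumr_const card_ord mul1n.
rewrite mul0n; set w := expi2pi _.
have wL : w ^+ L = 1 by rewrite -expi2piX divfK// expi2pi_int.
have w1 : w != 1.
  have -> : w = expi2pi ((k %% L)%Z%:~R / L%:R).
    rewrite /w {1}(divz_eq k L) intrD intrM mulrDl mulfK// expi2piD expi2pi_int mul1r.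
    by [].
  apply: expi2pi_neq1; rewrite divr_gt0 ?ltr0n ?ltr0z//=.
    rewrite ltr_pdivrMr ?ltr0n// mul1r.
    by have := ltz_pmod k (L0 : 0 < L%:Z); rewrite -(ltr_int R).
  by rewrite lt_neqAle modz_ge0 ?andbT ?eqz_nat -?lt0n// eq_sym; apply: contra ndvd => /eqP/dvdz_mod0P.
have /eqP : (w - 1) * (\sum_(i < L) w ^+ i) = 0 by rewrite -subrX1 wL subrr.
by rewrite mulf_eq0 subr_eq0 (negbTE w1)/= => /eqP.
Qed.

Lemma trig_char_prod (k : 'rV[int]_d) (x : 'rV[R]_d) :
  trig_char k x = \prod_j expi2pi ((k 0 j)%:~R * x 0 j).
Proof.
rewrite /trig_char; elim/big_rec2 : _ => [|j y z _ <-]; first by rewrite (expi2pi_int 0).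
by rewrite expi2piD.
Qed.

Lemma sum_grid_character (k : 'rV[int]_d) :
  \sum_t trig_char k (grid_point t) =
  (if [forall j, (L%:Z %| k 0%R j)%Z] then #|{: G}|%:R else 0) :> R[i].
Proof.
under eq_bigr do rewrite trig_char_prod.
rewrite (eq_bigr (fun t : G => \prod_j expi2pi ((k 0 j)%:~R * ((t j : nat)%:R / L%:R)))); last first.
  by move=> t _; apply: eq_bigr => j _; rewrite mxE.
rewrite -(bigA_distr_bigA (fun j (i : 'I_L) => expi2pi ((k 0 j)%:~R * ((i : nat)%:R / L%:R))))/=.
under eq_bigr do rewrite sum_root_of_unity.
case: forallP => [h|/forallP]; last first.
  rewrite negb_forall => /existsP[j hj].
  by rewrite (bigD1 j)//= (negbTE hj) mul0n mul0r.
rewrite (eq_bigr (fun=> L%:R)); last by move=> j _; rewrite h mul1n.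
by rewrite prodr_const card_ffun !card_ord natrX.
Qed.

Lemma sqr_normc_sum_char (I : finType) (c : I -> R[i]) (k : I -> 'rV[int]_d) (x : 'rV[R]_d) :
  ((normc (\sum_i c i * trig_char (k i) x) ^+ 2)%:C)%C =
  \sum_i \sum_i' (c i * (c i')^*%C) * trig_char (k i - k i') x.
Proof.
have -> (z : R[i]) : ((normc z ^+ 2)%:C)%C = z * (z^*)%C.
  by rewrite rmorphXn/= -sqr_normc.
rewrite rmorph_sum/= mulr_suml; apply: eq_bigr => i _.
rewrite mulr_sumr; apply: eq_bigr => i' _.
by rewrite rmorphM trig_charD trig_char_conj mulrACA.
Qed.

(** Orthogonality on the grid asks only for frequencies distinct modulo L. It serves twice: for the
    full set of residues, and for the cube [-K, K]^d when L > 2K. *)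
Lemma parseval_grid (I : finType) (c : I -> R[i]) (k : I -> 'rV[int]_d) :
  (forall i i', (forall j, (L%:Z %| (k i 0 j - k i' 0 j)%R)%Z) -> i = i') ->
  \sum_t normc (\sum_i c i * trig_char (k i) (grid_point t)) ^+ 2 =
  #|{: G}|%:R * \sum_i normc (c i) ^+ 2.
Proof.
move=> kinj; apply: (@complexI R).
rewrite rmorph_sum/=; under eq_bigr do rewrite sqr_normc_sum_char.
rewrite exchange_big rmorphM rmorph_nat rmorph_sum mulr_sumr/=; apply: eq_bigr => i _.
rewrite exchange_big/= (bigD1 i)//= [X in _ + X]big1 ?addr0 => [|i' i'i].
  rewrite -mulr_sumr subrr sum_grid_character; case: forallP => [_|[j]]; last first.
    by rewrite mxE dvdz0.
  by rewrite rmorphXn/= -sqr_normc mulrC.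
rewrite -mulr_sumr sum_grid_character; case: forallP => [h|_]; last by rewrite mulr0.
rewrite (kinj i i') ?eqxx// in i'i.
by move=> j; have := h j; rewrite !mxE.
Qed.

Lemma parseval_torus (I : finType) (c : I -> R[i]) (k : I -> 'rV[int]_d) : injective k ->
  (\int[haar d]_t ((normc (\sum_i c i * trig_char (k i) (torus_point t : 'rV[R]_d))) ^+ 2)%:E =
  (\sum_i normc (c i) ^+ 2)%:E)%E.
Proof.
move=> kinj.
pose f (x : 'rV[R]_d) : R[i] := \sum_i \sum_i' (c i * (c i')^*%C) * trig_char (k i - k i') x.
have if1 : torus_integrable f.
  apply: torus_integrable_sum => i; apply: torus_integrable_sum => i'.
  by apply: torus_integrableZ; exact: torus_integrable_char.
have fE : torus_integral f = ((\sum_i normc (c i) ^+ 2)%:C)%C.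
  rewrite torus_integral_sum; last first.
    move=> i; apply: torus_integrable_sum => i'.
    by apply: torus_integrableZ; exact: torus_integrable_char.
  rewrite rmorph_sum/=; apply: eq_bigr => i _.
  rewrite torus_integral_sum; last first.
    by move=> i'; apply: torus_integrableZ; exact: torus_integrable_char.
  rewrite (bigD1 i)//= big1 ?addr0 => [|i' i'i];
    rewrite torus_integralZ ?torus_integral_char; try exact: torus_integrable_char.
    by rewrite subrr eqxx mulr1 rmorphXn/= -sqr_normc.
  rewrite subr_eq0; case: eqVneq => [/kinj ii|]; last by rewrite mulr0.
  by rewrite ii eqxx in i'i.
have := congr1 (@complex.Re R) fE => /= <-.
rewrite /Rintegral fineK; last by case: if1 => h _; exact: integrable_fin_num h.
apply: eq_integral => t _; congr _%:E.
by rewrite -[LHS]/(complex.Re ((_)%:C)%C) sqr_normc_sum_char.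
Qed.

End grid.

Section Lp_norm_bounds.
Context {R : realType} {d : nat}.
Local Notation X := (d.-tuple (measurableTypeR R)).
Implicit Types (f : 'rV[R]_d -> R[i]).

Lemma Lp_norm_le (p M : R) f : 0 < p -> 0 <= M ->
  (\int[haar d]_t (normc (f (torus_point t)) `^ p)%:E <= (M `^ p)%:E)%E ->
  (Lp_norm p f <= M%:E)%E.
Proof.
move=> p0 M0 h; rewrite /Lp_norm unlock.
rewrite (eq_integral (fun t : X => (normc (f (torus_point t)) `^ p)%:E)); last first.
  by move=> t _; rewrite /= ger0_norm ?normc_ge0.
have -> : M%:E = ((M `^ p)%:E `^ p^-1)%E.
  by rewrite poweR_EFin -powRrM divff ?gt_eqF// powRr1.
have I0 : (0 <= \int[haar d]_t (normc (f (torus_point t)) `^ p)%:E)%E.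
  by apply: integral_ge0 => t _; rewrite lee_fin powR_ge0.
apply: gt0_ler_poweR => //.
- by rewrite invr_ge0 ltW.
- by rewrite in_itv/= I0 leey.
- by rewrite in_itv/= leey andbT (le_trans I0).
Qed.

Lemma bounded_Lp_norm_le (p M : R) f : 0 < p -> torus_measurable f ->
  (forall x, normc (f x) <= M) -> (Lp_norm p f <= M%:E)%E.
Proof.
move=> p0 mf fM; have M0 : 0 <= M by apply: le_trans (fM 0); exact: normc_ge0.
apply: Lp_norm_le => //.
apply: (@le_trans _ _ (\int[haar d]_t (M `^ p)%:E)%E).
  apply: ge0_le_integral.
  - by [].
  - by move=> t _; rewrite lee_fin powR_ge0.
  - apply/measurable_EFinP.
    exact: (@measurableT_comp _ _ _ _ _ _ (@powR R ^~ p) _ _ _ (torus_measurable_normc mf)).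
  - by [].
  - move=> t _; rewrite lee_fin; apply: ge0_ler_powR; rewrite ?nnegrE ?normc_ge0//.
    exact: ltW.
rewrite integral_cst// -[leRHS]mule1 lee_wpmul2l ?lee_fin ?powR_ge0//.
by rewrite -(probability_setT (haar d)); exact: lexx.
Qed.

Lemma bounded_Lp_space (p M : R) f : 0 < p -> torus_fun f -> torus_measurable f ->
  (forall x, normc (f x) <= M) -> Lp_space p f.
Proof.
move=> p0 pf mf fM; split=> //; split=> //.
exact: le_lt_trans (bounded_Lp_norm_le p0 mf fM) (ltry _).
Qed.

End Lp_norm_bounds.

(** * The kernel as a Fourier multiplier *)

Section convolution_of_characters.
Context {R : realType} {d : nat}.
Implicit Types (x : 'rV[R]_d).

Lemma partial_conv_char (r p : R) K (l : 'rV[int]_d) x : 1 < p ->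
  (forall j, `|l 0 j| <= K%:Z) ->
  partial_conv r K (trig_char l) x = (kernel_coef r l)%:C%C * trig_char l x.
Proof.
move=> p1 lK; rewrite (partial_convE r K (p := p))//; last first.
  apply: (@bounded_Lp_space _ _ p 1); first by lra.
  - exact: torus_fun_trig_char.
  - exact: torus_measurable_char.
  - by move=> y; rewrite normc_trig_char.
have coefE k : fourier_coef (trig_char l : 'rV[R]_d -> R[i]) k = (k == l)%:R.
  rewrite /fourier_coef (_ : (fun y => _) = trig_char (- k + l)).
    by rewrite torus_integral_char addrC subr_eq0 eq_sym.
  by apply/funext => y; rewrite trig_charD.
have hf j : (`|(K%:Z - l 0 j)%R| < (2 * K).+1)%N.
  by have := lK j; rewrite ler_norml => /andP[h1 h2]; lia.
pose f : {ffun 'I_d -> 'I_(2 * K).+1} := [ffun j => Ordinal (hf j)].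
have fl : frequency f = l.
  apply/rowP => j; rewrite mxE ffunE /=.
  by have := lK j; rewrite ler_norml => /andP[h1 h2]; lia.
rewrite /trig_poly (bigD1 f)//= coefE fl eqxx mulr1 big1 ?addr0// => g gf.
rewrite coefE; case: eqVneq => [gl|_]; last by rewrite mulr0 mul0r.
by move: gf; rewrite -fl in gl; rewrite (frequency_inj gl) eqxx.
Qed.

(** The truncated convolution no longer changes once K exceeds all frequencies, and it converges to
    [F_conv] by [conv_approximation]; so the Fourier coefficients of the singular kernel need not be
    integrated directly. *)
Lemma F_conv_sum_char (r p : R) (I : finType) (c : I -> R[i]) (l : I -> 'rV[int]_d) x :
  1 < p -> p^-1 < r ->
  F_conv r (fun y => \sum_i c i * trig_char (l i) y) x =
  \sum_i c i * ((kernel_coef r (l i))%:C%C * trig_char (l i) x).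
Proof.
move=> p1 pr; set phi := (fun y => _).
have [eta [C [eta0 C0 hC]]] := @conv_approximation R d r p p1 pr.
have Lphi : Lp_space p phi.
  apply: (@bounded_Lp_space _ _ p (\sum_i normc (c i))); first by lra.
  - exact: torus_fun_sum_char.
  - exact: torus_measurable_sum_char.
  - by move=> y; exact: normc_sum_char.
pose K0 := \sum_i \sum_j `|l i 0%R j|%N.
have lK0 i j : (`|l i 0%R j| <= K0)%N.
  rewrite /K0 (bigD1 i)//= (bigD1 j)//=; lia.
apply/eqP; rewrite -subr_eq0; apply/eqP/eq0_normc/eqP.
rewrite eq_le normc_ge0 andbT; apply/ler_addgt0Pr => e e0; rewrite add0r.
have [K K1 hK] := powRN_small (C * fine (Lp_norm p phi)) eta0 e0.
have KK : K%:R <= (K + K0)%:R :> R by rewrite ler_nat leq_addr.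
have Kp : (0 < K + K0)%N by rewrite addn_gt0 K1.
have pc : partial_conv r (K + K0) phi x =
    \sum_i c i * ((kernel_coef r (l i))%:C%C * trig_char (l i) x).
  rewrite /partial_conv (_ : (fun y => _) = (fun y => \sum_i c i *
      (partial_kernel r (K + K0) (x - y) * trig_char (l i) y))); last first.
    by apply/funext => y; rewrite mulr_sumr; apply: eq_bigr => i _; rewrite mulrCA.
  have it i : torus_integrable (fun y => partial_kernel r (K + K0) (x - y) * trig_char (l i) y).
    apply: (bounded_mul_integrable p1).
    - exact: torus_measurable_partial_kernel.
    - by move=> y; exact: partial_kernel_bounded.
    - apply: (@bounded_Lp_space _ _ p 1); first by lra.
      + exact: torus_fun_trig_char.
      + exact: torus_measurable_char.
      + by move=> y; rewrite normc_trig_char.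
  rewrite torus_integral_sum; last by move=> i; exact: torus_integrableZ.
  apply: eq_bigr => i _; rewrite torus_integralZ//.
  rewrite -[torus_integral _]/(partial_conv r (K + K0) (trig_char (l i)) x).
  rewrite (@partial_conv_char r p _ _ _ p1)// => j.
  by rewrite -abszE lez_nat (leq_trans (lK0 i j))// leq_addl.
rewrite -pc; apply: (le_trans (hC _ _ x Kp Lphi)); rewrite mulrAC.
apply: le_trans (ltW hK); rewrite ler_wpM2l ?mulr_ge0 ?fine_ge0 ?Lnorm_ge0//.
rewrite !powRN lef_pV2 ?posrE ?powR_gt0 ?ltr0n//.
by apply: ge0_ler_powR; rewrite ?nnegrE ?(ltW eta0).
Qed.

End convolution_of_characters.

(** * Lower bound for the width *)

Section width_lower_bound.
Context {R : realType} {d : nat}.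
Implicit Types (f : 'rV[R]_d.+1 -> R[i]).

Definition axis_freq (k : nat) : 'rV[int]_d.+1 := \row_j (k%:Z * (j == ord0)%:Z).

(* Fewer than N frequencies leave a residue class modulo N uncovered by their
   first coordinates; averaging over the N equispaced points of the first axis
   isolates that class. *)
Lemma sup_norm_ge_coef (N : nat) (c : 'I_N -> R[i]) (J : {fset 'rV[int]_d.+1})
    (b : 'rV[int]_d.+1 -> R[i]) (kappa : R) : (#|` J| < N)%N ->
  (forall k, kappa <= normc (c k)) ->
  (kappa%:E <= sup_norm (fun x => (\sum_k c k * trig_char (axis_freq k) x -
     \sum_(l <- J) b l * trig_char l x)%R))%E.
Proof.
move=> JN ck; have N0 : (0 < N)%N by exact: leq_ltn_trans JN.
have NR : N%:R != 0 :> R by rewrite pnatr_eq0 -lt0n.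
set g := (fun x => _).
pose pt (i : 'I_N) : 'rV[R]_d.+1 := \row_j ((i : nat)%:R / N%:R * (j == ord0)%:R).
have charE (l : 'rV[int]_d.+1) i : trig_char l (pt i) = expi2pi ((l 0 ord0)%:~R * ((i : nat)%:R / N%:R)).
  rewrite /trig_char (bigD1 ord0)//= big1 ?addr0 => [|j j0].
    by rewrite mxE eqxx mulr1.
  by rewrite mxE (negbTE j0) !mulr0.
pose red (l : 'rV[int]_d.+1) : nat := `|(l 0%R ord0 %% N)%Z|%N.
have redN l : (red l < N)%N.
  rewrite /red -ltz_nat gez0_abs ?ltz_pmod ?modz_ge0 ?eqz_nat -?lt0n//.
have [k hk] : exists k : 'I_N, k \notin [seq Ordinal (redN l) | l <- J].
  apply: contrapT => /forallNP h.
  have : (#|'I_N| <= size [seq Ordinal (redN l) | l <- J])%N.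
    apply: leq_trans (card_size _); apply/subset_leq_card/fintype.subsetP => k _.
    by apply: contrapT => /negP; exact: h.
  by rewrite card_ord size_map leqNgt JN.
have avg (l : 'rV[int]_d.+1) :
    \sum_i trig_char l (pt i) * expi2pi (- (k : nat)%:R * ((i : nat)%:R / N%:R)) =
    ((N%:Z %| l 0%R ord0 - (k : nat)%:Z)%Z * N)%:R.
  rewrite -(sum_root_of_unity N0); apply: eq_bigr => i _.
  by rewrite charE -expi2piD -mulrDl intrB.
have total : \sum_i g (pt i) * expi2pi (- (k : nat)%:R * ((i : nat)%:R / N%:R)) = c k * N%:R.
  rewrite /g; under eq_bigr do rewrite mulrBl !mulr_suml.
  rewrite sumrB exchange_big/= [X in _ - X]exchange_big/=.
  rewrite [X in _ - X]big1_seq ?subr0; last first.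
    move=> l /andP[_ lJ]; under eq_bigr do rewrite -mulrA.
    rewrite -mulr_sumr avg; case: (boolP (N%:Z %| _)%Z) => [hl|_]; last by rewrite mul0n mulr0.
    exfalso; move: hk => /negP; apply; apply/mapP; exists l => //; apply: val_inj => /=.
    apply/eqP; rewrite -eqz_nat /red gez0_abs ?modz_ge0 ?eqz_nat -?lt0n//.
    move: hl; rewrite -eqz_mod_dvd => /eqP ->.
    by rewrite modz_small ?eqxx//= ltz_nat ltn_ord.
  rewrite (bigD1 k)//= [X in _ + X]big1 ?addr0 => [|k' k'k];
    under eq_bigr do rewrite -mulrA; rewrite -mulr_sumr avg mxE eqxx mulr1.
    by rewrite subrr dvdz0 mul1n.
  case: (boolP (N%:Z %| _)%Z) => [|_]; last by rewrite mul0n mulr0.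
  rewrite -eqz_mod_dvd !modz_small ?ltz_nat ?ltn_ord// eqz_nat => /eqP kk.
  by exfalso; move: k'k => /negP; apply; apply/eqP/val_inj.
have [i hi] : exists i, kappa <= normc (g (pt i)).
  apply: contrapT => /forallNP h.
  have hlt i : normc (g (pt i)) < kappa by rewrite ltNge; exact/negP/h.
  have : normc (c k * N%:R) < kappa * N%:R.
    rewrite -total; apply: (le_lt_trans (ler_normc_sum _ _ _)).
    apply: (@lt_le_trans _ _ (\sum_(i < N) kappa)); last first.
      by rewrite sumr_const card_ord mulr_natr.
    apply: ltr_sum => [|i _]; last by rewrite normcM normc_expi2pi mulr1.
    by apply/hasP; exists (Ordinal N0); rewrite ?mem_index_enum.
  rewrite normcM; have -> : normc (N%:R : R[i]) = N%:R.
    by rewrite -(rmorph_nat (real_complex R)) normc_real ger0_norm.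
  by rewrite ltNge ler_wpM2r.
apply: (@le_trans _ _ (normc (g (pt i)))%:E); first by rewrite lee_fin.
by apply: ereal_sup_ubound; exists (pt i).
Qed.

(** The test density is the average of n + 1 characters along one axis. It is bounded by one, so its
    norm is at most one for every p, and convolution leaves n + 1 coefficients of at least the
    stated size, one more than n frequencies can cancel. *)
Lemma width_lower_bound (r p : R) (n : nat) : 1 < p -> p^-1 < r ->
  ((n.+1%:R^-1 * n.+1%:R `^ (- r))%:E <=
   best_nterm_width (@SW_norm R r p d.+1) n)%E.
Proof.
move=> p1 pr; have p0 : 0 < p by lra.
have r0 : 0 < r by apply: lt_trans pr; rewrite invr_gt0.
have n0 : 0 < n.+1%:R :> R by rewrite ltr0n.
pose a : R[i] := (n.+1%:R^-1)%:C%C.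
pose phi (x : 'rV[R]_d.+1) : R[i] := \sum_(k < n.+1) a * trig_char (axis_freq k) x.
pose c (k : 'I_n.+1) : R[i] := a * (kernel_coef r (axis_freq k))%:C%C.
pose f (x : 'rV[R]_d.+1) : R[i] := \sum_(k < n.+1) c k * trig_char (axis_freq k) x.
have na : normc a = n.+1%:R^-1 by rewrite normc_real ger0_norm.
have phi1 x : normc (phi x) <= 1.
  apply: (le_trans (normc_sum_char _ _ _ _)).
  under eq_bigr do rewrite na.
  by rewrite sumr_const card_ord -[_ *+ _]mulr_natr mulVf// gt_eqF.
have mphi : torus_measurable phi by exact: torus_measurable_sum_char.
have Lphi : Lp_space p phi.
  by apply: (bounded_Lp_space p0 _ mphi phi1); exact: torus_fun_sum_char.
have dens : SW_density r p f phi.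
  split=> //; apply: aeW => t.
  rewrite (F_conv_sum_char _ _ _ p1 pr); apply: eq_bigr => k _.
  by rewrite mulrA.
have Sf : SW_space r p f.
  split; first exact: torus_fun_sum_char.
  by split; [exact: continuous_sum_char|exists phi].
have Nf : (SW_norm r p f <= 1)%E.
  apply: (@le_trans _ _ (Lp_norm p phi)); last exact: bounded_Lp_norm_le.
  by apply: ereal_inf_lbound; exists phi.
have coef k : n.+1%:R^-1 * n.+1%:R `^ (- r) <= normc (c k).
  rewrite normcM na ler_wpM2l ?invr_ge0// normc_real.
  have -> : kernel_coef r (axis_freq k) = (Num.max 1 (k : nat)%:R) `^ (- r) :> R.
    rewrite /kernel_coef (bigD1 ord0)//= big1 ?mulr1 => [|j j0].
      by rewrite mxE eqxx mulr1 ger0_norm.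
    by rewrite mxE (negbTE j0) mulr0 normr0 max_l// powR1.
  have m0 : 0 < Num.max 1 (k : nat)%:R :> R by rewrite lt_max ltr01.
  rewrite ger0_norm ?powR_ge0// !powRN lef_pV2 ?posrE ?powR_gt0//.
  apply: ge0_ler_powR; rewrite ?nnegrE ?(ltW r0) ?(ltW m0)//.
  by rewrite ge_max ler1n ltn0Sn/= ler_nat ltnW.
apply: (@le_trans _ _ (ereal_inf [set sup_norm (fun x => (f x - \sum_(k <- J) b k * trig_char k x)%R) |
    J in [set J : {fset 'rV[int]_d.+1} | (#|` J| <= n)%N] &
    b in [set: 'rV[int]_d.+1 -> R[i]]])); last first.
  by apply: ereal_sup_ubound; exists f.
apply: le_ereal_inf_tmp => _ [J /= Jn [b _ <-]].
exact: sup_norm_ge_coef.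
Qed.

End width_lower_bound.

(** * Recovery *)

Section aliasing.
Context {R : realType} {d L : nat}.
Hypothesis L0 : (0 < L)%N.
Local Notation G := {ffun 'I_d -> 'I_L}.

Definition grid_freq (k : G) : 'rV[int]_d := \row_j (k j : nat)%:Z.

Definition grid_char (k t : G) : R[i] := trig_char (grid_freq k) (grid_point t).

Lemma grid_freq_inj_mod (k l : G) :
  (forall j, (L%:Z %| (grid_freq k 0 j - grid_freq l 0 j)%R)%Z) -> k = l.
Proof.
move=> h; apply/ffunP => j; apply/val_inj; have := h j.
by rewrite !mxE -eqz_mod_dvd !modz_small ?ltz_nat ?ltn_ord// eqz_nat => /eqP.
Qed.

Lemma grid_char_parseval (c : G -> R[i]) :
  \sum_t normc (combination grid_char c t) ^+ 2 = #|{: G}|%:R * \sum_k normc (c k) ^+ 2.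
Proof. exact: (parseval_grid L0 c grid_freq_inj_mod). Qed.

Lemma residue_lt (a : int) : (`|(a %% L)%Z| < L)%N.
Proof. by rewrite -ltz_nat gez0_abs ?ltz_pmod ?modz_ge0 ?eqz_nat -?lt0n. Qed.

Definition freq_residue (k : 'rV[int]_d) : G := [ffun j => Ordinal (residue_lt (k 0 j))].

(** The two frequencies differ by multiples of L in each coordinate, and such characters equal one
    on the grid. *)
Lemma trig_char_residue (k : 'rV[int]_d) (t : G) :
  trig_char k (grid_point t : 'rV[R]_d) = grid_char (freq_residue k) t.
Proof.
rewrite /grid_char -[in LHS](subrK (grid_freq (freq_residue k)) k) trig_charD.
rewrite -[RHS]mul1r; congr (_ * _).
rewrite trig_char_prod big1// => j _; rewrite !mxE ffunE/= gez0_abs ?modz_ge0 ?eqz_nat -?lt0n//.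
have -> : k 0 j - (k 0%R j %% L)%Z = (k 0%R j %/ L)%Z * L%:Z.
  by rewrite {1}(divz_eq (k 0 j) L) addrK.
rewrite -(expi2pi_int ((k 0%R j %/ L)%Z * (t j : nat)%:Z)) !intrM; congr expi2pi.
by field; rewrite pnatr_eq0 -lt0n.
Qed.

(** Coefficients in one residue class are added up, which cannot increase the number of nonzero
    ones. The frequencies in [J] may be of any size. *)
Lemma aliasing (J : {fset 'rV[int]_d}) (c : 'rV[int]_d -> R[i]) :
  exists a : G -> R[i], (#|[pred k | a k != 0%R]| <= #|` J|)%N /\
    forall t, \sum_(k <- J) c k * trig_char k (grid_point t) = combination grid_char a t.
Proof.
exists (fun k => \sum_(l <- J | freq_residue l == k) c l); split.
  rewrite -(size_map freq_residue); apply: leq_trans (card_size _).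
  apply/subset_leq_card/fintype.subsetP => k; rewrite inE => ak.
  apply: contrapT => /negP/mapP h; move/negP: ak; apply.
  rewrite big1_seq// => l /andP[/eqP lk lJ].
  by exfalso; apply: h; exists l.
move=> t; rewrite /combination.
under [RHS]eq_bigr do rewrite mulr_suml.
rewrite (exchange_big_dep xpredT)//=; apply: eq_bigr => l _.
by rewrite (big_pred1 (freq_residue l)) ?trig_char_residue// => k; rewrite /= eq_sym.
Qed.

End aliasing.

(** * From the grid to the torus *)

Section recovery_error.
Context {R : realType} {d : nat}.
Local Notation X := (d.-tuple (measurableTypeR R)).
Implicit Types (f g h s : 'rV[R]_d -> R[i]).

Lemma sqr_le_2D (a b c : R) : 0 <= a -> a <= b + c -> a ^+ 2 <= 2 * b ^+ 2 + 2 * c ^+ 2.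
Proof.
move=> a0 abc; apply: (@le_trans _ _ ((b + c) ^+ 2)).
  by rewrite lerXn2r ?nnegrE ?(le_trans a0).
by rewrite -subr_ge0 (_ : _ - _ = (b - c) ^+ 2) ?sqr_ge0//; ring.
Qed.

(* The error is compared on the grid with the sparse polynomial [combination a],
   to which the sampling inequality applies, and off the grid with [trig_poly c],
   whose L2 norm is computed exactly by the grid since L > 2K. *)
Lemma recovery_error (L K : nat) (h : 'rV[R]_d -> R[i]) (sigma : R)
    (c : {ffun 'I_d -> 'I_(2 * K).+1} -> R[i]) (a : {ffun 'I_d -> 'I_L} -> R[i]) :
  (2 * K < L)%N -> 0 <= sigma -> torus_measurable h ->
  (forall x, normc (h x - trig_poly c x) <= 2 * sigma) ->
  (forall t, normc (h (grid_point t) - combination grid_char a t) <= 4 * sigma) ->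
  \sum_k normc (a k) ^+ 2 <= 8 * (4 * sigma) ^+ 2 ->
  (Lp_norm 2 h <= (26 * sigma)%:E)%E.
Proof.
move=> KL s0 mh hc ha a2.
have L0 : (0 < L)%N by exact: leq_ltn_trans KL.
set N : R := #|{: {ffun 'I_d -> 'I_L}}|%:R.
have N0 : 0 < N.
  by rewrite ltr0n card_ffun !card_ord expn_gt0 L0.
have inj i i' : (forall j, (L%:Z %| (frequency i 0 j - frequency i' 0 j)%R)%Z) -> i = i'
    :> {ffun 'I_d -> 'I_(2 * K).+1}.
  move=> hd; apply: frequency_inj; apply/rowP => j; apply/eqP; rewrite -subr_eq0.
  have := hd j; set z := (_ - _) => /dvdzP[w zw].
  have zb : (`|z| < L)%N.
    rewrite /z !mxE; have := ltn_ord (i j); have := ltn_ord (i' j); lia.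
  have : (`|z| = `|w| * L)%N by rewrite zw abszM.
  case: (posnP `|w|%N) => [w0 _|w0 zwL].
    by move/eqP: w0; rewrite zw absz_eq0 => /eqP ->; rewrite mul0r.
  by move: zb; rewrite zwL -[ltnRHS]mul1n ltn_pmul2r// ltnNge w0.
have Pgrid := parseval_grid L0 c inj.
have Ptorus := parseval_torus c (@frequency_inj d K).
set S := \sum_f normc (c f) ^+ 2 in Pgrid Ptorus.
(* On the grid [trig_poly c] and [combination grid_char a] differ by at most 2 sigma + 4 sigma, and
   328 = 2 * 8 * 4^2 + 2 * 6^2. *)
have S_le : S <= 328 * sigma ^+ 2.
  rewrite -(ler_pM2l N0) -Pgrid.
  apply: (@le_trans _ _ (\sum_t (2 * normc (combination grid_char a t) ^+ 2 + 2 * (6 * sigma) ^+ 2))).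
    apply: ler_sum => t _; apply: sqr_le_2D; first exact: normc_ge0.
    have h1 := hc (grid_point t); have h2 := ha t; rewrite normc_distC in h1.
    set z := trig_poly c _ in h1 *; set y := h _ in h1 h2; set w := combination _ _ _ in h2 *.
    have zE : z = w + (y - w) + (z - y) by rewrite [w + _]addrC subrK addrC subrK.
    rewrite -[X in normc X]/z zE.
    apply: (le_trans (ler_normcD _ _)); have := ler_normcD w (y - w); lra.
  rewrite big_split/= -mulr_sumr (grid_char_parseval L0) sumr_const -/N -[_ *+ _]mulr_natl -/N.
  move: a2; set A := \sum_k _ => a2.
  have : N * A <= N * (8 * (4 * sigma) ^+ 2) by rewrite ler_pM2l.
  rewrite !exprMn; lra.
have mT : measurable_fun [set: X]
    (fun t => ((normc (trig_poly c (torus_point t)) ^+ 2)%:E)).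
  apply/measurable_EFinP; apply: measurable_funX; apply: torus_measurable_normc.
  exact: torus_measurable_sum_char.
apply: Lp_norm_le => //; first by rewrite mulr_ge0.
rewrite powR_mulrn ?mulr_ge0//.
apply: (@le_trans _ _ (\int[haar d]_t (2%:E * ((normc (trig_poly c (torus_point t)) ^+ 2)%:E)
    + (2 * (2 * sigma) ^+ 2)%:E))%E).
  apply: ge0_le_integral.
  - by [].
  - by move=> t _; rewrite lee_fin powR_ge0.
  - apply/measurable_EFinP.
    exact: (@measurableT_comp _ _ _ _ _ _ (@powR R ^~ 2) _ _ _ (torus_measurable_normc mh)).
  - by apply: emeasurable_funD => //; apply: emeasurable_funM.
  - move=> t _; rewrite -EFinM -EFinD lee_fin powR_mulrn ?normc_ge0//.
    apply: sqr_le_2D; first exact: normc_ge0.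
    rewrite -[h _](subrK (trig_poly c (torus_point t))) addrC.
    by rewrite (le_trans (ler_normcD _ _))// lerD2l.
rewrite ge0_integralD; last 5 first.
- by [].
- by move=> t _; rewrite -EFinM lee_fin mulr_ge0 ?sqr_ge0.
- exact: emeasurable_funM.
- by move=> t _; rewrite lee_fin mulr_ge0 ?sqr_ge0.
- by [].
rewrite ge0_integralZl; last 4 first.
- by [].
- exact: mT.
- by move=> t _; rewrite lee_fin sqr_ge0.
- by [].
rewrite Ptorus integral_cst// [X in (_ + _ * X)%E](_ : _ = 1%E); last exact: (probability_setT (haar d)).
rewrite mule1 -EFinM -EFinD lee_fin !exprMn.
(* 2 * 328 + 2 * 2^2 = 664, just below 26^2 = 676. *)
have fin (x y : R) : x <= 328 * y -> 0 <= y -> 2 * x + 2 * (2 ^+ 2 * y) <= 26 ^+ 2 * y by lra.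
by apply: fin => //; exact: sqr_ge0.
Qed.

End recovery_error.

(** * Choice of the parameters *)

Section parameters.
Context {R : realType}.

Lemma ln2_ge_half : 1 / 2 <= ln 2 :> R.
Proof.
have := @le_ln1Dx R (- (1 / 2)); have -> : 1 + - (1 / 2) = 2^-1 :> R by field.
rewrite lnV ?posrE// => h.
have : - ln 2 <= - (1 / 2) :> R by apply: h; lra.
lra.
Qed.

(** Powers of n + 1 are used rather than powers of n, so that constants can be absorbed: already at
    n = 1 the base is at least 2 and its logarithm at least 1/2. *)
Lemma sampling_parameters (A eta C r : R) (d : nat) : 0 < A -> 0 < eta -> 0 <= C ->
  exists2 C0 : R, 0 < C0 & forall n, (0 < n)%N ->
  exists K L : nat, [/\ (0 < K)%N, (2 * K < L)%N, (2 * n <= L ^ d.+1)%N,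
    C * K%:R `^ (- eta) <= n.+1%:R^-1 * n.+1%:R `^ (- r) &
    A * (up_log 2 (2 * n)).+1%:R * (2 * n)%:R *
      ln (4 * (L ^ d.+1)%:R) ^+ 2 <= C0 * n%:R * ln n.+1%:R ^+ 3].
Proof.
move=> A0 eta0 C_ge0.
(* K = (n+1)^a makes K^(- eta) beat (n+1)^(-1-r) with a surplus power 2 C, which absorbs the factor
   [C]. *)
pose a := (Num.truncn ((1 + r + 2 * C) / eta)).+1.
have ha : 1 + r + 2 * C <= a%:R * eta.
  by rewrite -ler_pdivrMr// ltW// truncnS_gt.
(* As L <= (n+1)^(a+4) and 4 <= (n+1)^2, the number 4 L^(d+1) is at most (n+1)^b. *)
pose b : nat := (d.+1 * (a + 4) + 2)%N.
exists (A * 16 * b%:R ^+ 2); first by rewrite !mulr_gt0// exprn_gt0// ltr0n /b addn2.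
move=> n n0; have n1 : 0 < n.+1%:R :> R by rewrite ltr0n.
have n2 : 2 <= n.+1%:R :> R by rewrite ler_nat.
have l2 := ln2_ge_half.
have ln0 : 0 <= ln n.+1%:R :> R by rewrite ln_ge0// ler1n.
(* 2 (n+1)^a + 1 exceeds 2K, for exactness on the grid; the added 2n provides at least 2n
   residues. *)
have [L LE] : {L | L = 2 * n.+1 ^ a + 2 * n + 1}%N by eexists.
exists (n.+1 ^ a)%N, L.
have L0 : (0 < L)%N by rewrite LE addn1.
have LL : (L <= n.+1 ^ (a + 4))%N.
  have h1 : (0 < n.+1 ^ a)%N by rewrite expn_gt0.
  have h2 : (n.+1 <= n.+1 ^ a)%N by rewrite /a -{1}(expn1 n.+1) leq_exp2l.
  have h3 : (8 <= n.+1 ^ 4)%N.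
    by apply: (@leq_trans (2 ^ 4)) => //; rewrite leq_exp2r.
  apply: (@leq_trans (8 * n.+1 ^ a)); first by rewrite LE; lia.
  by rewrite expnD mulnC leq_mul2l h3 orbT.
split.
- by rewrite expn_gt0.
- by rewrite LE; lia.
- apply: (@leq_trans (L ^ 1)%N); last by rewrite leq_exp2l// LE; lia.
  by rewrite expn1 LE; lia.
- rewrite natrX -powR_mulrn ?(ltW n1)// -powRrM.
  have -> : n.+1%:R^-1 * n.+1%:R `^ (- r) =
      n.+1%:R `^ (a%:R * - eta) * n.+1%:R `^ (a%:R * eta - (1 + r)) :> R.
    rewrite -powR_inv1 ?(ltW n1)// -!powRD ?pnatr_eq0 ?implybT//; congr (_ `^ _); ring.
  rewrite [leLHS]mulrC ler_wpM2l ?powR_ge0//.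
  (* C <= 1 + 2 C ln 2 <= 2^(2 C), since ln 2 >= 1/2. *)
  apply: (@le_trans _ _ (2 `^ (2 * C))).
    rewrite powR_expR//; apply: le_trans (expR_ge1Dx _); nra.
  apply: (@le_trans _ _ (n.+1%:R `^ (2 * C))).
    by apply: ge0_ler_powR; rewrite ?nnegrE ?mulr_ge0.
  by rewrite ler_powR ?ler1n//; lra.
have J8 : (up_log 2 (2 * n)).+1%:R <= 8 * ln n.+1%:R :> R.
  have hJ : (2 ^ (up_log 2 (2 * n)).+1 <= n.+1 ^ 4)%N.
    have n22 : (1 < 2 * n)%N by lia.
    have := up_log_gtn (isT : 1 < 2)%N n22.
    have : (0 < up_log 2 (2 * n))%N by rewrite up_log_gt0.
    case: (up_log 2 (2 * n)) => // J' _ /= hJ'.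
    apply: (@leq_trans (8 * n.+1)); first by rewrite !expnS; lia.
    by rewrite expnSr leq_mul2r; apply/orP; right; rewrite (@leq_trans (2 ^ 3))// leq_exp2r.
  have : ln ((2 ^ (up_log 2 (2 * n)).+1)%:R) <= ln ((n.+1 ^ 4)%:R) :> R.
    by rewrite ler_ln ?posrE ?ltr0n ?expn_gt0// ler_nat.
  move: (up_log 2 (2 * n)).+1 => J.
  rewrite (natrX _ 2%N) (natrX _ n.+1) !lnXn// -[ln 2 *+ J]mulr_natl -[_ *+ 4]mulr_natl => h.
  have : J%:R * (1 / 2) <= J%:R * ln 2 :> R by rewrite ler_wpM2l.
  lra.
have lnb : ln (4 * (L ^ d.+1)%:R) <= b%:R * ln n.+1%:R :> R.
  rewrite [b%:R * _]mulr_natl -lnXn// ler_ln ?posrE ?mulr_gt0 ?exprn_gt0 ?ltr0n ?expn_gt0 ?L0//.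
  rewrite -natrX -natrM ler_nat /b expnD mulnC leq_mul//.
    by rewrite mulnC expnM leq_exp2r.
  by rewrite (@leq_trans (2 ^ 2))// leq_exp2r.
have ln0' : 0 <= ln (4 * (L ^ d.+1)%:R) :> R.
  by rewrite ln_ge0// -natrM ler1n muln_gt0 expn_gt0 L0.
have lnb2 : ln (4 * (L ^ d.+1)%:R) ^+ 2 <= (b%:R * ln n.+1%:R) ^+ 2 :> R.
  by rewrite lerXn2r ?nnegrE ?mulr_ge0.
set l := ln n.+1%:R in ln0 J8 lnb2 *.
apply: (@le_trans _ _ (A * (8 * l) * (2 * n)%:R * (b%:R * l) ^+ 2)).
  apply: ler_pM => //; first by rewrite !mulr_ge0 ?(ltW A0).
    by rewrite sqr_ge0.
  by rewrite ler_wpM2r// ler_wpM2l// ltW.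
by rewrite natrM le_eqVlt; apply/orP; left; apply/eqP; ring.
Qed.

End parameters.

(** * Consistent recovery and the final estimate *)

Section recovery.
Context {R : realType} {d : nat}.
Implicit Types (f g : 'rV[R]_d -> R[i]).

Lemma normc_sub_sub (x y z w : R[i]) :
  normc (x - y - (z - w)) <= normc (x - z) + normc (y - w).
Proof.
have -> : x - y - (z - w) = (x - z) - (y - w) by ring.
exact: ler_normcB.
Qed.

(** The infimum over sparse polynomials may not be attained; since s > 0, the value 2 s lies
    strictly above it. *)
Lemma near_best_sparse (N : ('rV[R]_d -> R[i]) -> \bar R) (n : nat) (s : R) f :
  best_nterm_width N n = s%:E -> 0 < s -> (N f <= 1)%E ->
  exists (J : {fset 'rV[int]_d}) (c : 'rV[int]_d -> R[i]), (#|` J| <= n)%N /\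
    forall x, normc (f x - \sum_(k <- J) c k * trig_char k x) <= 2 * s.
Proof.
move=> hs s0 Nf.
have lt2 : (ereal_inf [set sup_norm (fun x => (f x - \sum_(k <- J) c k * trig_char k x)%R) |
    J in [set J : {fset 'rV[int]_d} | (#|` J| <= n)%N] &
    c in [set: 'rV[int]_d -> R[i]]] < (2 * s)%:E)%E.
  apply: (@le_lt_trans _ _ s%:E); last by rewrite lte_fin; lra.
  by rewrite -hs; apply: ereal_sup_ubound; exists f.
have [_ [J /= Jn [c _ <-]] supJ] := ereal_inf_lt lt2.
exists J, c; split=> // x; rewrite -lee_fin; apply: le_trans (ltW supJ).
by apply: ereal_sup_ubound; exists x.
Qed.

(* Any element of the unit ball with the given samples will do. *)
Definition consistent_recovery (N : ('rV[R]_d -> R[i]) -> \bar R) m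
    (t : 'I_m -> 'rV[R]_d) (z : 'rV[R[i]]_m) : 'rV[R]_d -> R[i] :=
  match pselect (exists g, (N g <= 1)%E /\ \row_i g (t i) = z) with
  | left h => projT1 (cid h)
  | right _ => fun=> 0
  end.

Lemma consistent_recoveryP (N : ('rV[R]_d -> R[i]) -> \bar R) m
    (t : 'I_m -> 'rV[R]_d) f : (N f <= 1)%E ->
  let g := consistent_recovery N t (\row_i f (t i)) in
  (N g <= 1)%E /\ forall i, g (t i) = f (t i).
Proof.
move=> Nf; rewrite /consistent_recovery; case: pselect => [h|[]]; last by exists f.
case: (cid h) => g [Ng gt]; split=> // i.
by have := congr1 (fun u : 'rV_m => u 0 i) gt; rewrite !mxE.
Qed.

End recovery.

Theorem corollary4p14 (R : realType) (d : nat) (p r : R)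
    (hd : (0 < d)%N) (hp : 1 < p) (hr : p^-1 < r) :
  exists2 C : R, 0 < C &
  exists2 c : R, 0 < c &
  forall n : nat, (0 < n)%N ->
    (sampling_number (@SW_norm R r p d) 2
       `|Num.ceil (C * n%:R * ln (n.+1%:R) ^+ 3)|%N
     <= c%:E * best_nterm_width (@SW_norm R r p d) n)%E.
Proof.
case: d hd => // d _.
have [eta [C [eta0 C0 happrox]]] := @unit_ball_approximation R d.+1 r p hp hr.
have A0 : 0 < 4 * (64 * 256 + 3) :> R by rewrite mulr_gt0// addr_gt0// mulr_gt0.
have [C1 C10 hparam] := sampling_parameters r d A0 eta0 C0.
exists C1 => //; exists 26 => // n n0.
set m := `|_|%N.
have kappa0 : 0 < n.+1%:R^-1 * n.+1%:R `^ (- r) :> R.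
  by rewrite mulr_gt0 ?powR_gt0 ?invr_gt0 ?ltr0n.
have := @width_lower_bound R d r p n hp hr.
(* The value -oo contradicts the lower bound, and +oo makes the claim trivial; otherwise the lower
   bound makes s positive. *)
case hs : (best_nterm_width _ n) => [s| |] //;
  last by rewrite gt0_muley ?leey ?lte_fin.
rewrite lee_fin => kappa_le.
have s0 : 0 < s by exact: lt_le_trans kappa_le.
have [K [L [K0 KL nL CK hm]]] := hparam n n0.
have L0 : (0 < L)%N by exact: leq_ltn_trans KL.
have cardG : #|{: {ffun 'I_d.+1 -> 'I_L}}| = (L ^ d.+1)%N by rewrite card_ffun !card_ord.
have mge : C1 * n%:R * ln n.+1%:R ^+ 3 <= m%:R.
  have z0 : 0 <= C1 * n%:R * ln n.+1%:R ^+ 3.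
    by rewrite !mulr_ge0 ?exprn_ge0 ?ln_ge0 ?ler1n// ltW.
  apply: (le_trans (ceil_ge _)).
  have c0 : 0 <= Num.ceil (C1 * n%:R * ln n.+1%:R ^+ 3).
    by rewrite -(ler_int R); apply: le_trans z0 (ceil_ge _).
  by rewrite /m -{1}(gez0_abs c0).
(* Sparsity 2n, because f - g is compared with a difference of two n-sparse polynomials. *)
have [tg htg] : exists t : 'I_m -> {ffun 'I_d.+1 -> 'I_L},
    forall (a : {ffun 'I_d.+1 -> 'I_L} -> R[i]) (b : R),
    (#|[pred k | a k != 0%R]| <= 2 * n)%N ->
    (forall i, normc (combination grid_char a (t i)) <= b) ->
    \sum_k normc (a k) ^+ 2 <= 8 * b ^+ 2.
  apply: sparse_sampling.
  - by rewrite cardG expn_gt0 L0.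
  - by [].
  - by move=> k t; rewrite normc_trig_char.
  - by move=> a; exact: grid_char_parseval.
  - by rewrite muln_gt0.
  - by rewrite cardG.
  - by rewrite cardG; exact: le_trans hm mge.
pose N := @SW_norm R r p d.+1.
pose t i : 'rV[R]_d.+1 := grid_point (tg i).
apply: (@le_trans _ _ (ereal_sup [set Lp_norm 2 (fun x =>
    (f x - consistent_recovery N t (\row_i f (t i)) x)%R) | f in [set f | (N f <= 1)%E]])).
  apply: ereal_inf_lbound; exists t => //; exists (consistent_recovery N t) => //= z.
  (* The recovery map must take values in L^2 for every data vector; data that no element of the
     ball realizes are sent to zero. *)
  rewrite /consistent_recovery; case: pselect => [h|_]; last first.
    apply: (@bounded_Lp_space _ _ 2 0) => //.
    by move=> x; rewrite normc0.
  case: (cid h) => g [Ng _] /=.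
  have [M gM] := unit_ball_bounded hp hr Ng.
  apply: (bounded_Lp_space _ _ _ gM) => //; last exact: unit_ball_measurable hp hr Ng.
  by have [[pg _] _] := SW_norm_le1_density Ng.
apply: ge_ereal_sup => _ [f /= Nf <-].
have [Ng gt] := consistent_recoveryP t Nf.
set g := consistent_recovery _ _ _ in Ng gt *.
have [cf hcf] := happrox f K Nf K0; have [cg hcg] := happrox g K Ng K0.
have [Jf [bf [Jfn hf]]] := near_best_sparse hs s0 Nf.
have [Jg [bg [Jgn hg]]] := near_best_sparse hs s0 Ng.
have [af [afn haf]] := aliasing L0 Jf bf; have [ag [agn hag]] := aliasing L0 Jg bg.
pose a k := af k - ag k.
have aE u : combination grid_char a u = combination grid_char af u - combination grid_char ag u.
  by rewrite /combination -sumrB; apply: eq_bigr => k _; rewrite mulrBl.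
have ha u : normc (f (grid_point u) - g (grid_point u) - combination grid_char a u) <= 4 * s.
  rewrite aE -haf -hag (le_trans (normc_sub_sub _ _ _ _))//.
  have := hf (grid_point u); have := hg (grid_point u); lra.
rewrite -EFinM; apply: (@recovery_error R d.+1 L K _ s (fun k => cf k - cg k) a) => //.
- exact: ltW.
- apply: torus_measurableD; first exact: unit_ball_measurable hp hr Nf.
  by apply: torus_measurableN; exact: unit_ball_measurable hp hr Ng.
- move=> x.
  have -> : trig_poly (fun k => cf k - cg k) x = trig_poly cf x - trig_poly cg x.
    by rewrite /trig_poly -sumrB; apply: eq_bigr => k _; rewrite mulrBl.
  (* The truncation error is below the lower bound for the width, hence below s; f and g together
     account for 2 s. *)
  have tail_le := le_trans CK kappa_le.
  rewrite (le_trans (normc_sub_sub _ _ _ _))// mulr_natl mulr2n.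
  by rewrite lerD// (le_trans _ tail_le).
apply: htg.
  rewrite mul2n -addnn; apply: leq_trans (leq_add (leq_trans afn Jfn) (leq_trans agn Jgn)).
  rewrite -cardUI (leq_trans _ (leq_addr _ _))//.
  apply/subset_leq_card/fintype.subsetP => k; rewrite !inE => ak.
  rewrite -negb_and; apply: contra ak => /andP[/eqP ak0 /eqP bk0].
  by rewrite /a ak0 bk0 subrr.
(* At a sampling point f - g vanishes, so the combination there is bounded by its own distance 4 s
   to f - g. *)
move=> i; have := ha (tg i); have := gt i; rewrite /t => ->.
by rewrite subrr sub0r normc_opp.
Qed.
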